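(* Let $\mathcal{M}$ be the Vámos matroid, i.e. the rank $4$ matroid on $\{0,1,\dots,7\}$ in which all four-element subsets are bases except $$\{0,1,3,4\},\ \{0,1,2,5\},\ \{2,3,4,5\},\ \{3,4,6,7\},\ \{2,5,6,7\}.$$ Modulo lineality and intersecting with a sphere, the Dressian $\mathrm{Dr}_{\mathcal{M}}$ is an $8$-dimensional polyhedral complex with $f$-vector $$(201,\ 2014,\ 6810,\ 9581,\ 5425,\ 896,\ 72,\ 18,\ 2).$$
   Context: For a matroid $\mathcal{M}$ of rank $d$ on a finite set $E$ with bases $\mathcal{B}$, let $G_{\mathcal{M}}$ be the set of polynomials in the variables $p_\sigma$, $\sigma\in\mathcal{B}$, obtained from the three-term Plücker relations $p_{Sij}p_{Skl}-p_{Sik}p_{Sjl}+p_{Sil}p_{Sjk}$ ($S\in\binom{E}{d-2}$, $i,j,k,l$ distinct in $E\setminus S$, $Sij=S\cup\{i,j\}$) by replacing $p_\sigma$ by $0$ if $\sigma\notin\mathcal{B}$. For such $f$ (with coefficients $\pm1$), $\mathrm{trop}(V(f))\subset\mathbb{R}^{\mathcal{B}}$ is the set of $w$ at which the minimum of the linear forms $u\cdot w$, over the monomials $p^u$ of $f$, is attained at least twice (all of $\mathbb{R}^{\mathcal{B}}$ if $f=0$). The Dressian is $\mathrm{Dr}_{\mathcal{M}}=\bigcap_{f\in G_{\mathcal{M}}}\mathrm{trop}(V(f))$. The Dressian is a polyhedral fan, with the fan structure given by the common refinement of the tropical hypersurfaces $\mathrm{trop}(V(f))$, $f\in G_{\mathcal{M}}$.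 Its lineality space is the largest linear subspace $L$ with $w+u\in\mathrm{Dr}_{\mathcal{M}}$ for all $w\in\mathrm{Dr}_{\mathcal{M}}$, $u\in L$. ''Modulo lineality and intersecting with a sphere'' means: take the image of the fan in $\mathbb{R}^{\mathcal{B}}/L$ and intersect with a sphere centered at the origin, so that cones of dimension $\dim L+i+1$ become cells of dimension $i$. The $f$-vector lists the numbers of cells of dimension $0,1,2,\dots$. *)

(* Defs.v *)
From HB Require Import structures.
From mathcomp Require Import all_boot all_order all_algebra.
From mathcomp Require Import boolp classical_sets functions cardinality reals.
From mathcomp Require Import mpoly.
Set Implicit Arguments.
Unset Strict Implicit.
Unset Printing Implicit Defensive.
Import Order.TTheory GRing.Theory Num.Theory.
Local Open Scope card_scope.
Local Open Scope classical_set_scope.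
Local Open Scope ring_scope.

Record matroid (E : finType) (d : nat) := Matroid {
  bases : {set {set E}};
  bases_neq0 : bases != finset.set0;
  bases_card : forall A, A \in bases -> #|A| = d;
  bases_exchange : forall A B x, A \in bases -> B \in bases ->
    x \in A :\: B -> exists2 y, y \in B :\: A & y |: (A :\ x) \in bases }.

(* The variables of the polynomial ring, and the coordinates of R^B, are
   indexed by 'I_#|B|; the basis with index i is [enum_val i]. *)
Definition plucker_var (E : finType) (d : nat) (M : matroid E d) (A : {set E})
    : {mpoly int[#|bases M|]} :=
  if [pick i : 'I_#|bases M| | enum_val i == A] is Some i then 'X_i else 0.

Definition three_term_plucker (E : finType) (d : nat) (M : matroid E d)
    (S : {set E}) (i j k l : E) : {mpoly int[#|bases M|]} :=
  let p a b := plucker_var M (a |: (b |: S)) in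
  p i j * p k l - p i k * p j l + p i l * p j k.

Definition plucker_relations (E : finType) (d : nat) (M : matroid E d)
    : set {mpoly int[#|bases M|]} :=
  [set f | exists (S : {set E}) (i j k l : E),
    [/\ #|S|.+2 = d, uniq [:: i; j; k; l],
        all (fun x => x \notin S) [:: i; j; k; l]
      & f = three_term_plucker M S i j k l]].
Arguments plucker_relations {E d} M.

Section Tropical.
Variables (R : realType) (n : nat).
Local Notation V := 'rV[R]_n.
Implicit Types (f : {mpoly int[n]}) (w : V).

Definition weight w (u : 'X_{1..n}) : R := \sum_(i < n) w 0 i *+ u i.

Definition min_supp f w : seq 'X_{1..n} :=
  [seq u <- msupp f | all (fun v => weight w u <= weight w v) (msupp f)].

(* [msupp f] is duplicate-free, so this counts distinct monomials. *)
Definition trop f : set V := [set w | f = 0 \/ (2 <= size (min_supp f w))%N].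

(* The closed cone of [trop f] with [w] in its relative interior.  These are
   the cones of positive codimension in the normal fan of the Newton polytope
   of f; for f = 0 the only cone is R^n. *)
Definition trop_cone f w : set V :=
  [set v | {subset min_supp f w <= min_supp f v}].

Definition trop_fan f : set (set V) := [set trop_cone f w | w in trop f].

Definition common_refinement (I : Type) (G : set I) (Sigma : I -> set (set V))
    : set (set V) :=
  [set \bigcap_(i in G) C i |
    C in [set C : I -> set V | forall i, G i -> Sigma i (C i)]].

Definition is_lineality_space (D : set V) (L : {vspace V}) : Prop :=
  let stable (U : {vspace V}) := forall w u, D w -> u \in U -> D (w + u) in
  stable L /\ forall U, stable U -> (U <= L)%VS.

(* [q] identifies R^m with the quotient V / L. *)
Definition is_quotient_map (m : nat) (L : {vspace V})
    (q : 'Hom(V, 'rV[R]_m)) : Prop :=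
  lker q = L /\ limg q = fullv.

Fact is_quotient_map_exists (L : {vspace V}) :
  exists m (q : 'Hom('rV[R]_n, 'rV[R]_m)), is_quotient_map L q.
Proof.
pose U := (L^C)%VS; exists (\dim U).
pose g := fun v : 'rV[R]_n => \row_i coord (vbasis U) i (daddv_pi U L v).
have g_lin : linear g.
  by move=> a u v; apply/rowP => i; rewrite !mxE linearP /= linearP.
pose G := GRing.isLinear.Build _ _ _ _ g g_lin.
pose gl : {linear 'rV[R]_n -> 'rV[R]_(\dim U)} := HB.pack g G.
have gE v : linfun gl v = g v by rewrite lfunE.
have UL : (U :&: L = 0)%VS by rewrite capvC capv_compl.
have LU : (U + L = fullv)%VS by rewrite addvC addv_complf.
exists (linfun gl); split.
  apply/vspaceP => v; rewrite memv_ker gE; apply/eqP/idP => [gv|vL].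
    have pv : daddv_pi U L v = 0.
      rewrite (coord_vbasis (memv_pi U L v)) big1 // => i _.
      by move/rowP/(_ i): gv; rewrite !mxE => ->; rewrite scale0r.
    have <- : daddv_pi U L v + daddv_pi L U v = v.
      by apply: daddv_pi_add => //; rewrite LU memvf.
    by rewrite pv add0r memv_pi.
  apply/rowP => i; rewrite !mxE.
  have -> : daddv_pi U L v = 0.
    have LU0 : (L :&: U = 0)%VS by rewrite capvC.
    have vUL : v \in (U + L)%VS by rewrite LU memvf.
    have vE := daddv_pi_add UL vUL.
    have vE2 := daddv_pi_id LU0 vL.
    by rewrite vE2 in vE; apply: (addIr v); rewrite vE add0r.
  by rewrite linear0.
apply/eqP; rewrite eqEsubv subvf; apply/subvP => w _.
apply/memv_imgP; exists (\sum_i w 0 i *: (vbasis U)`_i); rewrite ?memvf // gE.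
apply/rowP => i; rewrite mxE daddv_pi_id //.
  by rewrite coord_sum_free // (basis_free (vbasisP U)).
by apply: rpred_sum => j _; rewrite rpredZ // vbasis_mem // mem_nth // size_tuple.
Qed.

End Tropical.

Definition Dressian (R : realType) (E : finType) (d : nat) (M : matroid E d)
    : set 'rV[R]_#|bases M| :=
  \bigcap_(f in plucker_relations M) trop f.
Arguments Dressian R {E d} M.

Definition Dressian_fan (R : realType) (E : finType) (d : nat)
    (M : matroid E d) : set (set 'rV[R]_#|bases M|) :=
  common_refinement (plucker_relations M) (@trop_fan R _).
Arguments Dressian_fan R {E d} M.

Section Spherical.
Variables (R : realType) (m : nat).
Local Notation W := 'rV[R]_m.
Implicit Types (X Y F P : set W) (K : set (set W)) (r : R).

Definition dot (a x : W) : R := \sum_(i < m) a 0 i * x 0 i.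

Definition sphere r : set W := [set x | dot x x = r ^+ 2].

(* The cone {0} does not meet the sphere and yields no cell. *)
Definition spherical_cells (n : nat) (q : 'Hom('rV[R]_n, W)) r
    (Sigma : set (set 'rV[R]_n)) : set (set W) :=
  [set X | X !=set0 /\ exists2 C, Sigma C & X = (q @` C) `&` sphere r].

Definition polyhedral_cone P : Prop :=
  exists s : seq W, P = [set x | forall a, a \in s -> 0 <= dot a x].

Definition pointed P : Prop := forall x, P x -> P (- x) -> x = 0.

Definition spherical_polytope r X : Prop :=
  exists P, [/\ polyhedral_cone P, pointed P & X = P `&` sphere r].

Definition face F X : Prop :=
  exists2 a, forall x, X x -> 0 <= dot a x & F = X `&` [set x | dot a x = 0].

(* Polyhedral complex on the sphere, with only its nonempty cells listed. *)
Definition spherical_complex r K : Prop :=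
  [/\ finite_set K,
      forall X, K X -> X !=set0 /\ spherical_polytope r X,
      forall X F, K X -> face F X -> F !=set0 -> K F
    & forall X Y, K X -> K Y -> X `&` Y !=set0 -> face (X `&` Y) X].

Definition is_span X (U : {vspace W}) : Prop :=
  (forall x, X x -> x \in U) /\
  forall U' : {vspace W}, (forall x, X x -> x \in U') -> (U <= U')%VS.

(* A cell on the sphere has dimension one less than its linear span. *)
Definition has_cell_dim X (i : nat) : Prop :=
  exists2 U : {vspace W}, is_span X U & \dim U = i.+1.

Definition has_complex_dim K (d : nat) : Prop :=
  (exists2 X, K X & has_cell_dim X d) /\
  forall X i, K X -> has_cell_dim X i -> (i <= d)%N.

Definition has_f_vector K (s : seq nat) : Prop :=
  forall i : nat, [set X | K X /\ has_cell_dim X i] #= `I_(nth 0%N s i).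

End Spherical.

Definition vamos_nonbases : {set {set 'I_8}} :=
  [set A | A \in [seq [set x : 'I_8 | (x : nat) \in s] |
     s <- [:: [:: 0; 1; 3; 4]; [:: 0; 1; 2; 5]; [:: 2; 3; 4; 5];
              [:: 3; 4; 6; 7]; [:: 2; 5; 6; 7]]%N]]%SET.

Definition vamos_bases : {set {set 'I_8}} :=
  [set A : {set 'I_8} | (#|A| == 4)%N && (A \notin vamos_nonbases)]%SET.

Fact card_meet_seq (n : nat) (s t : seq nat) :
  (#|[set x : 'I_n | (x : nat) \in s] :&: [set x : 'I_n | (x : nat) \in t]|
    <= size [seq a <- s | a \in t])%N.
Proof.
rewrite cardE -(size_map val); apply: uniq_leq_size.
  by rewrite map_inj_uniq ?enum_uniq //; apply: val_inj.
by move=> _ /mapP[x xst ->]; move: xst; rewrite mem_enum !inE mem_filter andbC.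
Qed.

Fact vamos_nonbases_meet A B :
  A \in vamos_nonbases -> B \in vamos_nonbases -> A != B -> (#|A :&: B| <= 2)%N.
Proof.
rewrite !inE => hA hB.
by case/or4P: hA => [|||/orP[]] /eqP->; case/or4P: hB => [|||/orP[]] /eqP->;
  rewrite ?eqxx //= => _; apply: leq_trans (card_meet_seq _ _ _) _.
Qed.

Fact vamos_bases_neq0 : vamos_bases != finset.set0.
Proof.
apply/set0Pn; exists [set x : 'I_8 | (x < 4)%N]%SET; rewrite inE; apply/andP; split.
  by rewrite -sum1_card big_mkcond /= !big_ord_recl big_ord0 !inE.
apply/negP; rewrite !inE => /or4P[|||/orP[]] /eqP/setP e.
- by have := e 2%:R; rewrite !inE.
- by have := e 3%:R; rewrite !inE.
- by have := e 0; rewrite !inE.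
- by have := e 0; rewrite !inE.
- by have := e 0; rewrite !inE.
Qed.

Fact vamos_bases_card A : A \in vamos_bases -> #|A| = 4%N.
Proof. by rewrite inE => /andP[/eqP]. Qed.

Fact vamos_bases_exchange A B x : A \in vamos_bases -> B \in vamos_bases ->
  x \in A :\: B -> exists2 y, y \in B :\: A & y |: (A :\ x) \in vamos_bases.
Proof.
move=> hA hB /finset.setDP[xA xB].
have cA := vamos_bases_card hA; have cB := vamos_bases_card hB.
have cAx : #|A :\ x| = 3%N by move: cA; rewrite (cardsD1 x A) xA => -[].
have card_sw y : y \in B :\: A -> #|y |: (A :\ x)| = 4%N.
  by move=> /finset.setDP[_ yA]; rewrite cardsU1 cAx !inE (negPf yA) andbF.
have sw y : y \in B :\: A -> y |: (A :\ x) \notin vamos_bases ->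
    y |: (A :\ x) \in vamos_nonbases.
  move=> hy; rewrite [_ \in vamos_bases]inE negb_and negbK => /orP[|//].
  by rewrite (card_sw y hy).
have cBA : #|B :\: A| = #|A :\: B| by rewrite !cardsD finset.setIC cA cB.
have [y hy] : exists y, y \in B :\: A.
  by apply/card_gt0P; rewrite cBA; apply/card_gt0P; exists x; rewrite !inE xA xB.
have [?|Ny] := boolP (y |: (A :\ x) \in vamos_bases); first by exists y.
have [/eqP c1|/negP] := boolP (#|B :\: A| == 1%N).
  case/negP: Ny; suff -> : y |: (A :\ x) = B by [].
  apply/eqP; rewrite eqEcard (card_sw y hy) cB leqnn andbT.
  apply/fintype.subsetP => z; rewrite !inE => /orP[/eqP->|/andP[zx zA]].
    by move: hy => /finset.setDP[].
  apply: contraNT zx => zB.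
  have /cards1P[t /setP e] : #|A :\: B| == 1%N by rewrite -cBA c1.
  have := e z; have := e x; rewrite !inE xA xB zA zB /= => /esym/eqP-> /esym/eqP->.
  by [].
rewrite (cardsD1 y) hy => /negP; rewrite eqSS -lt0n => /card_gt0P[z].
rewrite finset.in_setD1 => /andP[zy hz].
have [?|Nz] := boolP (z |: (A :\ x) \in vamos_bases); first by exists z.
have /(vamos_nonbases_meet (sw y hy Ny) (sw z hz Nz)) :
    y |: (A :\ x) != z |: (A :\ x).
  apply/eqP => /setP/(_ z); rewrite !inE eqxx (negPf zy) /=.
  by move: hz => /finset.setDP[_ /negPf->]; rewrite andbF.
have le_meet : (#|A :\ x| <= #|(y |: A :\ x) :&: (z |: A :\ x)|)%N.
  by apply: fintype.subset_leq_card; rewrite finset.subsetI !finset.subsetUr.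
by move: le_meet; rewrite cAx => /leq_trans le_meet /le_meet.
Qed.

Definition vamos : matroid 'I_8 4%N :=
  Matroid vamos_bases_neq0 vamos_bases_card vamos_bases_exchange.

(* Main.v *)
(** Modulo its lineality space, the Dressian lies in the 20-dimensional space cut
    out by the two-term relations. In suitable coordinates y on that space, indexed
    by the 4 directions and the 16 vertices of the 4-cube, every three-term
    relation says one of the following: a coordinate is nonnegative; for an edge
    (v, v') of direction d, the minimum of y_d, y_v, y_v' is attained twice; or the
    four-point condition holds for the 6 coordinates attached to a square of the
    cube, which are the entries of an ultrametric on 4 points. The last condition,
    with its set of minimal terms, follows from the second one.

    A point y satisfies these conditions if and only if the indicators of its
    superlevel sets do. There are 939 such 0/1 points, and any y is a nonnegative
    combination of a chain of them; hence the patterns of ties of the points of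
    the Dressian are the meets of patterns of 0/1 points that are again patterns.
    They correspond to the cones of the fan, and are enumerated in a trie. The
    linear span of a cone is cut out by equations y_i = y_j and y_i = 0, so that
    its dimension is a number of classes of coordinates.

    For any finite set of polynomials, the points of a convex set of the
    prevariety with the fewest ties lie in its relative interior, which shows that
    the cones are closed under taking faces and meet along faces. *)
From HB Require Import structures.
Require Import Defs.
From mathcomp Require Import all_boot all_order all_algebra.
From mathcomp Require Import boolp classical_sets functions cardinality reals.
From mathcomp Require Import mpoly lra.
Import Order.TTheory GRing.Theory Num.Theory.
Local Open Scope classical_set_scope.
Local Open Scope ring_scope.
Set Implicit Arguments.
Unset Strict Implicit.
Unset Printing Implicit Defensive.

(** What the machine evaluates contains no real number: words of 52 codes (20 signs and 32 edges of
    the cube), bit vectors and integer vectors. The bridge to the reals is one order: a pattern is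
    smaller when it has fewer ties. The closed cone of a point then consists of the points with a
    larger pattern, and adding two points takes the meet of their patterns whenever every minimum is
    still attained twice. Both inclusions between the trie and the Dressian rest on this.

    Starting from 8 bases, the table fills in the other 57 one relation at a time, at the cost of 20
    new parameters. The choices found by search need no trust: each of the 420 relations is
    recomputed from the table of integer vectors and its shape is checked.

    The pattern of the origin has dimension 0 and its cone is the lineality space, which the sphere
    misses after the quotient. Hence cells of dimension i are counted by patterns with i + 1 nonzero
    classes, and these counts alone give the dimension of the complex. *)

Section Dot.
Variables (R : realType) (n : nat).
Implicit Types (a v w : 'rV[R]_n) (c : R).

Lemma dotDl a b v : dot (a + b) v = dot a v + dot b v.
Proof. by rewrite -big_split; apply: eq_bigr => i _; rewrite mxE mulrDl. Qed.

Lemma dotDr a v w : dot a (v + w) = dot a v + dot a w.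
Proof. by rewrite -big_split; apply: eq_bigr => i _; rewrite mxE mulrDr. Qed.

Lemma dotZr a c v : dot a (c *: v) = c * dot a v.
Proof. by rewrite mulr_sumr; apply: eq_bigr => i _; rewrite mxE mulrCA. Qed.

Lemma dotC a v : dot a v = dot v a.
Proof. by apply: eq_bigr => i _; rewrite mulrC. Qed.

Lemma dotZl a c v : dot (c *: a) v = c * dot a v.
Proof. by rewrite dotC dotZr dotC. Qed.

Lemma dotNr a v : dot a (- v) = - dot a v.
Proof. by rewrite -scaleN1r dotZr mulN1r. Qed.

Lemma dotBl a b v : dot (a - b) v = dot a v - dot b v.
Proof. by rewrite dotDl -scaleN1r dotZl mulN1r. Qed.

Lemma dot0l v : dot 0 v = 0.
Proof. by rewrite -(subrr v) dotBl subrr. Qed.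

Lemma dot0r v : dot v 0 = 0. Proof. by rewrite dotC dot0l. Qed.

Lemma dot_suml (I : Type) (s : seq I) (F : I -> 'rV[R]_n) v :
  dot (\sum_(i <- s) F i) v = \sum_(i <- s) dot (F i) v.
Proof.
by elim: s => [|i s IH]; rewrite ?big_nil ?dot0l // !big_cons dotDl IH.
Qed.

Lemma dot_ge0 v : 0 <= dot v v.
Proof. by apply: sumr_ge0 => i _; rewrite -expr2 sqr_ge0. Qed.

Lemma dot_eq0 v : (dot v v == 0) = (v == 0).
Proof.
apply/idP/eqP => [|->]; last by rewrite dot0l.
rewrite psumr_eq0 => [/allP h|i _]; last by rewrite -expr2 sqr_ge0.
apply/rowP => i; rewrite mxE; apply/eqP.
by have := h i (mem_index_enum _); rewrite mulf_eq0 orbb.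
Qed.

Lemma sphere_normalize (r : R) v : 0 < r -> v != 0 ->
  exists2 c, 0 < c & sphere r (c *: v).
Proof.
move=> r0 v0; have d0 : 0 < dot v v by rewrite lt_def dot_ge0 dot_eq0 v0.
exists (r / Num.sqrt (dot v v)); first by rewrite divr_gt0 // sqrtr_gt0.
rewrite /sphere /= dotZl dotZr mulrA -expr2 expr_div_n sqr_sqrtr ?ltW //.
by rewrite divfK // gt_eqF.
Qed.

End Dot.

(** * The tropical fan of a finite set of polynomials *)

Section TropicalFan.
Variables (R : realType) (n : nat).
Local Notation V := 'rV[R]_n.
Implicit Types (f : {mpoly int[n]}) (v w : V) (u : 'X_{1..n}).

Definition mnm_row u : V := \row_i (u i)%:R.

Lemma weightE w u : weight w u = dot (mnm_row u) w.
Proof. by apply: eq_bigr => i _; rewrite mxE mulr_natl. Qed.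

Lemma weightD v w u : weight (v + w) u = weight v u + weight w u.
Proof. by rewrite !weightE dotDr. Qed.

Lemma weightZ (c : R) w u : weight (c *: w) u = c * weight w u.
Proof. by rewrite !weightE dotZr. Qed.

Lemma weightN w u : weight (- w) u = - weight w u.
Proof. by rewrite !weightE dotNr. Qed.

Lemma mem_min_supp f w u :
  u \in min_supp f w <->
  u \in msupp f /\ forall u', u' \in msupp f -> weight w u <= weight w u'.
Proof.
rewrite mem_filter; split => [/andP[/allP h uf]|[uf h]] //.
by rewrite uf andbT; apply/allP.
Qed.

Lemma min_supp_msupp {f w u} : u \in min_supp f w -> u \in msupp f.
Proof. by case/mem_min_supp. Qed.

Lemma min_supp_exists f w : msupp f != [::] -> exists u, u \in min_supp f w.
Proof.
case E : (msupp f) => [//|u0 s] _; rewrite /min_supp E.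
case: (@arg_minP _ _ _ (ord0 : 'I_(size s).+1) xpredT
    (fun i => weight w (nth u0 (u0 :: s) i)) erefl) => i _ hi.
exists (nth u0 (u0 :: s) i); rewrite mem_filter mem_nth ?andbT //.
by apply/(all_nthP u0) => j js; apply: (hi (Ordinal js)).
Qed.

(** The shared monomial [u0] makes the minimum of the sum equal to the sum of the minima, so a
    monomial attains it only if it attains both. *)
Lemma min_suppD f v w u0 : u0 \in min_supp f v -> u0 \in min_supp f w ->
  forall u, u \in min_supp f (v + w) <-> u \in min_supp f v /\ u \in min_supp f w.
Proof.
move=> /mem_min_supp[u0f h1] /mem_min_supp[_ h2] u; split; last first.
  move=> [/mem_min_supp[uf k1] /mem_min_supp[_ k2]]; apply/mem_min_supp.
  by split=> // x xf; rewrite !weightD lerD ?k1 ?k2.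
move=> /mem_min_supp[uf k].
have le1 := h1 _ uf; have le2 := h2 _ uf; have := k _ u0f; rewrite !weightD => le3.
have e1 : weight v u = weight v u0.
  apply/eqP; rewrite eq_le le1 andbT.
  by rewrite -(lerD2r (weight w u0)); apply: le_trans le3; rewrite lerD2l.
have e2 : weight w u = weight w u0.
  apply/eqP; rewrite eq_le le2 andbT.
  by rewrite -(lerD2l (weight v u0)); apply: le_trans le3; rewrite lerD2r.
by split; apply/mem_min_supp; split => // x xf; rewrite ?e1 ?e2 ?h1 ?h2.
Qed.

Lemma min_suppZ (c : R) f w : 0 < c -> min_supp f (c *: w) = min_supp f w.
Proof.
move=> c0; apply: eq_filter => u; apply: eq_all => v.
by rewrite !weightZ ler_pM2l.
Qed.

Variable G : set {mpoly int[n]}.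
Hypothesis finG : finite_set G.
Hypothesis sizeG : forall f, G f -> f = 0 \/ (2 <= size (msupp f) <= 3)%N.

Let D : set V := \bigcap_(f in G) trop f.

Definition cone w : set V :=
  [set v | forall f, G f -> {subset min_supp f w <= min_supp f v}].

Lemma tropS f v w : trop f w -> {subset min_supp f w <= min_supp f v} -> trop f v.
Proof.
rewrite /trop /= => -[->|h] s; [by left | right; apply: leq_trans h _].
by apply: uniq_leq_size => //; rewrite filter_uniq // msupp_uniq.
Qed.

Lemma cone_refl w : cone w w. Proof. by move=> f _ u. Qed.

Lemma cone_trans v w x : cone w v -> cone v x -> cone w x.
Proof. by move=> wv vx f Gf u /(wv f Gf) /(vx f Gf). Qed.

Lemma cone_sub_D w : D w -> cone w `<=` D.
Proof. by move=> Dw v wv f Gf; apply: tropS (Dw f Gf) (wv f Gf). Qed.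

Lemma msupp_neq0 f : G f -> f != 0 -> msupp f != [::].
Proof. by rewrite msupp_eq0. Qed.

Lemma coneZ (c : R) w v : 0 < c -> cone w v -> cone w (c *: v).
Proof. by move=> c0 wv f Gf; rewrite min_suppZ //; apply: wv. Qed.

Lemma min_supp0 (w : V) : min_supp 0 w = [::].
Proof. by rewrite /min_supp msupp0. Qed.

Lemma coneD w v v' : cone w v -> cone w v' -> cone w (v + v').
Proof.
move=> wv wv' f Gf u uw.
by apply/(min_suppD (wv f Gf _ uw) (wv' f Gf _ uw)); split; [apply: wv|apply: wv'].
Qed.

(* Adding points of [F] can only break ties, so a point with fewest ties lies
   in the relative interior of [F]. *)
Lemma relint_exists (F : set V) : F !=set0 ->
  (forall f, G f -> f != 0 -> exists u, forall v, F v -> u \in min_supp f v) ->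
  (forall v w, F v -> F w -> F (v + w)) ->
  exists2 w, F w & F `<=` cone w.
Proof.
move=> [v0 Fv0] FC FD; have [s Gs] := (finite_seqP _).1 finG.
pose mu w := (\sum_(f <- s) size (min_supp f w))%N.
have sub v w g : F v -> F w -> G g -> forall x, x \in min_supp g (v + w) ->
    x \in min_supp g v /\ x \in min_supp g w.
  move=> Fv Fw Gg x; have [->|g0] := eqVneq g 0; first by rewrite min_supp0.
  by have [y yg] := FC g Gg g0 => /(min_suppD (yg _ Fv) (yg _ Fw)).
have uniq_ms (g : {mpoly int[n]}) (x : V) : uniq (min_supp g x).
  by rewrite filter_uniq // msupp_uniq.
have [k] := ubnP (mu v0); elim: k v0 Fv0 => // k IH v Fv lek.
have [?|] := pselect (F `<=` cone v); first by exists v.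
move=> /existsNP[w /not_implyP[Fw /existsNP[f /not_implyP[Gf]]]].
move=> /existsNP[u /not_implyP[uv uw]].
apply: (IH (v + w)); first exact: FD.
apply: leq_trans (_ : mu v <= k)%N => //.
have fs : f \in s by move: Gf; rewrite Gs.
rewrite /mu !(big_rem f fs) /= -addSn leq_add //.
  have sf x : x \in min_supp f (v + w) -> x \in min_supp f v.
    by case/(sub _ _ _ Fv Fw Gf).
  rewrite ltn_neqAle uniq_leq_size // andbT.
  apply/eqP => esz; have [_ e] := uniq_min_size (uniq_ms f (v + w)) sf (eq_leq (esym esz)).
  by apply: uw; move: uv; rewrite -e => /(sub _ _ _ Fv Fw Gf)[].
rewrite big_seq [leqRHS]big_seq; apply: leq_sum => g gs.
apply: uniq_leq_size => // x; case/(sub _ _ _ Fv Fw _) => //.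
by rewrite Gs /=; apply: mem_rem gs.
Qed.

Lemma zero_cone w : cone w 0.
Proof.
move=> f Gf u /min_supp_msupp uf; apply/mem_min_supp; split => // v _.
by rewrite !weightE !dot0r.
Qed.

Lemma zero_D : D 0.
Proof.
move=> f Gf; rewrite /trop /=; have [->|] := sizeG Gf; [by left | case/andP => h _].
right; rewrite /min_supp (_ : filter _ _ = msupp f) //.
by apply/all_filterP/allP => u uf; apply/allP => v _; rewrite !weightE !dot0r.
Qed.

(** A cone of the refinement combines cones of the several polynomials, chosen at unrelated points.
    Its point with the fewest ties has every tie demanded by those choices, hence it lies in [D] and
    its own [cone] is the whole intersection. *)
Lemma common_refinementE :
  common_refinement G (@trop_fan R n) = [set cone w | w in D].
Proof.
apply/seteqP; split => X.
  move=> [C hC <-].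
  have /choice[x hx] : forall f, exists w, G f -> trop f w /\ C f = trop_cone f w.
    move=> f; have [Gf|nG] := pselect (G f); last by exists 0.
    by have [w tw <-] := hC f Gf; exists w.
  have zX : (\bigcap_(i in G) C i) 0.
    by move=> f Gf; rewrite (hx f Gf).2; apply: (@zero_cone (x f) f Gf).
  have Fmin f : G f -> f != 0 ->
      exists u, forall v, (\bigcap_(i in G) C i) v -> u \in min_supp f v.
    move=> Gf f0; have [u uf] := min_supp_exists (x f) (msupp_neq0 Gf f0).
    by exists u => v /(_ f Gf); rewrite (hx f Gf).2; apply.
  have [|v w Fv Fw f Gf|w Fw FC] := relint_exists _ Fmin; first by exists 0.
    have := Fv f Gf; have := Fw f Gf; rewrite (hx f Gf).2 => h1 h2 u um.
    by apply/(min_suppD (h2 _ um) (h1 _ um)); split; [apply: h2|apply: h1].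
  exists w; last first.
    apply/seteqP; split; last by [].
    move=> v wv f Gf; rewrite (hx f Gf).2 => u uf.
    apply: wv => //; have := Fw f Gf; rewrite (hx f Gf).2; exact.
  move=> f Gf; have [h1 h2] := hx f Gf.
  by apply: tropS h1 _; have := Fw f Gf; rewrite h2.
move=> [w Dw <-]; exists (fun f => trop_cone f w); last by [].
by move=> f Gf; exists w => //; apply: Dw.
Qed.

Definition lineality_forms (s : seq {mpoly int[n]}) : seq V :=
  flatten [seq [seq mnm_row u - mnm_row u' | u <- msupp f, u' <- msupp f] | f <- s].

Definition lineality : {vspace V} :=
  let s := lineality_forms (sval (cid ((finite_seqP _).1 finG))) in
  lker (linfun (mulmxr (\matrix_(i < n, j < size s) s`_j 0 i))).

Lemma linealityP v : v \in lineality <-> forall f, G f ->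
  forall u u', u \in msupp f -> u' \in msupp f -> weight v u = weight v u'.
Proof.
rewrite memv_ker lfunE /=; case: cid => s /= Gs; set t := lineality_forms s.
have -> : (v *m (\matrix_(i < n, j < size t) t`_j 0 i) == 0) =
    all (fun a => dot a v == 0) t.
  apply/eqP/(all_nthP 0) => [/rowP h i it|h].
    have := h (Ordinal it); rewrite !mxE => e; apply/eqP; rewrite -[RHS]e.
    by rewrite /dot; apply: eq_bigr => k _; rewrite mxE mulrC.
  apply/rowP => i; rewrite !mxE; have /eqP e := h i (ltn_ord i).
  by rewrite -[RHS]e /dot; apply: eq_bigr => k _; rewrite mxE mulrC.
split => [/allP h f Gf u u' uf uf'|h].
  apply/eqP; rewrite -subr_eq0 !weightE -dotBl; apply: h.
  apply/flatten_mapP; exists f; first by move: Gf; rewrite Gs.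
  by apply/allpairsP; exists (u, u').
apply/allP => a /flatten_mapP[f fs /allpairsP[[u u'] /= [uf uf' ->]]].
by rewrite dotBl -!weightE subr_eq0; apply/eqP/(h f) => //; rewrite Gs.
Qed.

Lemma lineality_min_supp f l w : G f -> l \in lineality ->
  min_supp f (w + l) = min_supp f w.
Proof.
move=> Gf /linealityP h; apply: eq_in_filter => u uf; apply: eq_in_all => u' uf'.
by rewrite !weightD (h f Gf u u') // lerD2r.
Qed.

Lemma cone_lineality l w v : l \in lineality -> cone w (v + l) <-> cone w v.
Proof.
by move=> lL; split => h f Gf u /(h f Gf); rewrite lineality_min_supp.
Qed.

Lemma D_lineality w l : l \in lineality -> D (w + l) <-> D w.
Proof.
by move=> lL; split => h f Gf; have := h f Gf; rewrite /trop /= lineality_min_supp.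
Qed.

Lemma cone_pointed w v : D w -> cone w v -> cone w (- v) -> v \in lineality.
Proof.
move=> Dw h h'; apply/linealityP => f Gf.
have [->|f0] := eqVneq f 0; first by rewrite msupp0.
have [y yw] := min_supp_exists w (msupp_neq0 Gf f0).
have /mem_min_supp[_ k] := h f Gf y yw; have /mem_min_supp[_ k'] := h' f Gf y yw.
suff e u : u \in msupp f -> weight v u = weight v y by move=> u u' /e-> /e->.
by move=> uf; apply/eqP; rewrite eq_le k // andbT -lerN2 -!weightN k'.
Qed.

(** Any stable subspace lies in [D], since 0 does; so [u] and [- u] both attain each minimum twice.
    Two pairs among at most three monomials overlap, and a monomial minimal at both [u] and [- u] is
    also maximal at [u]: all weights agree. *)
Lemma lineality_spaceP : is_lineality_space D lineality.
Proof.
split => [w u Dw /(D_lineality w)[_]|U stU]; first exact.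
apply/subvP => u uU; apply/linealityP => f Gf.
have tu x : x \in U -> trop f x.
  by move=> xU; have := stU _ _ zero_D xU; rewrite add0r; apply.
have [->|f0] := eqVneq f 0; first by rewrite msupp0.
have [f00|/andP[_ s3]] := sizeG Gf; first by rewrite f00 eqxx in f0.
have [/eqP|t1] := tu _ uU; first by rewrite (negPf f0).
have [/eqP|t2] : trop f (- u) by apply: tu; rewrite rpredN.
  by rewrite (negPf f0).
have [x x1 x2] : exists2 x, x \in min_supp f u & x \in min_supp f (- u).
  apply/not_exists2P => h.
  have : uniq (min_supp f u ++ min_supp f (- u)).
    rewrite cat_uniq !filter_uniq ?msupp_uniq //= andbT; apply/hasPn => y y2.
    by apply/negP => y1; have [] := h y.
  move=> /uniq_leq_size/(_ (_ : {subset _ <= msupp f})).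
  rewrite size_cat => /(_ _)/leq_trans/(_ s3) h3.
  have : (4 <= 3)%N by apply: leq_trans (leq_add t1 t2) (h3 _) => y;
    rewrite mem_cat => /orP[] /min_supp_msupp.
  by [].
have /mem_min_supp[_ k] := x1; have /mem_min_supp[_ k'] := x2.
suff e y : y \in msupp f -> weight u y = weight u x by move=> y z /e-> /e->.
by move=> yf; apply/eqP; rewrite eq_le k // andbT -lerN2 -!weightN k'.
Qed.

(* The relative interior point [w'] singles out a face of [cone w]: it is cut
   out by the sum of the differences between the weights tied at [w'] and a
   weight that is minimal on all of [cone w]. *)
Lemma cone_face w w' : D w -> cone w w' -> exists2 a : V,
  (forall l, l \in lineality -> dot a l = 0) /\ (forall v, cone w v -> 0 <= dot a v) &
  forall v, cone w v -> cone w' v <-> dot a v = 0.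
Proof.
move=> Dw ww'; have [s Gs] := (finite_seqP _).1 finG.
pose b f := head 0%MM (min_supp f w).
have bw f : G f -> f != 0 -> b f \in min_supp f w.
  move=> Gf f0; have [y] := min_supp_exists w (msupp_neq0 Gf f0).
  by rewrite /b; case: (min_supp f w) => // z t _; rewrite mem_head.
pose a := \sum_(f <- s) \sum_(u <- min_supp f w') (mnm_row u - mnm_row (b f)).
have aE v : dot a v =
    \sum_(f <- s) \sum_(u <- min_supp f w') (weight v u - weight v (b f)).
  rewrite dot_suml; apply: eq_bigr => f _; rewrite dot_suml; apply: eq_bigr => u _.
  by rewrite dotBl -!weightE.
have f0P f u (x : V) : u \in min_supp f x -> f != 0.
  by move=> h; apply: contraTneq h => ->; rewrite min_supp0.
have ge0 v f u : cone w v -> f \in s -> u \in min_supp f w' ->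
    0 <= weight v u - weight v (b f).
  move=> wv fs uf; have Gf : G f by rewrite Gs.
  have /mem_min_supp[_ h] := wv f Gf _ (bw f Gf (f0P _ _ _ uf)).
  by rewrite subr_ge0 h // (min_supp_msupp uf).
have sum_ge0 v f : cone w v -> f \in s ->
    0 <= \sum_(u <- min_supp f w') (weight v u - weight v (b f)).
  by move=> wv fs; rewrite big_seq; apply: sumr_ge0 => u uf; apply: ge0.
exists a; first split.
- move=> l /linealityP h; rewrite aE big_seq big1 // => f fs.
  have Gf : G f by rewrite Gs.
  rewrite big_seq big1 // => u uf; have f0 := f0P _ _ _ uf.
  by rewrite (h f Gf u (b f)) ?subrr ?(min_supp_msupp uf) ?(min_supp_msupp (bw _ Gf f0)).
- by move=> v wv; rewrite aE big_seq; apply: sumr_ge0 => f; apply: sum_ge0.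
move=> v wv; split => [w'v|].
  rewrite aE big_seq big1 // => f fs; have Gf : G f by rewrite Gs.
  rewrite big_seq big1 // => u uf; apply/eqP; rewrite eq_le ge0 // andbT subr_le0.
  have /mem_min_supp[_ h] := w'v f Gf u uf; apply: h.
  exact: min_supp_msupp (bw _ Gf (f0P _ _ _ uf)).
move=> a0 f Gf u uf; have fs : f \in s by move: Gf; rewrite Gs.
have f0 := f0P _ _ _ uf.
have : \sum_(u <- min_supp f w') (weight v u - weight v (b f)) == 0.
  move: a0; rewrite aE big_seq => /eqP; rewrite psumr_eq0 => [/allP|i]; last exact: sum_ge0.
  by move=> /(_ f fs); rewrite fs.
rewrite big_seq psumr_eq0 => [/allP/(_ u uf)|x]; last exact: ge0.
rewrite uf subr_eq0 => /eqP e; have /mem_min_supp[_ h] := wv f Gf _ (bw f Gf f0).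
by apply/mem_min_supp; split=> [|x xf]; rewrite ?(min_supp_msupp uf) // e h.
Qed.

Definition cone_forms w : seq V :=
  flatten [seq [seq mnm_row u' - mnm_row u | u <- min_supp f w, u' <- msupp f]
          | f <- sval (cid ((finite_seqP _).1 finG))].

Lemma cone_formsP w v :
  cone w v <-> forall a, a \in cone_forms w -> 0 <= dot a v.
Proof.
rewrite /cone_forms; case: cid => s /= Gs; split => h.
  move=> a /flatten_mapP[f fs /allpairsP[[u u'] /= [uf uf' ->]]].
  have Gf : G f by rewrite Gs.
  by have /mem_min_supp[_ k] := h f Gf u uf; rewrite dotBl -!weightE subr_ge0 k.
move=> f Gf u uf; apply/mem_min_supp; split; first exact: min_supp_msupp uf.
move=> u' uf'; rewrite -subr_ge0 !weightE -dotBl; apply: h.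
apply/flatten_mapP; exists f; first by move: Gf; rewrite Gs.
by apply/allpairsP; exists (u, u').
Qed.

Lemma cone_forms_lineality w a l :
  a \in cone_forms w -> l \in lineality -> dot a l = 0.
Proof.
rewrite /cone_forms; case: cid => s /= Gs.
move=> /flatten_mapP[f fs /allpairsP[[u u'] /= [uf uf' ->]]].
move=> /linealityP h; rewrite dotBl -!weightE (h f _ u' u) ?subrr ?Gs //.
exact: min_supp_msupp uf.
Qed.

(** A form of [cone_forms w] that vanishes at [w] compares two monomials minimal at [w], so it
    vanishes at [v] too. The remaining forms are positive at [w] and leave room for a small step. *)
Lemma relint_open w v :
  (forall f, G f -> forall u u', u \in min_supp f w -> u' \in min_supp f w ->
    weight v u = weight v u') ->
  exists2 c, 0 < c & cone w (w + c *: v).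
Proof.
move=> h.
have tied a : a \in cone_forms w -> 0 <= dot a w /\ (dot a w = 0 -> dot a v = 0).
  move=> aw; split; first by move: a aw; apply/cone_formsP/cone_refl.
  move: aw; rewrite /cone_forms; case: cid => s /= Gs.
  move=> /flatten_mapP[f fs /allpairsP[[u u'] /= [uf uf' ->]]].
  rewrite !dotBl -!weightE => /eqP; rewrite subr_eq0 => /eqP e.
  rewrite (h f _ u' u) ?subrr ?Gs //; apply/mem_min_supp; split => // x xf.
  by rewrite e; have /mem_min_supp[_] := uf; apply.
(* The bound is asked on a whole interval so that the induction can take the minimum of two
   bounds. *)
suff [c c0 hc] : exists2 c, 0 < c & forall a, a \in cone_forms w ->
    forall d, 0 <= d <= c -> 0 <= dot a (w + d *: v).
  by exists c => //; apply/cone_formsP => a aw; apply: hc aw _ _; rewrite lexx ltW.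
elim: (cone_forms w) tied => [|a s IH] tied; first by exists 1.
have [b bs|c c0 hc] := IH; first by apply: tied; rewrite in_cons bs orbT.
have [aw0 aw1] := tied a (mem_head _ _).
have [c' c'0 hc'] : exists2 c', 0 < c' & forall d, 0 <= d <= c' -> 0 <= dot a (w + d *: v).
  have [av|av] := leP 0 (dot a v).
    by exists 1 => // d /andP[d0 _]; rewrite dotDr dotZr addr_ge0 // mulr_ge0.
  have aw : 0 < dot a w.
    by rewrite lt_def aw0 andbT; apply: contraTneq av => /aw1 ->; rewrite ltxx.
  exists (dot a w / - dot a v); first by rewrite divr_gt0 // oppr_gt0.
  move=> d /andP[_]; rewrite ler_pdivlMr ?oppr_gt0 // mulrN lerNl => h'.
  by rewrite dotDr dotZr -lerBlDl sub0r.
exists (Num.min c c'); first by rewrite lt_min c0.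
move=> b; rewrite in_cons => /orP[/eqP->|bs] d; rewrite le_min => /and3P[d0 dc dc'].
  by apply: hc'; rewrite d0.
by apply: hc bs _ _; rewrite d0.
Qed.

(** * Cells in the quotient by the lineality space *)

Section Quotient.
Variables (m : nat) (q : 'Hom(V, 'rV[R]_m)) (r : R).
Hypotheses (qP : is_quotient_map lineality q) (r_gt0 : 0 < r).

Lemma quotient_eq v w : q v = q w <-> v - w \in lineality.
Proof.
by rewrite -qP.1 memv_ker linearB subr_eq0; split => /eqP.
Qed.

Lemma quotient_inv x : q (q^-1%VF x) = x.
Proof. by apply: limg_lfunVK; rewrite qP.2 memvf. Qed.

Lemma quotient_form a : (forall l, l \in lineality -> dot a l = 0) ->
  exists b, forall v, dot b (q v) = dot a v.
Proof.
move=> al; exists (\row_j dot a (q^-1%VF (delta_mx 0 j))) => v.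
have dv : dot a v = dot a (q^-1%VF (q v)).
  rewrite -[v in LHS](subrK (q^-1%VF (q v))) dotDr al ?add0r //.
  by apply/quotient_eq; rewrite quotient_inv.
rewrite dv [in RHS](row_sum_delta (q v)) linear_sum [RHS]dotC dot_suml.
by apply: eq_bigr => j _; rewrite linearZ dotZl mxE mulrC dotC.
Qed.

Let K := spherical_cells q r (common_refinement G (@trop_fan R n)).

Definition cell w : set 'rV[R]_m := (q @` cone w) `&` sphere r.

Lemma spherical_cellsE : K = [set X | X !=set0 /\ exists2 w, D w & X = cell w].
Proof.
rewrite /K /spherical_cells common_refinementE; apply/seteqP; split => X [X0].
  by move=> [_ [w Dw <-] e]; split=> //; exists w.
by move=> [w Dw e]; split => //; exists (cone w); [exists w | rewrite e].
Qed.

(** The ray of [w] meets the sphere inside its own cell; this point, moved into [cone w'] along the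
    lineality space, rescales to [w]. If [q w] is 0 there is no such ray, but then [w] belongs to
    every cone. *)
Lemma sub_cell w w' : D w -> D w' -> cell w !=set0 -> cell w `<=` cell w' -> cone w' w.
Proof.
move=> Dw Dw' [x [[v wv qv] xr]] sub.
have [q0|q0] := eqVneq (q w) 0.
  have wL : w \in lineality by rewrite -qP.1 memv_ker q0.
  by have := (cone_lineality w' 0 wL).2 (@zero_cone w'); rewrite add0r.
have [c c0 cr] := sphere_normalize r_gt0 q0.
have /sub[[v' w'v' e] _] : cell w (c *: q w).
  by split=> //; exists (c *: w); rewrite ?linearZ //; apply/coneZ/cone_refl.
have /cone_lineality : c *: w - v' \in lineality.
  by apply/quotient_eq; rewrite linearZ e.
move=> /(_ w' v') [_ /(_ w'v')]; rewrite addrC subrK => h.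
by rewrite -[w](scalerK (lt0r_neq0 c0)); apply: coneZ; rewrite ?invr_gt0.
Qed.

Lemma cell_inj w w' : D w -> D w' -> cell w !=set0 -> cell w = cell w' ->
  cone w = cone w'.
Proof.
move=> Dw Dw' w0 e; have w0' : cell w' !=set0 by rewrite -e.
have h : cone w' w by apply: sub_cell w0 _; rewrite // e.
have h' : cone w w' by apply: sub_cell w0' _; rewrite // e.
by apply/seteqP; split => v; apply: cone_trans.
Qed.

Lemma spherical_cells_cover : \bigcup_(X in K) X = (q @` D) `&` sphere r.
Proof.
rewrite spherical_cellsE; apply/seteqP; split => x.
  by move=> [_ [_ [w Dw ->]] [[v wv <-] xr]]; split=> //; exists v => //; apply: cone_sub_D wv.
move=> [[w Dw e] xr].
have xw : cell w x by split=> //; exists w => //; apply: cone_refl.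
by exists (cell w) => //; split; [exists x|exists w].
Qed.

Lemma cell_polytope w : D w -> spherical_polytope r (cell w).
Proof.
move=> Dw; exists (q @` cone w); split => //; last first.
  move=> _ [v wv <-] [v' wv' e]; apply/eqP; rewrite -memv_ker qP.1.
  apply: (cone_pointed Dw wv).
  have /cone_lineality : - v - v' \in lineality by apply/quotient_eq; rewrite e linearN.
  by move=> /(_ w v')[_ /(_ wv')]; rewrite addrC subrK.
(* The form induced by [a] on the quotient. The default 0 is never taken on [cone_forms w], whose
   forms vanish on the lineality space. *)
pose ch a := if pselect (exists b, forall v, dot b (q v) = dot a v) is left h
  then projT1 (cid h) else 0.
have chP a v : a \in cone_forms w -> dot (ch a) (q v) = dot a v.
  move=> aw; rewrite /ch; case: pselect => [h|[]]; first by case: cid.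
  by apply: quotient_form => l; apply: cone_forms_lineality aw.
exists (map ch (cone_forms w)); apply/seteqP; split => x /=.
  by move=> [v /cone_formsP wv <-] _ /mapP[a aw ->]; rewrite chP // wv.
move=> h; exists (q^-1%VF x); last exact: quotient_inv.
apply/cone_formsP => a aw; rewrite -chP // quotient_inv; apply: h.
by apply/mapP; exists a.
Qed.

Lemma cell_face w F : D w -> face F (cell w) -> F !=set0 ->
  exists2 w', D w' & F = cell w'.
Proof.
move=> Dw [a age ->] [x [[[v0 wv0 e0] xr] ax]].
have pos v : cone w v -> 0 <= dot a (q v).
  move=> wv; have [->|q0] := eqVneq (q v) 0; first by rewrite dot0r.
  have [c c0 cr] := sphere_normalize r_gt0 q0.
  rewrite -(pmulr_rge0 _ c0) -dotZr; apply: age; split=> //.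
  by exists (c *: v); rewrite ?linearZ //; apply: coneZ.
pose F0 := [set v | cone w v /\ dot a (q v) = 0].
have [||v v' [wv av] [wv' av']|w' [ww' aw'] Fw'] := @relint_exists F0.
- by exists v0; split=> //; rewrite e0.
- move=> f Gf f0; have [u uf] := min_supp_exists w (msupp_neq0 Gf f0).
  by exists u => v [wv _]; apply: wv.
- by split; [apply: coneD|rewrite linearD dotDr av av' addr0].
exists w'; first exact: cone_sub_D ww'.
apply/seteqP; split => y.
  by move=> [[[v wv e] yr] ay]; split=> //; exists v => //; apply: Fw'; split; rewrite ?e.
move=> [[v w'v e] yr]; have wv := cone_trans ww' w'v; split; first by split=> //; exists v.
rewrite /= -e; apply/eqP; rewrite eq_le pos // andbT.
(* Since [w'] is in the relative interior of its cone, a small step from [w'] away from [v] stays in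
   [cone w]. The form is 0 at [w'], so its value at [v] cannot be positive. *)
have [f Gf u u' uf uf'|c c0 hc] := @relint_open w' (- v).
  have /mem_min_supp[u1 k] := w'v f Gf u uf; have /mem_min_supp[u2 k'] := w'v f Gf u' uf'.
  by rewrite !weightN; congr (- _); apply/eqP; rewrite eq_le k // k'.
have := pos _ (cone_trans ww' hc).
by rewrite linearD linearZ linearN dotDr dotZr aw' add0r dotNr mulrN oppr_ge0 pmulr_rle0.
Qed.

(** The intersection of the two cones is the cone of its point with the fewest ties, and [cone_face]
    turns that point into a supporting form. *)
Lemma cell_meet w w' : D w -> D w' -> cell w `&` cell w' !=set0 ->
  face (cell w `&` cell w') (cell w).
Proof.
move=> Dw Dw' _.
have [||v v' [wv w'v] [wv' w'v']|x [wx w'x] Fx] := @relint_exists (cone w `&` cone w').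
- by exists 0; split; apply: zero_cone.
- move=> f Gf f0; have [u uf] := min_supp_exists w (msupp_neq0 Gf f0).
  by exists u => v [wv _]; apply: wv.
- by split; apply: coneD.
have [a [al age] aP] := cone_face Dw wx.
have [b bE] := quotient_form al.
exists b; first by move=> _ [[v wv <-] _]; rewrite bE age.
apply/seteqP; split => y.
  move=> [[[v wv e] yr] [[v' w'v' e'] _]]; split; first by split=> //; exists v.
  have wv' : cone w' v.
    have /cone_lineality : v - v' \in lineality by apply/quotient_eq; rewrite e e'.
    by move=> /(_ w' v')[_ /(_ w'v')]; rewrite addrC subrK.
  by rewrite /= -e bE; apply/(aP _ wv)/Fx.
move=> [[[v wv e] yr] /=]; rewrite -e bE => /(aP _ wv) xv.
split; split; rewrite -?e; [by exists v | by rewrite e | | by rewrite e].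
by exists v => //; apply: cone_trans w'x xv.
Qed.

Lemma spherical_complexP : finite_set K -> spherical_complex r K.
Proof.
move=> finK; split => // [X|X F|X Y]; rewrite spherical_cellsE.
- by move=> [X0 [w Dw e]]; split=> //; rewrite e; apply: cell_polytope.
- move=> [_ [w Dw ->]] Fw F0; split=> //.
  by have [w' Dw' ->] := cell_face Dw Fw F0; exists w'.
- by move=> [_ [w Dw ->]] [_ [w' Dw' ->]]; apply: cell_meet.
Qed.

End Quotient.
End TropicalFan.

(** * Patterns of ties, and tries of patterns *)

(* [C0] records a triple tie, [Ci] that the two entries other than the i-th
   are tied for the minimum. *)
Inductive code := C0 | C1 | C2 | C3.

Definition code_enc (c : code) : option (option bool) :=
  match c with C0 => None | C1 => Some None | C2 => Some (Some true) | C3 => Some (Some false) end.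
Definition code_dec (o : option (option bool)) : code :=
  match o with None => C0 | Some None => C1 | Some (Some true) => C2 | Some (Some false) => C3 end.
Lemma code_encK : cancel code_enc code_dec. Proof. by case. Qed.
HB.instance Definition _ := Equality.copy code (can_type code_encK).

(** The ties of [c] persist in [d], with [C0] on top: larger patterns belong to smaller cones. *)
Definition codele (c d : code) : bool :=
  match d, c with C0, _ | C1, C1 | C2, C2 | C3, C3 => true | _, _ => false end.

(** Partial, because two different double ties have only one minimal entry in common, which no point
    of a tropical hypersurface can show. *)
Definition codemeet (c d : code) : option code :=
  match c, d with
  | C0, e | e, C0 => Some e
  | C1, C1 => Some C1 | C2, C2 => Some C2 | C3, C3 => Some C3
  | _, _ => None
  end.

Lemma codele_meet b c d e : codemeet c d = Some e ->
  codele b e = codele b c && codele b d.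
Proof. by case: b c d e => [] [] [] []. Qed.

Lemma codele_meet_exists b c d : codele b c -> codele b d ->
  exists e, codemeet c d = Some e.
Proof. by case: b c d => [] [] [] //; eexists. Qed.

Definition patle (p q : seq code) : bool := all2 codele p q.

Fixpoint patmeet (p q : seq code) : option (seq code) :=
  match p, q with
  | [::], [::] => Some [::]
  | c :: p', d :: q' => if codemeet c d is Some e then omap (cons e) (patmeet p' q') else None
  | _, _ => None
  end.

Lemma patle_refl p : patle p p.
Proof. by elim: p => //= c p ->; case: c. Qed.

Lemma patle_trans q p r : patle p q -> patle q r -> patle p r.
Proof.
elim: p q r => [|c p IH] [|d q] [|e r] //= /andP[cd pq] /andP[de qr].
by rewrite (IH _ _ pq qr) andbT; case: c d e cd de => [] [] [].
Qed.

Lemma patle_anti p q : patle p q -> patle q p -> p = q.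
Proof.
elim: p q => [|c p IH] [|d q] //= /andP[cd pq] /andP[dc qp].
by rewrite (IH _ pq qp); case: c d cd dc => [] [].
Qed.

Lemma patle_meet b p q r : patmeet p q = Some r ->
  patle b r = patle b p && patle b q.
Proof.
elim: p q r b => [|c p IH] [|d q] //= r [|x b].
- by case=> <-.
- by case=> <-.
- by case: codemeet => // e; case: patmeet => // s [<-].
case E : codemeet => [e|] //; case E' : patmeet => [s|] //= [<-] /=.
by rewrite (IH _ _ b E') (codele_meet x E) andbACA.
Qed.

Lemma patle_meet_exists b p q : patle b p -> patle b q -> exists r, patmeet p q = Some r.
Proof.
elim: b p q => [|x b IH] [|c p] [|d q] //=; first by exists [::].
move=> /andP[xc bp] /andP[xd bq]; have [e ->] := codele_meet_exists xc xd.
by have [r ->] := IH _ _ bp bq; exists (e :: r).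
Qed.

(** Patterns share prefixes: one traversal meets a pattern with the whole collection, and equal
    meets collapse by themselves. *)
Inductive trie := Empty | Leaf | Node of trie & trie & trie & trie.

Fixpoint trie_wf n t {struct t} : bool :=
  match t, n with
  | Empty, _ | Leaf, 0 => true
  | Node a b c d, n'.+1 => [&& trie_wf n' a, trie_wf n' b, trie_wf n' c & trie_wf n' d]
  | _, _ => false
  end.

Fixpoint leaves t : seq (seq code) :=
  match t with
  | Empty => [::]
  | Leaf => [:: [::]]
  | Node a b c d => map (cons C0) (leaves a) ++ map (cons C1) (leaves b) ++
                    map (cons C2) (leaves c) ++ map (cons C3) (leaves d)
  end.

Fixpoint trie_mem p t {struct t} : bool :=
  match t with
  | Empty => false
  | Leaf => if p is [::] then true else false
  | Node a b c d =>
      match p with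
      | C0 :: p' => trie_mem p' a
      | C1 :: p' => trie_mem p' b
      | C2 :: p' => trie_mem p' c
      | C3 :: p' => trie_mem p' d
      | [::] => false
      end
  end.

Lemma mem_leaves p t : (p \in leaves t) = trie_mem p t.
Proof.
have consP x s (l : seq (seq code)) : (x :: s \in map (cons x) l) = (s \in l).
  by rewrite mem_map // => ? ? [].
have consF x y s (l : seq (seq code)) : x != y -> (x :: s \in map (cons y) l) = false.
  by move=> /eqP xy; apply/negP => /mapP[? _ []].
elim: t p => [||a IHa b IHb c IHc d IHd] [|x p] //=.
  by rewrite !mem_cat; do 4?[case: mapP => [[]//|_]].
by rewrite !mem_cat; case: x; rewrite consP !consF //= ?orbF.
Qed.

Lemma leaves_uniq t : uniq (leaves t).
Proof.
have inj x : injective (cons x : seq code -> _) by move=> ? ? [].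
have dis x y (l l' : seq (seq code)) : x != y ->
    ~~ has (mem (map (cons x) l)) (map (cons y) l').
  move=> /eqP xy; apply/hasPn => _ /mapP[s _ ->]; apply/negP => /mapP[? _ [e _]].
  exact: xy.
elim: t => [||a IHa b IHb c IHc d IHd] //=.
by rewrite !cat_uniq !has_cat !negb_or !map_inj_uniq // IHa IHb IHc IHd !dis.
Qed.

Fixpoint trie_union s t : trie :=
  match s, t with
  | Empty, _ => t
  | _, Empty => s
  | Node a b c d, Node a' b' c' d' =>
      Node (trie_union a a') (trie_union b b') (trie_union c c') (trie_union d d')
  | _, _ => s
  end.

Lemma trie_union_wf n s t : trie_wf n s -> trie_wf n t -> trie_wf n (trie_union s t).
Proof.
elim: s t n => [||a IHa b IHb c IHc d IHd] [||a' b' c' d'] [|n] //=.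
by move=> /and4P[? ? ? ?] /and4P[? ? ? ?]; rewrite IHa ?IHb ?IHc ?IHd.
Qed.

Lemma mem_union n s t p : trie_wf n s -> trie_wf n t ->
  trie_mem p (trie_union s t) = trie_mem p s || trie_mem p t.
Proof.
elim: s t n p => [||a IHa b IHb c IHc d IHd] [||a' b' c' d'] [|n] [|x p] //=.
- by move=> _ _; rewrite orbF.
- by move=> /and4P[? ? ? ?] /and4P[? ? ? ?]; case: x; [rewrite (IHa _ n)|
    rewrite (IHb _ n)|rewrite (IHc _ n)|rewrite (IHd _ n)].
Qed.

Definition node a b c d : trie :=
  match a, b, c, d with Empty, Empty, Empty, Empty => Empty | _, _, _, _ => Node a b c d end.

Arguments node : simpl never.

Lemma node_wf n a b c d : trie_wf n.+1 (Node a b c d) -> trie_wf n.+1 (node a b c d).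
Proof. by case: a b c d => [||????] [||????] [||????] [||????]. Qed.

Lemma mem_node p a b c d : trie_mem p (node a b c d) = trie_mem p (Node a b c d).
Proof. by case: p => [|[] [|? ?]]; case: a b c d => [||????] [||????] [||????] [||????]. Qed.

(** [C0] is neutral, so each child keeps its code. Any other code has a meet only with [C0] and with
    itself, equal to it in both cases, so the two results have to be united. *)
Fixpoint trie_meet p t : trie :=
  match p, t with
  | [::], Leaf => Leaf
  | x :: p', Node a b c d =>
    match x with
    | C0 => node (trie_meet p' a) (trie_meet p' b) (trie_meet p' c) (trie_meet p' d)
    | C1 => node Empty (trie_union (trie_meet p' a) (trie_meet p' b)) Empty Empty
    | C2 => node Empty Empty (trie_union (trie_meet p' a) (trie_meet p' c)) Empty
    | C3 => node Empty Empty Empty (trie_union (trie_meet p' a) (trie_meet p' d))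
    end
  | _, _ => Empty
  end.

Lemma trie_meet_wf p t : trie_wf (size p) t -> trie_wf (size p) (trie_meet p t).
Proof.
elim: p t => [|x p IH] [||a b c d] //= /and4P[/IH wa /IH wb /IH wc /IH wd].
by case: x; apply: node_wf; rewrite /= ?trie_union_wf ?wa ?wb ?wc ?wd.
Qed.

Lemma mem_meet p t q : trie_wf (size p) t ->
  trie_mem q (trie_meet p t) <-> exists2 s, trie_mem s t & patmeet p s = Some q.
Proof.
elim: p t q => [|x p IH] [||a b c d] q //=.
- by move=> _; split=> [|[[]]]//; case: q.
- move=> _; split; first by case: q => // _; exists [::].
  by move=> [[|? ?]] // _ [<-].
- by move=> _; split=> [|[[]]]//; case: q.
move=> /and4P[wa wb wc wd].
have wm r : trie_wf (size p) r -> trie_wf (size p) (trie_meet p r) by apply: trie_meet_wf.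
have step y e r : trie_wf (size p) r -> codemeet x y = Some e ->
    (forall s, trie_mem (y :: s) (Node a b c d) = trie_mem s r) ->
    forall q', trie_mem q' (trie_meet p r) ->
    exists2 s, trie_mem s (Node a b c d) & patmeet (x :: p) s = Some (e :: q').
  move=> wr xy h q' /(IH _ _ wr)[s sr ps]; exists (y :: s); first by rewrite h.
  by rewrite /= xy ps.
have back r s q' : trie_wf (size p) r -> trie_mem s r -> patmeet p s = Some q' ->
    trie_mem q' (trie_meet p r) by move=> wr sr ps; apply/IH => //; exists s.
split.
  case: x step => step; rewrite mem_node; case: q => [|[] q] //=;
    rewrite ?(mem_union _ (wm _ _) (wm _ _)) //.
  - exact: (step C0).
  - exact: (step C1).
  - exact: (step C2).
  - exact: (step C3).
  - by case/orP; [apply: (step C0)|apply: (step C1)].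
  - by case/orP; [apply: (step C0)|apply: (step C2)].
  - by case/orP; [apply: (step C0)|apply: (step C3)].
move=> [[|y s]] //=; case E : codemeet => [e|] //; case E' : patmeet => [q'|] //= sm [<-].
case: x y e E sm {step} => [] [] // e [<-]; rewrite mem_node /= => sm;
  rewrite ?(mem_union _ (wm _ _) (wm _ _)) // ?(back _ _ _ _ sm E') ?orbT //.
Qed.

Fixpoint trie_single (p : seq code) : trie :=
  match p with
  | [::] => Leaf
  | C0 :: p' => Node (trie_single p') Empty Empty Empty
  | C1 :: p' => Node Empty (trie_single p') Empty Empty
  | C2 :: p' => Node Empty Empty (trie_single p') Empty
  | C3 :: p' => Node Empty Empty Empty (trie_single p')
  end.

Lemma trie_single_wf p : trie_wf (size p) (trie_single p).
Proof. by elim: p => // -[] p IH /=; rewrite IH. Qed.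

Lemma mem_single p q : trie_mem q (trie_single p) = (q == p).
Proof.
elim: p q => [|x p IH] [|y q] //=; first by case: x.
by rewrite eqseq_cons; case: x; case: y; rewrite /= ?IH //; case: q {IH}.
Qed.

(** Folded over a list from the top pattern, this produces every existing meet of a sublist. *)
Definition add_meets t p := trie_union t (trie_meet p t).

(* Under call-by-need evaluation, forcing the trie from time to time keeps the
   chains of suspended calls of [add_meets] short. *)
Fixpoint trie_force t : bool :=
  match t with
  | Empty | Leaf => true
  | Node a b c d => [&& trie_force a, trie_force b, trie_force c & trie_force d]
  end.

Fixpoint add_all_meets t (pss : seq (seq (seq code))) : trie :=
  if pss is ps :: r then
    (fun t' => if trie_force t' then add_all_meets t' r else Empty) (foldl add_meets t ps)
  else t.

Lemma add_all_meetsE t pss : add_all_meets t pss = foldl add_meets t (flatten pss).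
Proof.
have forceT s : trie_force s by elim: s => //= a -> b -> c -> d ->.
by elim: pss t => //= ps pss IH t; rewrite forceT IH foldl_cat.
Qed.

Lemma add_meets_wf n t ps : trie_wf n t -> all (fun p => size p == n) ps ->
  trie_wf n (foldl add_meets t ps).
Proof.
elim: ps t => //= p ps IH t tn /andP[/eqP pn psn]; apply: IH => //.
by apply: trie_union_wf => //; rewrite -pn; apply: trie_meet_wf; rewrite pn.
Qed.

Lemma mem_add_meets_ind (P : seq code -> Prop) n t ps :
  trie_wf n t -> all (fun p => size p == n) ps ->
  (forall p, trie_mem p t -> P p) ->
  (forall p q r, p \in ps -> P q -> patmeet p q = Some r -> P r) ->
  forall p, trie_mem p (foldl add_meets t ps) -> P p.
Proof.
elim: ps t => [t _ _ h _|p ps IH t tn /= /andP[/eqP pn psn] h hm]; first exact: h.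
have mn : trie_wf n (trie_meet p t) by rewrite -pn; apply: trie_meet_wf; rewrite pn.
apply: IH => // [|q|q q' r qs]; first exact: trie_union_wf.
  rewrite (mem_union _ tn mn) => /orP[/h//|]; rewrite -pn in tn.
  by move=> /(mem_meet _ tn)[s /h Ps e]; apply: hm Ps e; apply: mem_head.
by apply: hm; rewrite in_cons qs orbT.
Qed.

(* Since [b] is below each of them, the patterns of [ps] above [b] can be met
   one after the other. *)
Lemma mem_add_meets_glb n t ps b s :
  trie_wf n t -> all (fun p => size p == n) ps ->
  trie_mem s t -> patle b s ->
  exists2 r, trie_mem r (foldl add_meets t ps) &
    patle b r /\ forall p, p \in ps -> patle b p -> patle r p.
Proof.
move=> tn psn st bs.
suff [r rm [br rs rp]] : exists2 r, trie_mem r (foldl add_meets t ps) &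
    [/\ patle b r, patle r s & forall p, p \in ps -> patle b p -> patle r p].
  by exists r.
elim: ps t s tn psn st bs => [|p ps IH] t s tn /=; first by exists s; rewrite ?patle_refl.
move=> /andP[/eqP pn psn] st bs.
have mn : trie_wf n (trie_meet p t) by rewrite -pn; apply: trie_meet_wf; rewrite pn.
have un := trie_union_wf tn mn.
have [bp|bp] := boolP (patle b p).
  have [e pse] := patle_meet_exists bp bs.
  have em : trie_mem e (add_meets t p).
    rewrite (mem_union _ tn mn); apply/orP; right; rewrite -pn in tn.
    by apply/(mem_meet _ tn); exists s.
  have be : patle b e by rewrite (patle_meet b pse) bp.
  have [r rm [br re rp]] := IH _ _ un psn em be.
  have := patle_meet r pse; rewrite re => /esym/andP[rp' rs].
  exists r => //; split=> // p'; rewrite in_cons => /orP[/eqP->//|]; exact: rp.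
have sm : trie_mem s (add_meets t p) by rewrite (mem_union _ tn mn) st.
have [r rm [br rs rp]] := IH _ _ un psn sm bs.
exists r => //; split=> // p'; rewrite in_cons => /orP[/eqP->|]; last exact: rp.
by rewrite (negPf bp).
Qed.

(** * Points of the 4-cube *)

(* Coordinates on the 4-cube: index 0 is the constant 0, the indices 1 to 4 are
   the directions and [5 + v] is the vertex [v < 16], whose binary digits are
   its coordinates. *)
Definition triples : seq (nat * nat * nat) :=
  ([seq (i, 0, 0) | i <- iota 1 20] ++
  flatten [seq [seq (d.+1, 5 + v, 5 + v + 2 ^ d) | v <- iota 0 16 & ~~ odd (v %/ 2 ^ d)]
          | d <- iota 0 4])%N.

Section Patterns.
Variable R : realFieldType.
Implicit Types (a b c : R) (x y : nat -> R).

Definition min_twice a b c : Prop := [\/ a = b /\ a <= c, a = c /\ a <= b | b = c /\ b <= a].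

(** Only equalities are inspected: once the minimum is known to be attained twice, they determine
    where. On three distinct values the answer [C1] is a mere default. *)
Definition code_of a b c : code :=
  if a == b then if b == c then C0 else C3 else if a == c then C2 else C1.

Definition holds (d : code) a b c : Prop :=
  match d with
  | C0 => a = b /\ b = c
  | C1 => b = c /\ b < a
  | C2 => a = c /\ a < b
  | C3 => a = b /\ a < c
  end.

Lemma holds_code d a b c : holds d a b c -> code_of a b c = d /\ min_twice a b c.
Proof.
rewrite /code_of; case: d => /= -[e l].
- by rewrite e l eqxx; split=> //; constructor 1.
- by rewrite -e (gt_eqF l); split=> //; constructor 3; rewrite ltW.
- by rewrite -e (lt_eqF l) eqxx; split=> //; constructor 2; rewrite ltW.
- by rewrite -e eqxx (lt_eqF l); split=> //; constructor 1; rewrite ltW.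
Qed.

Lemma min_twice_holds a b c : min_twice a b c -> holds (code_of a b c) a b c.
Proof.
rewrite /code_of; have [<-|ab] := eqVneq a b; first have [<-|ac] := eqVneq a c => //=.
  by rewrite lt_neqAle ac; case=> -[e l] //; rewrite e eqxx in ac.
have [<-|ac] := eqVneq a c => /=.
  by rewrite lt_neqAle ab; case=> -[e l] //; rewrite e eqxx in ab.
case=> -[e l]; [by rewrite e eqxx in ab | by rewrite e eqxx in ac |].
by split=> //; rewrite lt_neqAle eq_sym ab.
Qed.

(** When the meet exists, the two triples share minimal entries, so their sum is minimal exactly at
    the shared ones. *)
Lemma holds_add d e f a b c a' b' c' : holds d a b c -> holds e a' b' c' ->
  codemeet d e = Some f -> holds f (a + a') (b + b') (c + c').
Proof. by case: d e => [] [] //= -[? ?] [? ?] [<-] /=; split; lra. Qed.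

Definition valid x : Prop :=
  x 0%N = 0 /\ forall t, t \in triples -> min_twice (x t.1.1) (x t.1.2) (x t.2).

Definition pattern x : seq code := [seq code_of (x t.1.1) (x t.1.2) (x t.2) | t <- triples].

Lemma size_pattern x : size (pattern x) = size triples.
Proof. exact: size_map. Qed.

Lemma validD x y p : valid x -> valid y -> patmeet (pattern x) (pattern y) = Some p ->
  valid (fun i => x i + y i) /\ pattern (fun i => x i + y i) = p.
Proof.
move=> [x0 vx] [y0 vy]; rewrite /valid x0 y0 addr0 /pattern.
elim: triples vx vy p => [|t s IH] vx vy p /=; first by case=> <-.
case E : codemeet => [e|] //; case E' : patmeet => [q|] //= [<-].
have [|t' ts|[_ vs] ps] := IH _ _ _ E'.
- by move=> t' ts; apply: vx; rewrite in_cons ts orbT.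
- by apply: vy; rewrite in_cons ts orbT.
have hx := min_twice_holds (vx t (mem_head _ _)).
have hy := min_twice_holds (vy t (mem_head _ _)).
have [-> h] := holds_code (holds_add hx hy E); rewrite ps; split=> //; split=> //.
by move=> t'; rewrite in_cons => /orP[/eqP->|/vs].
Qed.

Definition bool_code (a b c : bool) : code :=
  match a, b, c with
  | true, false, false => C1 | false, true, false => C2 | false, false, true => C3
  | _, _, _ => C0
  end.

(** Three bits have a unique minimum exactly when two of them are 1. *)
Definition bool_ok (a b c : bool) : bool := (a + b + c != 2)%N.

Definition bool_pattern (s : seq bool) : seq code :=
  [seq bool_code (nth false s t.1.1) (nth false s t.1.2) (nth false s t.2) | t <- triples].

Definition bool_valid (s : seq bool) : bool :=
  ~~ nth false s 0 && all (fun t : nat * nat * nat =>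
    bool_ok (nth false s t.1.1) (nth false s t.1.2) (nth false s t.2)) triples.

Lemma bool_holds (m : R) (a b c : bool) : 0 < m -> bool_ok a b c ->
  holds (bool_code a b c) (m * a%:R) (m * b%:R) (m * c%:R).
Proof. by move=> m0; case: a b c => [] [] []; rewrite ?mulr0 ?mulr1. Qed.

Lemma bool_validP (m : R) s : 0 < m -> bool_valid s ->
  valid (fun i => m * (nth false s i)%:R) /\
  pattern (fun i => m * (nth false s i)%:R) = bool_pattern s.
Proof.
move=> m0 /andP[/negPf s0 /allP h]; rewrite /valid s0 mulr0; split.
  by split=> // t /h/(bool_holds m0)/holds_code[].
by apply/eq_in_map => t /h/(bool_holds m0)/holds_code[].
Qed.

(** In the triple [(i, 0, 0)] a minimum attained twice means that 0 attains it. The code of this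
    triple also records whether the coordinate vanishes. *)
Lemma valid_ge0 x i : valid x -> (i <= 20)%N -> 0 <= x i.
Proof.
case: i => [|i] [x0 vx] i20; first by rewrite x0.
have /vx /= : (i.+1, 0, 0)%N \in triples.
  rewrite mem_cat; apply/orP; left; apply/mapP; exists i.+1 => //.
  by rewrite mem_iota.
by rewrite x0 => -[] [<-].
Qed.

Lemma triples_le t : t \in triples -> [&& t.1.1 <= 20, t.1.2 <= 20 & t.2 <= 20]%N.
Proof.
by apply/allP: t; vm_compute.
Qed.

Definition peel (m z : R) : R := if 0 < z then z - m else 0.

(** The triple is the sum of its peeled version and of [m] times the indicator of its support. As
    [m] is at most each positive entry, the remainder stays nonnegative and the two codes are
    compatible. *)
Lemma peel_holds (m a b c : R) : 0 < m -> 0 <= a -> 0 <= b -> 0 <= c ->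
  (0 < a -> m <= a) -> (0 < b -> m <= b) -> (0 < c -> m <= c) -> min_twice a b c ->
  [/\ bool_ok (0 < a) (0 < b) (0 < c), min_twice (peel m a) (peel m b) (peel m c) &
      codemeet (bool_code (0 < a) (0 < b) (0 < c))
        (code_of (peel m a) (peel m b) (peel m c)) =
      Some (code_of a b c)].
Proof.
move=> m0 a0 b0 c0 ma mb mc h.
have split_peel (z : R) : 0 <= z -> z = peel m z + m * (0 < z)%R%:R.
  by rewrite /peel => z0; case: (ltrP 0 z) => hz /=; lra.
have ok : bool_ok (0 < a) (0 < b) (0 < c).
  by case: h => -[]; case: (ltrP 0 a) => ha; case: (ltrP 0 b) => hb;
    case: (ltrP 0 c) => hc //; lra.
(* Existence of the meet is enough: [holds_add] identifies it as the code of the sum, which is the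
   original triple. *)
suff [t [g hg]] : min_twice (peel m a) (peel m b) (peel m c) /\ exists g,
    codemeet (bool_code (0 < a) (0 < b) (0 < c))
      (code_of (peel m a) (peel m b) (peel m c)) = Some g.
  split=> //; rewrite hg; congr Some.
  have [<- _] := holds_code (holds_add (bool_holds m0 ok) (min_twice_holds t) hg).
  by rewrite ![m * _ + _]addrC -!split_peel.
rewrite /peel; move: ok ma mb mc; case: (ltrP 0 a) => ha; case: (ltrP 0 b) => hb;
  case: (ltrP 0 c) => hc //= _ ma mb mc.
- split; last by eexists.
  by case: h => -[? ?]; [constructor 1|constructor 2|constructor 3]; split; lra.
- have am := ma isT; split; first by constructor 3; split; lra.
  by rewrite /code_of; case: (eqVneq (a - m) 0) => _; rewrite ?eqxx; eexists.
- have bm := mb isT; split; first by constructor 2; split; lra.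
  by rewrite /code_of; case: (eqVneq 0 (b - m)) => _; rewrite ?eqxx; eexists.
- have cm := mc isT; split; first by constructor 1; split; lra.
  by rewrite /code_of eqxx; case: (eqVneq 0 (c - m)) => _; eexists.
- by split; [constructor 1; split|eexists].
Qed.

(* Any valid point is a combination of indicators of a chain of valid 0/1
   points, obtained by repeatedly subtracting its least positive value on its
   support. *)
Lemma pattern_glb x p : valid x -> size p = size triples ->
  (forall s, size s = 21%N -> bool_valid s -> patle (pattern x) (bool_pattern s) ->
    patle p (bool_pattern s)) ->
  patle p (pattern x).
Proof.
move=> + szp; have [n] := ubnP #|[pred i : 'I_21 | 0 < x i]|.
elim: n x => // n IH x lex vx hp.
have [i0 xi0|no] := pickP [pred i : 'I_21 | 0 < x i]; last first.
  have z i : (i <= 20)%N -> x i = 0.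
    move=> i20; apply/eqP; rewrite eq_le valid_ge0 // andbT leNgt.
    by have /= -> := no (Ordinal (i20 : (i < 21)%N)).
  suff -> : pattern x = nseq (size p) C0.
    by elim: (p) => //= c q ->; case: c.
  rewrite szp; apply/all_pred1P.
  rewrite all_map; apply/allP => t /triples_le/and3P[h1 h2 h3].
  by rewrite /= !z // /code_of !eqxx.
case: (arg_minP (fun i : 'I_21 => x i) xi0) => j xj jmin.
pose m := x j; have m0 : 0 < m := xj.
have mle i : (i <= 20)%N -> 0 < x i -> m <= x i.
  by move=> i20; apply: (jmin (Ordinal (i20 : (i < 21)%N))).
pose F := mkseq (fun i => 0 < x i) 21.
pose y i := peel m (x i).
have nF i : (i <= 20)%N -> nth false F i = (0 < x i) by move=> ?; rewrite nth_mkseq.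
have peelP t (ts : t \in triples) :=
  let: And3 h1 h2 h3 := and3P (triples_le ts) in
  peel_holds m0 (valid_ge0 vx h1) (valid_ge0 vx h2) (valid_ge0 vx h3)
    (mle _ h1) (mle _ h2) (mle _ h3) (vx.2 t ts).
have FV : bool_valid F.
  rewrite /bool_valid nF // vx.1 ltxx; apply/allP => t ts; have [ok _ _] := peelP t ts.
  by have /and3P[h1 h2 h3] := triples_le ts; rewrite !nF.
have yV : valid y.
  by split=> [|t /peelP[]//]; rewrite /y vx.1 /peel ltxx.
have e : patmeet (bool_pattern F) (pattern y) = Some (pattern x).
  rewrite /pattern /bool_pattern.
  have : {subset triples <= triples} by [].
  (* The second occurrence stays fixed, so that the shrinking list remains inside [triples], where
     [peelP] applies. *)
  elim: {1 3 4 5}triples => //= t s IHs st.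
  have ts : t \in triples by apply: st; rewrite mem_head.
  have [_ _ h] := peelP t ts; have /and3P[h1 h2 h3] := triples_le ts.
  rewrite !nF // h IHs // => t' t's; apply: st; by rewrite in_cons t's orbT.
have le_x := patle_meet (pattern x) e; rewrite patle_refl in le_x.
have /esym/andP[xF xy] := le_x.
(* [p] is below the pattern of the support [F] by [hp], and below that of the peeled point by
   induction: the least positive coordinate has left the support. *)
rewrite (patle_meet p e) hp ?size_mkseq // /=; apply: IH => // [|s szs sV ys].
  rewrite -ltnS; apply: leq_trans lex; apply/proper_card/properP; split.
    by apply/fintype.subsetP => i; rewrite !inE /y /peel; case: ifP; rewrite ?ltxx.
  by exists j; rewrite !inE // /y /peel m0 subrr ltxx.
by apply: hp => //; apply: patle_trans xy ys.
Qed.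
End Patterns.

(** * Enumeration of the 0/1 points and of all patterns *)

Definition extend (ss : seq (seq bool)) (k : nat) : seq (seq bool) :=
  let ts := [seq t <- triples | maxn t.1.1 (maxn t.1.2 t.2) == k] in
  [seq s <- [seq rcons s b | s <- ss, b <- [:: false; true]] |
    all (fun t : nat * nat * nat =>
      bool_ok (nth false s t.1.1) (nth false s t.1.2) (nth false s t.2)) ts].

(** Backtracking from the constant 0: each new coordinate is tested at once against the triples in
    which it has the largest index, which keeps the intermediate lists short. *)
Definition bool_points : seq (seq bool) := foldl extend [:: [:: false]] (iota 1 20).

Lemma bool_points_complete s : size s = 21%N -> bool_valid s -> s \in bool_points.
Proof.
move=> szs /andP[s0 /allP ok].
suff h k : (k <= 20)%N -> take k.+1 s \in foldl extend [:: [:: false]] (iota 1 k).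
  by have := h 20%N isT; rewrite take_oversize ?szs.
elim: k => [_|k IH k20].
  by move: s0 szs {ok}; case: s => //= -[] //= s _ _; rewrite take0 mem_head.
rewrite -[X in iota 1 X]addn1 iotaD foldl_cat /= add1n mem_filter; apply/andP; split; last first.
  rewrite (take_nth false) ?szs //; apply/allpairsP; exists (take k.+1 s, nth false s k.+1).
  by split=> //=; [apply: IH; apply: ltnW | case: nth].
apply/allP => t; rewrite mem_filter => /andP[/eqP tk ts].
rewrite !nth_take ?ok //; rewrite ltnS -tk ?leq_maxl ?leq_maxr //.
  by rewrite leq_max leq_maxr orbT.
by rewrite leq_max leq_maxl orbT.
Qed.

Lemma bool_points_valid s : s \in bool_points -> bool_valid s.
Proof. by apply/allP: s; vm_compute. Qed.

Fixpoint chunks (T : Type) (fuel : nat) (s : seq T) : seq (seq T) :=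
  if fuel is fuel'.+1 then take 30 s :: chunks fuel' (drop 30 s) else [:: s].

Lemma flatten_chunks (T : Type) fuel (s : seq T) : flatten (chunks fuel s) = s.
Proof. by elim: fuel s => [|n IH] s /=; rewrite ?cats0 // IH cat_take_drop. Qed.

Definition origin : seq code := nseq (size triples) C0.

(** 32 chunks of 30 cover the 939 points; the splitting affects only the evaluation, not the
    result. *)
Definition pattern_trie : trie :=
  add_all_meets (trie_single origin) (chunks 32 (map bool_pattern bool_points)).

Lemma pattern_trieE : pattern_trie =
  foldl add_meets (trie_single origin) (map bool_pattern bool_points).
Proof. by rewrite /pattern_trie add_all_meetsE flatten_chunks. Qed.

Lemma size_origin : size origin = size triples. Proof. exact: size_nseq. Qed.

Lemma origin_wf : trie_wf (size triples) (trie_single origin).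
Proof. by rewrite -size_origin; apply: trie_single_wf. Qed.

Lemma bool_patterns_size :
  all (fun p => size p == size triples) (map bool_pattern bool_points).
Proof. by apply/allP => _ /mapP[s _ ->]; rewrite size_map. Qed.

Lemma pattern_trie_wf : trie_wf (size triples) pattern_trie.
Proof. by rewrite pattern_trieE; apply: add_meets_wf origin_wf bool_patterns_size. Qed.

Section Realization.
Variable R : realFieldType.

Lemma pattern_zero : valid (fun=> 0 : R) /\ pattern (fun=> 0 : R) = origin.
Proof.
split; first by split=> // t _; constructor 1.
by rewrite /pattern /origin /code_of eqxx; elim: triples => //= t s ->.
Qed.

Lemma pattern_trie_realized p : trie_mem p pattern_trie ->
  exists2 x : nat -> R, valid x & pattern x = p.
Proof.
rewrite pattern_trieE; move: p.
apply: (mem_add_meets_ind origin_wf bool_patterns_size) => [p|_ q r /mapP[s sb ->]].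
  by rewrite mem_single => /eqP ->; have [] := pattern_zero; exists (fun=> 0).
move=> [x vx <-] e; have [vy py] := bool_validP (ltr01 : 0 < 1 :> R) (bool_points_valid sb).
by rewrite -py in e; have [v <-] := validD vy vx e; eexists; first exact: v.
Qed.

(** The trie contains an element [r] above the pattern of [x] and below every 0/1 pattern above it.
    The converse inequality is [pattern_glb]. *)
Lemma pattern_trie_complete (x : nat -> R) : valid x -> trie_mem (pattern x) pattern_trie.
Proof.
move=> vx; rewrite pattern_trieE.
have o : trie_mem origin (trie_single origin) by rewrite mem_single.
have xo : patle (pattern x) origin.
  by rewrite /origin -(size_pattern x); elim: (pattern x) => //= c s ->; case: c.
have [r rm [xr rp]] := mem_add_meets_glb origin_wf bool_patterns_size o xo.
have szr : size r = size triples.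
  by move: xr; rewrite /patle all2E size_pattern => /andP[/eqP <-].
have rx : patle r (pattern x).
  apply: (pattern_glb vx szr) => s szs sV xs.
  by apply: rp xs; apply: map_f; apply: bool_points_complete.
by rewrite (patle_anti xr rx).
Qed.

End Realization.

(* The coordinates forced to coincide by a pattern: [merge] updates the list
   of class representatives, keeping 0 as a representative. *)
Definition merge (st : seq nat) (a b : nat) : seq nat :=
  let x := nth 0%N st a in let y := nth 0%N st b in
  if x == y then st
  else if x == 0%N then [seq if z == y then x else z | z <- st]
  else [seq if z == x then y else z | z <- st].

Definition merge_code st (t : nat * nat * nat) (c : code) : seq nat :=
  let: (a, b, d) := t in
  match c with
  | C0 => merge (merge st a b) b d
  | C1 => merge st b d
  | C2 => merge st a d
  | C3 => merge st a b
  end.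

Fixpoint merge_pattern ts st (p : seq code) : seq nat :=
  match ts, p with
  | t :: ts', c :: p' => merge_pattern ts' (merge_code st t c) p'
  | _, _ => st
  end.

Definition classes (p : seq code) : seq nat := merge_pattern triples (iota 0 21) p.

Fixpoint count_fixed (st : seq nat) (i : nat) : nat :=
  if st is x :: s then (if x == i then S else id) (count_fixed s i.+1) else 0.

(** Position 0 is dropped: the class of the constant 0 contributes no free parameter. *)
Definition pattern_dim (p : seq code) : nat := count_fixed (behead (classes p)) 1.

(** Following the trie, representatives are merged once for each shared prefix rather than once for
    each pattern. *)
Fixpoint trie_dims ts st t (acc : seq nat) : seq nat :=
  match t, ts with
  | Empty, _ => acc
  | Node a b c d, tr :: ts' =>
      trie_dims ts' (merge_code st tr C0) a
        (trie_dims ts' (merge_code st tr C1) b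
          (trie_dims ts' (merge_code st tr C2) c
            (trie_dims ts' (merge_code st tr C3) d acc)))
  | _, _ => count_fixed (behead st) 1 :: acc
  end.

Lemma trie_dimsE ts st t acc : trie_wf (size ts) t ->
  trie_dims ts st t acc =
  [seq count_fixed (behead (merge_pattern ts st p)) 1 | p <- leaves t] ++ acc.
Proof.
elim: t ts st acc => [||a IHa b IHb c IHc d IHd] [|tr ts] st acc //=.
move=> /and4P[wa wb wc wd]; rewrite IHa // IHb // IHc // IHd //.
by rewrite !map_cat -!catA -!map_comp.
Qed.

(** Matching on the successor forces it under call-by-need evaluation; the branch [N0] is never
    reached. Binary numbers suit counts in the thousands. *)
Fixpoint count_acc (k : nat) (s : seq nat) (n : BinNums.N) : BinNums.N :=
  if s is x :: s' then
    if x == k then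
      match BinNat.N.succ n with BinNums.N0 => BinNums.N0 | m => count_acc k s' m end
    else count_acc k s' n
  else n.

Lemma nat_of_succ_bin n : nat_of_bin (BinNat.N.succ n) = (nat_of_bin n).+1.
Proof. by case: n => //= p; apply: nat_of_succ_pos. Qed.

Lemma count_accE k s n : nat_of_bin (count_acc k s n) = (count_mem k s + nat_of_bin n)%N.
Proof.
elim: s n => //= x s IH n; case: eqP => _ /=; last exact: IH.
transitivity (nat_of_bin (count_acc k s (BinNat.N.succ n))); first by case: n.
by rewrite IH nat_of_succ_bin addnS add1n addSn.
Qed.

(** The bound 9 makes the entries beyond the list vanish. Counting begins at 1, since a cell has
    dimension one less than its span and the origin yields no cell. *)
Definition f_vector_check (l : seq nat) : bool :=
  all (fun k => k <= 9)%N l &&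
  ([seq count_acc k l BinNums.N0 | k <- iota 1 9] ==
   [seq bin_of_nat k | k <- [:: 201; 2014; 6810; 9581; 5425; 896; 72; 18; 2]%N]).

Lemma f_vector_check_count l i : f_vector_check l ->
  count_mem i.+1 l = nth 0%N [:: 201; 2014; 6810; 9581; 5425; 896; 72; 18; 2]%N i.
Proof.
move=> /andP[/allP le9 /eqP e]; have [i9|i9] := ltnP i 9; last first.
  rewrite nth_default //; apply/eqP; rewrite -leqn0 leqNgt -has_count.
  by apply/hasPn => k /le9 k9; rewrite /= neq_ltn (leq_ltn_trans k9).
have := congr1 (fun s => nat_of_bin (nth BinNums.N0 s i)) e.
rewrite (nth_map 0%N) ?size_iota // nth_iota // add1n count_accE addn0 => ->.
by rewrite (nth_map 0%N) // bin_of_natK.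
Qed.

Lemma pattern_trie_f_vector :
  f_vector_check (trie_dims triples (iota 0 21) pattern_trie [::]).
Proof. by vm_compute. Qed.

Lemma trie_dims_count t k : trie_wf (size triples) t ->
  count_mem k (trie_dims triples (iota 0 21) t [::]) =
  count (fun p => pattern_dim p == k) (leaves t).
Proof. by move=> wt; rewrite trie_dimsE // cats0 count_map; apply: eq_count => p. Qed.

Lemma cell_patterns (R : realFieldType) : exists s : seq (seq code), [/\ uniq s,
  forall p, p \in s <-> (exists2 x : nat -> R, valid x & pattern x = p) &
  forall i, count (fun p => pattern_dim p == i.+1) s =
    nth 0%N [:: 201; 2014; 6810; 9581; 5425; 896; 72; 18; 2]%N i].
Proof.
exists (leaves pattern_trie); split=> [|p|i]; first exact: leaves_uniq.
  rewrite mem_leaves; split; first exact: pattern_trie_realized.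
  by move=> [x vx <-]; exact: pattern_trie_complete.
move: (f_vector_check_count i pattern_trie_f_vector) (trie_dims_count i.+1 pattern_trie_wf).
by move: (trie_dims _ _ _ _) (leaves _) => l s -> ->.
Qed.

(** * Correctness of the class representatives *)

Definition code_tied (T : Type) (y : nat -> T) (t : nat * nat * nat) (c : code) : Prop :=
  let: (a, b, d) := t in
  match c with
  | C0 => y a = y b /\ y b = y d
  | C1 => y b = y d
  | C2 => y a = y d
  | C3 => y a = y b
  end.

Definition is_repr (st : seq nat) : Prop :=
  [/\ size st = 21%N, nth 0%N st 0 = 0%N,
      forall i, (i <= 20)%N -> (nth 0%N st i <= 20)%N &
      forall i, (i <= 20)%N -> nth 0%N st (nth 0%N st i) = nth 0%N st i].

Lemma mergeE st a b : exists u v,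
  [/\ merge st a b = [seq if z == u then v else z | z <- st],
      (u = nth 0%N st a /\ v = nth 0%N st b) \/ (u = nth 0%N st b /\ v = nth 0%N st a) &
      u = v \/ u != 0%N].
Proof.
rewrite /merge; have [e|ne] := eqVneq (nth 0%N st a) (nth 0%N st b).
  exists (nth 0%N st a), (nth 0%N st b); split; [|by left|by left].
  by rewrite e -[LHS]map_id; apply: eq_map => z; case: eqP.
have [e|ne0] := eqVneq (nth 0%N st a) 0%N.
  exists (nth 0%N st b), (nth 0%N st a); split; [by []|by right|right].
  by move: ne; rewrite e eq_sym.
by exists (nth 0%N st a), (nth 0%N st b); split; [|left|right].
Qed.

Lemma nth_merge st a b : size st = 21%N -> exists g : nat -> nat,
  [/\ forall i, (i <= 20)%N -> nth 0%N (merge st a b) i = g (nth 0%N st i),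
      g (nth 0%N st a) = g (nth 0%N st b) & size (merge st a b) = 21%N].
Proof.
move=> sz; have [u [v [-> h _]]] := mergeE st a b.
exists (fun z => if z == u then v else z); split; last by rewrite size_map.
  by move=> i i20; rewrite (nth_map 0%N) // sz.
by case: h => -[-> ->]; rewrite eqxx; case: eqP.
Qed.

Lemma merge_repr st a b : (a <= 20)%N -> (b <= 20)%N -> is_repr st ->
  is_repr (merge st a b).
Proof.
move=> a20 b20 [sz z0 le20 idem]; have [u [v [-> h uv]]] := mergeE st a b.
have fu : nth 0%N st u = u by case: h => -[-> _]; apply: idem.
have fv : nth 0%N st v = v by case: h => -[_ ->]; apply: idem.
have lv : (v <= 20)%N by case: h => -[_ ->]; apply: le20.
have nE i : (i <= 20)%N -> nth 0%N [seq if z == u then v else z | z <- st] i =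
    if nth 0%N st i == u then v else nth 0%N st i.
  by move=> i20; rewrite (nth_map 0%N) // sz.
split=> [||i i20|i i20]; first by rewrite size_map.
- by rewrite nE // z0; case: eqP => // u0; case: uv => [<-//|]; rewrite -u0.
- by rewrite nE //; case: ifP => _; [exact: lv|exact: le20].
rewrite (nE i) //; case: ifP => h'; first by rewrite nE // fv; case: eqP.
by rewrite nE ?le20 // idem // h'.
Qed.

Lemma merge_sound (T : Type) (y : nat -> T) st a b : (a <= 20)%N -> (b <= 20)%N ->
  size st = 21%N -> (forall i, (i <= 20)%N -> y i = y (nth 0%N st i)) -> y a = y b ->
  forall i, (i <= 20)%N -> y i = y (nth 0%N (merge st a b) i).
Proof.
move=> a20 b20 sz ys yab i i20; have [u [v [-> h _]]] := mergeE st a b.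
rewrite (nth_map 0%N) ?sz //; case: eqP => [e|_]; last exact: ys.
have := yab; rewrite (ys a a20) (ys b b20) (ys i i20) e.
by case: h => -[-> ->].
Qed.

Lemma subset_behead (T : eqType) (x : T) s (P : {pred T}) :
  {subset x :: s <= P} -> x \in P /\ {subset s <= P}.
Proof.
by move=> h; split=> [|y ys]; apply: h; rewrite ?mem_head // in_cons ys orbT.
Qed.

Lemma merge_code_repr st t c : t \in triples -> is_repr st -> is_repr (merge_code st t c).
Proof.
move=> /triples_le; case: t => -[a b] d /= /and3P[? ? ?] rs.
by case: c; do ?apply: merge_repr.
Qed.

Lemma merge_code_sound (T : Type) (y : nat -> T) st t c : t \in triples -> is_repr st ->
  (forall i, (i <= 20)%N -> y i = y (nth 0%N st i)) -> code_tied y t c ->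
  forall i, (i <= 20)%N -> y i = y (nth 0%N (merge_code st t c) i).
Proof.
move=> /triples_le; case: t => -[a b] d /= /and3P[a20 b20 d20] rs ys.
have [sz _ _ _] := rs; case: c => /=; [|exact: merge_sound..].
have [sz' _ _ _] := merge_repr a20 b20 rs; case=> ab bd.
exact: merge_sound d20 sz' (merge_sound a20 b20 sz ys ab) bd.
Qed.

Lemma nth_merge_code st t c : t \in triples -> is_repr st -> exists g : nat -> nat,
  (forall i, (i <= 20)%N -> nth 0%N (merge_code st t c) i = g (nth 0%N st i)) /\
  code_tied (g \o nth 0%N st) t c.
Proof.
move=> /triples_le; case: t => -[a b] d /= /and3P[a20 b20 d20] rs.
have [sz _ _ _] := rs.
have one a' b' : exists g : nat -> nat,
    (forall i, (i <= 20)%N -> nth 0%N (merge st a' b') i = g (nth 0%N st i)) /\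
    g (nth 0%N st a') = g (nth 0%N st b').
  by have [g [h1 h2 _]] := nth_merge a' b' sz; exists g.
case: c => /=; [|exact: one..].
have [sz' _ _ _] := merge_repr a20 b20 rs.
have [g [hg eg _]] := nth_merge b d sz'; have [g' [hg' eg' _]] := nth_merge a b sz.
exists (g \o g'); split=> [i i20|/=]; first by rewrite hg // hg'.
by rewrite eg'; split=> //; rewrite -!hg'.
Qed.

Lemma merge_pattern_repr ts st p : {subset ts <= triples} -> is_repr st ->
  is_repr (merge_pattern ts st p).
Proof.
elim: ts st p => [|t ts IH] st [|c p] //= /subset_behead[tt sub] rs.
by apply: IH => //; apply: merge_code_repr.
Qed.

Lemma merge_pattern_sound (T : Type) (y : nat -> T) ts st p : {subset ts <= triples} ->
  is_repr st -> (forall i, (i <= 20)%N -> y i = y (nth 0%N st i)) ->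
  (forall t c, (t, c) \in zip ts p -> code_tied y t c) ->
  forall i, (i <= 20)%N -> y i = y (nth 0%N (merge_pattern ts st p) i).
Proof.
elim: ts st p => [|t ts IH] st [|c p] //= /subset_behead[tt sub] rs ys h.
apply: IH => // [||t' c' k]; first exact: merge_code_repr.
  by apply: merge_code_sound => //; apply: h; rewrite mem_head.
by apply: h; rewrite in_cons k orbT.
Qed.

(** Each merge composes the representatives with a map, so coordinates once identified stay
    identified. *)
Lemma merge_pattern_mono ts st p : {subset ts <= triples} -> is_repr st ->
  exists g : nat -> nat,
    forall i, (i <= 20)%N -> nth 0%N (merge_pattern ts st p) i = g (nth 0%N st i).
Proof.
elim: ts st p => [|t ts IH] st [|c p] /=; try by exists id.
move=> /subset_behead[tt sub] rs.
have [g hg] := IH _ p sub (merge_code_repr c tt rs).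
have [g' [hg' _]] := nth_merge_code c tt rs.
by exists (g \o g') => i i20; rewrite hg // hg'.
Qed.

Lemma code_tied_comp (S T : Type) (g : S -> T) (y : nat -> S) (y' : nat -> T) t c :
  t \in triples -> (forall i, (i <= 20)%N -> y' i = g (y i)) ->
  code_tied y t c -> code_tied y' t c.
Proof.
move=> /triples_le; case: t => -[a b] d /= /and3P[a20 b20 d20] h.
by case: c => /=; rewrite !h //; [case=> -> -> | move=> -> ..].
Qed.

Lemma merge_pattern_tied ts st p t c : {subset ts <= triples} -> is_repr st ->
  (t, c) \in zip ts p -> code_tied (nth 0%N (merge_pattern ts st p)) t c.
Proof.
elim: ts st p => [|t' ts IH] st [|c' p] //= /subset_behead[tt sub] rs.
have rs' := merge_code_repr c' tt rs.
rewrite in_cons => /orP[/eqP[-> ->]|]; last exact: IH.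
have [g hg] := merge_pattern_mono p sub rs'.
have [g' [hg' h]] := nth_merge_code c' tt rs.
by apply: (code_tied_comp (g := g) tt) h => i i20; rewrite hg // hg'.
Qed.

Lemma iota_repr : is_repr (iota 0 21).
Proof. by split=> // i i20; rewrite !nth_iota. Qed.

Lemma classes_repr p : is_repr (classes p).
Proof. exact: merge_pattern_repr iota_repr. Qed.

Lemma mem_zip_fst (S T : eqType) (s : seq S) (t : seq T) x y : (x, y) \in zip s t -> x \in s.
Proof.
elim: s t => [|a s IH] [|b t] //=; rewrite !in_cons => /orP[/eqP[-> _]|/IH->].
  by rewrite eqxx.
by rewrite orbT.
Qed.

(** Only forced identifications are made, so a solution of the ties is constant on classes.
    Conversely the representatives themselves satisfy the ties, and [y] factors through them. *)
Lemma classesP (T : Type) (y : nat -> T) p :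
  (forall t c, (t, c) \in zip triples p -> code_tied y t c) <->
  (forall i, (i <= 20)%N -> y i = y (nth 0%N (classes p) i)).
Proof.
split=> [h i i20|h t c tc].
  apply: (merge_pattern_sound _ iota_repr) => // j j20.
  by rewrite nth_iota.
have := merge_pattern_tied (fun _ => id) iota_repr tc.
exact: code_tied_comp (mem_zip_fst tc) h.
Qed.

(** * Linear spans of the cones *)

Section Dimension.
Variable R : realType.
Implicit Types (x y z : nat -> R) (u : 'rV[R]_20).

Lemma patle_tied x y t c : valid x -> valid y -> patle (pattern x) (pattern y) ->
  (t, c) \in zip triples (pattern x) -> code_tied y t c.
Proof.
move=> [_ vx] [_ vy]; rewrite /pattern.
elim: triples vx vy => //= t' s IH vx vy /andP[le les].
rewrite in_cons => /orP[/eqP[-> ->]|]; last first.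
  by apply: IH => // k ks; [apply: vx|apply: vy]; rewrite in_cons ks orbT.
have := min_twice_holds (vy t' (mem_head _ _)); move: le; case: t' {IH vx vy} => -[a b] d /=.
by case: (code_of (x a) _ _); case: (code_of (y a) _ _) => //= _ [e1 e2]; rewrite ?e1 ?e2.
Qed.

Lemma lt_perturb (a b a' b' : R) : a < b ->
  exists2 e, 0 < e & forall d, 0 <= d <= e -> a + d * a' < b + d * b'.
Proof.
move=> ab; have [h|h] := leP a' b'.
  by exists 1 => // d /andP[d0 _]; rewrite ltr_leD // ler_wpM2l.
(* Half of the critical value keeps the inequality strict on the closed interval. *)
exists ((b - a) / (a' - b') / 2).
  by rewrite !divr_gt0 // subr_gt0.
move=> d /andP[d0 hd].
have hh : d * (a' - b') <= (b - a) / 2.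
  by rewrite -ler_pdivlMr ?subr_gt0 // mulrAC.
by lra.
Qed.

(** The ties are linear equations that [z] satisfies, and strict inequalities survive a small
    change. This is why the span of a cone is cut out by its ties alone. *)
Lemma relint_perturb x z : valid x -> z 0%N = 0 ->
  (forall t c, (t, c) \in zip triples (pattern x) -> code_tied z t c) ->
  exists2 e, 0 < e & valid (fun i => x i + e * z i) /\
                     pattern (fun i => x i + e * z i) = pattern x.
Proof.
move=> [x0 vx] z0 h; rewrite /valid x0 z0.
suff [e e0 he] : exists2 e, 0 < e & forall d, 0 <= d <= e -> forall t, t \in triples ->
    holds (code_of (x t.1.1) (x t.1.2) (x t.2))
      (x t.1.1 + d * z t.1.1) (x t.1.2 + d * z t.1.2) (x t.2 + d * z t.2).
  have ee : 0 <= e <= e by rewrite lexx ltW.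
  exists e => //; split; first split; first by rewrite mulr0 addr0.
    by move=> t ts; have [] := holds_code (he e ee t ts).
  by apply/eq_in_map => t ts; have [] := holds_code (he e ee t ts).
move: vx h; rewrite /pattern.
elim: triples => [|t s IH] vx h; first by exists 1.
have [t' ts|t' c ts|e e0 he] := IH.
- by apply: vx; rewrite in_cons ts orbT.
- by apply: h; rewrite /= in_cons ts orbT.
have ht := h t _ (mem_head _ _); have xt := min_twice_holds (vx t (mem_head _ _)).
suff [e' e'0 he'] : exists2 e', 0 < e' & forall d, 0 <= d <= e' ->
    holds (code_of (x t.1.1) (x t.1.2) (x t.2))
      (x t.1.1 + d * z t.1.1) (x t.1.2 + d * z t.1.2) (x t.2 + d * z t.2).
  exists (Num.min e e'); first by rewrite lt_min e0.
  move=> d; rewrite le_min => /and3P[d0 de de'] t'; rewrite in_cons.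
  by case/orP => [/eqP->|ts]; [apply: he'|apply: he]; rewrite ?d0.
case: t {h IH vx he} ht xt => -[a b] d /=; case: code_of => /= ht [e1 e2].
- by exists 1 => // k _; rewrite e1 e2 ht.1 ht.2.
- have [e' e'0 he'] := lt_perturb (z b) (z a) e2.
  by exists e' => // k hk; rewrite -e1 -ht he'.
- have [e' e'0 he'] := lt_perturb (z a) (z b) e2.
  by exists e' => // k hk; rewrite -e1 -ht he'.
- have [e' e'0 he'] := lt_perturb (z a) (z d) e2.
  by exists e' => // k hk; rewrite -e1 -ht he'.
Qed.

Definition coord_ext u (i : nat) : R := if i is j.+1 then u 0 (inord j) else 0.

Lemma coord_extD u v i : coord_ext (u + v) i = coord_ext u i + coord_ext v i.
Proof. by case: i => [|i] /=; rewrite ?addr0 // mxE. Qed.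

Lemma coord_extZ (c : R) u i : coord_ext (c *: u) i = c * coord_ext u i.
Proof. by case: i => [|i] /=; rewrite ?mulr0 // mxE. Qed.

Lemma coord_ext_row x i : x 0%N = 0 -> (i <= 20)%N ->
  coord_ext (\row_j x j.+1) i = x i.
Proof. by case: i => [|i] x0 i20 //=; rewrite mxE inordK. Qed.

Lemma eq_valid x y : (forall i, (i <= 20)%N -> x i = y i) -> valid x ->
  valid y /\ pattern y = pattern x.
Proof.
move=> e [x0 vx]; split; last first.
  by apply/eq_in_map => t /triples_le/and3P[? ? ?]; rewrite !e.
split=> [|t ts]; first by rewrite -e.
by have /and3P[? ? ?] := triples_le ts; rewrite -!e //; apply: vx.
Qed.

Lemma count_fixedE s i :
  count_fixed s i = count (fun j => nth 0%N s (j - i) == j) (iota i (size s)).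
Proof.
elim: s i => //= x s IH i; rewrite subnn /= IH.
have -> : count (fun j => nth 0%N s (j - i.+1) == j) (iota i.+1 (size s)) =
    count (fun j => nth 0%N (x :: s) (j - i) == j) (iota i.+1 (size s)).
  apply: eq_in_count => j; rewrite mem_iota => /andP[ij _].
  by rewrite -(subnSK ij).
by case: (x == i).
Qed.

Lemma class_basis p : exists B : 'M[R]_(pattern_dim p, 20),
  (forall z : 'rV_(pattern_dim p), z *m B = 0 -> z = 0) /\
  forall u, (exists z : 'rV_(pattern_dim p), u = z *m B) <->
    (forall i, (i <= 20)%N -> coord_ext u i = coord_ext u (nth 0%N (classes p) i)).
Proof.
have [sz st0 le20 idem] := classes_repr p; set st := classes p in sz st0 le20 idem *.
pose I := [seq i <- iota 1 20 | nth 0%N st i == i].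
have szI : size I = pattern_dim p.
  rewrite /pattern_dim count_fixedE size_filter size_behead sz -/st.
  apply: eq_in_count => j; rewrite mem_iota => /andP[j1 _].
  by rewrite nth_behead subnSK // subn0.
have uI : uniq I by rewrite filter_uniq // iota_uniq.
have memI i : (i \in I) = [&& 0 < i, i <= 20 & nth 0%N st i == i]%N.
  by rewrite mem_filter mem_iota andbC andbA.
have nI (l : 'I_(pattern_dim p)) : nth 0%N I l \in I by rewrite mem_nth // szI.
(* Row [l] is the indicator of the class represented by entry [l] of [I]; the class of 0 has no row.
   Column [j] stands for coordinate [j + 1]. *)
pose B : 'M[R]_(pattern_dim p, 20) :=
  \matrix_(l, j) (nth 0%N I l == nth 0%N st j.+1)%:R.
have zB (z : 'rV_(pattern_dim p)) (l : 'I_(pattern_dim p)) i :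
    (0 < i <= 20)%N -> nth 0%N st i = nth 0%N I l -> coord_ext (z *m B) i = z 0 l.
  case: i => // i /= i20 e; rewrite mxE (bigD1 l) //= big1 => [|k kl].
    by rewrite !mxE inordK // e eqxx mulr1 addr0.
  rewrite !mxE inordK // e nth_uniq ?szI // (_ : (k == l :> nat) = false) ?mulr0 //.
  exact: negbTE.
have zB0 (z : 'rV_(pattern_dim p)) i : (i <= 20)%N -> nth 0%N st i = 0%N ->
    coord_ext (z *m B) i = 0.
  case: i => // i /= i20 e; rewrite mxE big1 // => l _; rewrite !mxE inordK // e.
  by have := nI l; rewrite memI => /and3P[l0 _ _]; rewrite gtn_eqF // mulr0.
have cases i : (i <= 20)%N -> nth 0%N st i = 0%N \/
    exists l : 'I_(pattern_dim p), nth 0%N st i = nth 0%N I l.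
  move=> i20; have [->|n0] := eqVneq (nth 0%N st i) 0%N; [by left | right].
  have iI : nth 0%N st i \in I by rewrite memI lt0n n0 le20 // idem //=.
  have lt : (index (nth 0%N st i) I < pattern_dim p)%N by rewrite -szI index_mem.
  by exists (Ordinal lt); rewrite /= nth_index.
exists B; split.
  move=> z zB_0; apply/rowP => l; have := nI l; rewrite memI => /and3P[l0 l20 /eqP e].
  by rewrite -(zB z l _ _ e) ?l0 // zB_0 mxE; case: (nth _ _ _) l0 => //= k; rewrite mxE.
move=> u; split=> [[z ->] i i20|h].
  have [e0|[l el]] := cases i i20.
    by rewrite e0 zB0.
  have := nI l; rewrite -el memI => /and3P[p0 p20 _].
  rewrite (zB z l (nth 0%N st i)) ?p0 ?idem //.
  case: i i20 el p0 p20 => [|i] i20 el p0 p20; first by rewrite st0 in p0.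
  by apply: zB.
exists (\row_l coord_ext u (nth 0%N I l)); apply/rowP => j.
have j20 : (j.+1 <= 20)%N by [].
have -> : u 0 j = coord_ext u j.+1 by rewrite /= inord_val.
rewrite [RHS](_ : _ = coord_ext (\row_l coord_ext u (nth 0%N I l) *m B) j.+1); last first.
  by rewrite /= inord_val.
rewrite h //; have [e0|[l el]] := cases j.+1 j20; first by rewrite e0 zB0.
by rewrite (zB _ l) // mxE el.
Qed.

End Dimension.

(** * The relations of the Vamos matroid *)

(* The coordinates at the bases in [gauge] parametrize the lineality space, and
   each step determines the coordinate at one more basis. Both lists were found
   by a search. *)
Definition gauge : seq (seq nat) :=
  [:: [:: 0; 5; 6; 7]; [:: 0; 1; 6; 7]; [:: 0; 2; 5; 6]; [:: 0; 2; 5; 7];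
      [:: 3; 5; 6; 7]; [:: 0; 4; 5; 6]; [:: 0; 1; 5; 7]; [:: 0; 3; 5; 6]]%N.

Definition steps : seq (nat * bool * seq nat) :=
  [:: (2, true, [:: 0; 6; 2; 1; 5; 7]); (0, false, [:: 0; 2; 1; 7; 6; 5]);
      (0, false, [:: 5; 6; 3; 2; 7; 0]); (0, false, [:: 2; 5; 7; 3; 0; 6]);
      (4, true, [:: 6; 7; 3; 1; 5; 0]); (13, false, [:: 1; 6; 3; 2; 7; 0]);
      (14, false, [:: 1; 7; 3; 2; 6; 0]); (11, true, [:: 0; 6; 1; 4; 7; 5]);
      (1, false, [:: 0; 1; 4; 2; 6; 7]); (0, false, [:: 0; 2; 5; 4; 6; 1]);
      (3, false, [:: 1; 6; 4; 3; 0; 7]); (0, false, [:: 3; 6; 5; 4; 7; 1]);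
      (0, false, [:: 1; 4; 2; 3; 0; 6]); (0, false, [:: 3; 5; 4; 7; 6; 2]);
      (0, false, [:: 3; 4; 1; 7; 6; 5]); (0, false, [:: 1; 4; 0; 7; 2; 3]);
      (12, false, [:: 0; 7; 5; 4; 6; 1]); (0, false, [:: 0; 5; 1; 6; 7; 2]);
      (0, false, [:: 0; 5; 4; 1; 2; 7]); (0, false, [:: 1; 4; 3; 5; 2; 0]);
      (0, false, [:: 3; 4; 2; 7; 1; 5]); (0, false, [:: 3; 5; 2; 1; 6; 4]);
      (0, false, [:: 3; 4; 2; 6; 7; 5]); (0, false, [:: 3; 7; 2; 6; 4; 1]);
      (0, false, [:: 2; 6; 0; 7; 5; 3]); (10, false, [:: 0; 7; 4; 2; 1; 6]);
      (9, false, [:: 0; 6; 2; 4; 7; 1]); (16, false, [:: 1; 7; 3; 5; 6; 0]);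
      (15, false, [:: 1; 6; 5; 3; 0; 7]); (7, true, [:: 0; 6; 3; 7; 5; 1]);
      (0, false, [:: 3; 6; 4; 0; 5; 7]); (0, false, [:: 0; 4; 7; 3; 1; 6]);
      (0, false, [:: 0; 4; 3; 5; 7; 1]); (0, false, [:: 3; 5; 0; 2; 4; 1]);
      (0, false, [:: 3; 4; 2; 0; 1; 6]); (0, false, [:: 0; 2; 3; 1; 5; 7]);
      (0, false, [:: 0; 1; 5; 3; 7; 2]); (0, false, [:: 4; 5; 6; 2; 3; 0]);
      (0, false, [:: 2; 5; 4; 7; 6; 0]); (0, false, [:: 4; 5; 2; 1; 6; 3]);
      (0, false, [:: 5; 6; 4; 7; 2; 0]); (0, false, [:: 6; 7; 2; 4; 0; 5]);
      (0, false, [:: 1; 2; 7; 5; 0; 3]); (0, false, [:: 0; 3; 1; 7; 2; 4]);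
      (0, false, [:: 0; 1; 6; 3; 4; 5]); (0, false, [:: 6; 7; 0; 4; 3; 2]);
      (0, false, [:: 2; 5; 1; 6; 7; 3]); (0, false, [:: 6; 7; 4; 1; 5; 3]);
      (0, false, [:: 2; 6; 7; 1; 0; 5]); (0, false, [:: 6; 7; 1; 5; 2; 4]);
      (17, false, [:: 1; 6; 2; 4; 7; 0]); (20, false, [:: 1; 7; 4; 5; 6; 0]);
      (5, false, [:: 0; 6; 2; 3; 1; 7]); (18, false, [:: 1; 7; 2; 4; 6; 0]);
      (6, false, [:: 0; 7; 3; 2; 1; 6]); (19, false, [:: 1; 6; 4; 5; 7; 0]);
      (8, false, [:: 0; 7; 3; 5; 1; 6])]%N.

Definition bits_of (l : seq nat) : seq bool := [seq x \in l | x <- iota 0 8].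

Definition vamos_nonbasis_bits : seq (seq bool) :=
  map bits_of [:: [:: 0; 1; 3; 4]; [:: 0; 1; 2; 5]; [:: 2; 3; 4; 5];
                  [:: 3; 4; 6; 7]; [:: 2; 5; 6; 7]]%N.

Definition is_basis_bits (s : seq bool) : bool :=
  [&& size s == 8, count id s == 4 & s \notin vamos_nonbasis_bits]%N.

Fixpoint vadd (a b : seq int) : seq int :=
  match a, b with
  | [::], _ => b
  | _, [::] => a
  | x :: a', y :: b' => (x + y) :: vadd a' b'
  end.

Definition vopp (a : seq int) : seq int := [seq - x | x <- a].

(** Trailing zeros are optional in vectors, so lists of different lengths may be equal. *)
Definition veq (a b : seq int) : bool := all (fun x => x == 0) (vadd a (vopp b)).

Definition unit_vec (e : nat) : seq int := if e is e'.+1 then ncons e' 0 [:: 1] else [::].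

Definition table := seq (seq bool * seq int).

Fixpoint lookup (tab : table) (s : seq bool) : option (seq int) :=
  if tab is (s', v) :: tab' then if s == s' then Some v else lookup tab' s else None.

Definition entry tab s : seq int := odflt [::] (lookup tab s).

(* A relation is given by the list [c; d; i; j; k; l], with S = {c, d}; its
   three terms are indexed by the pairs of bases below. *)
Definition term1 (q : seq nat) : seq bool * seq bool :=
  let n := nth 0%N q in
  (bits_of [:: n 2; n 3; n 0; n 1]%N, bits_of [:: n 4; n 5; n 0; n 1]%N).
Definition term2 (q : seq nat) : seq bool * seq bool :=
  let n := nth 0%N q in
  (bits_of [:: n 2; n 4; n 0; n 1]%N, bits_of [:: n 3; n 5; n 0; n 1]%N).
Definition term3 (q : seq nat) : seq bool * seq bool :=
  let n := nth 0%N q in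
  (bits_of [:: n 2; n 5; n 0; n 1]%N, bits_of [:: n 3; n 4; n 0; n 1]%N).

Definition term_vec tab (t : seq bool * seq bool) : seq int :=
  vadd (entry tab t.1) (entry tab t.2).

Definition sign_vec (b : bool) (v : seq int) := if b then vopp v else v.

(* The step (e, b, q) solves [p_Sij + p_Skl - p_Sik - p_Sjl = +/- y_e] for
   p_Sij, where y_0 = 0. *)
Definition step_entry tab (st : nat * bool * seq nat) : seq bool * seq int :=
  let: (e, b, q) := st in
  ((term1 q).1, vadd (vadd (term_vec tab (term2 q)) (vopp (entry tab (term1 q).2)))
                     (sign_vec b (unit_vec e))).

(** Positions 0 to 19 of a vector are the cube coordinates 1 to 20; positions 20 to 27 are the gauge
    coordinates. *)
Definition gauge_table : table :=
  [seq (bits_of (nth [::] gauge i), unit_vec (20 + i).+1) | i <- iota 0 8].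

Definition vamos_table : table :=
  foldl (fun tab st => step_entry tab st :: tab) gauge_table steps.

Definition step_of (e : nat) : nat * bool * seq nat :=
  nth (0%N, false, [::]) steps (find (fun st => st.1.1 == e) steps).

Definition is_basis_term (t : seq bool * seq bool) : bool :=
  is_basis_bits t.1 && is_basis_bits t.2.

Definition support (m a : seq int) : seq nat :=
  [seq j.+1 | j <- iota 0 20 & nth 0 a j != nth 0 m j].

Definition min_int (x y : int) : int := if (x <= y)%R then x else y.

(** A guess at what the three terms have beyond a common part. It needs no proof of its own, because
    [same_base] verifies it in each case; in particular the terms must agree at the gauge positions,
    which are left out here. *)
Definition residues (a b c : seq int) : seq (seq nat) :=
  let m := [seq min_int (nth 0 a j) (min_int (nth 0 b j) (nth 0 c j)) | j <- iota 0 20] in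
  [:: support m a; support m b; support m c].

(** A list with fewer than two entries is padded with index 0, whose vector is 0. *)
Definition residue_vec (s : seq nat) : seq int :=
  vadd (unit_vec (nth 0%N s 0)) (unit_vec (nth 0%N s 1)).

Definition is_triple (x y z : nat) : bool :=
  has (mem triples) [:: (x, y, z); (x, z, y); (y, x, z); (y, z, x); (z, x, y); (z, y, x)].

(** These are the four triangles on four points, and equal letters mark opposite edges. In a square
    of the cube one letter stands for the two directions, the other two for the diagonals. *)
Definition is_square (a1 a2 b1 b2 c1 c2 : nat) : bool :=
  [&& is_triple a1 b1 c1, is_triple a1 b2 c2, is_triple a2 b1 c2 & is_triple a2 b2 c1].

Definition triple_residues (rs : seq (seq nat)) : bool :=
  let r i := nth 0%N (nth [::] rs i) in
  [&& r 0 1 == 0, r 1 1 == 0, r 2 1 == 0 & is_triple (r 0 0) (r 1 0) (r 2 0)]%N.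

(** Exchanging the entries in two of the three pairs permutes the triangles, so only the parity of
    the exchanges matters and two cases suffice. *)
Definition square_residues (rs : seq (seq nat)) : bool :=
  let r i := nth 0%N (nth [::] rs i) in
  is_square (r 0 0) (r 0 1) (r 1 0) (r 1 1) (r 2 0) (r 2 1) ||
  is_square (r 0 1) (r 0 0) (r 1 0) (r 1 1) (r 2 0) (r 2 1).

Definition same_base a b (ra rb : seq nat) : bool :=
  veq (vadd a (residue_vec rb)) (vadd b (residue_vec ra)).

Definition distinct_terms (q : seq nat) : bool :=
  let: (t1, t2, t3) := (term1 q, term2 q, term3 q) in
  [&& uniq q, size q == 6, all (fun x => x < 8) q,
      t1.1 \notin [:: t2.1; t2.2; t3.1; t3.2] & t2.1 \notin [:: t3.1; t3.2]]%N.

Definition three_check (a b c : seq int) : bool :=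
  let rs := residues a b c in
  let r i := nth [::] rs i in
  [&& same_base a b (r 0%N) (r 1%N), same_base a c (r 0%N) (r 2%N) &
   triple_residues rs || square_residues rs].

(** With no term the polynomial is 0; two terms must agree identically on the parametrized space. A
    single term is rejected, as the tropical hypersurface of a monomial is empty. *)
Definition relation_check tab (q : seq nat) : bool :=
  let: (t1, t2, t3) := (term1 q, term2 q, term3 q) in
  distinct_terms q &&
  match pmap id [seq (if is_basis_term t then Some (term_vec tab t) else None)
                | t <- [:: t1; t2; t3]] with
  | [::] => true
  | [:: a; b] => veq a b
  | [:: a; b; c] => three_check a b c
  | _ => false
  end.

Definition increasing_pairs : seq (nat * nat) :=
  [seq p <- [seq (i, j) | i <- iota 0 8, j <- iota 0 8] | p.1 < p.2]%N.

(** Increasing indices are enough, because permuting [i], [j], [k], [l] only permutes the three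
    terms up to signs. *)
Definition relations : seq (seq nat) :=
  [seq q <- [seq [:: s.1; s.2] ++ ij | s <- increasing_pairs,
               ij <- [seq [:: i.1; i.2; k.1; k.2] | i <- increasing_pairs, k <- increasing_pairs]]
         | uniq q && (nth 0 q 3 < nth 0 q 4)]%N.

Definition triple_of tab (q : seq nat) : option (nat * nat * nat) :=
  let: (t1, t2, t3) := (term1 q, term2 q, term3 q) in
  let rs := residues (term_vec tab t1) (term_vec tab t2) (term_vec tab t3) in
  let r i := nth 0%N (nth [::] rs i) 0 in
  if all is_basis_term [:: t1; t2; t3] && triple_residues rs then
    Some (r 0%N, r 1%N, r 2%N) else None.

Definition permuted (t t' : nat * nat * nat) : bool :=
  let: (x, y, z) := t in
  t' \in [:: (x, y, z); (x, z, y); (y, x, z); (y, z, x); (z, x, y); (z, y, x)].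

(** A step with [e] equal to 0 must come from a two-term relation, hence the test on the third term.
    Any other step must be the one that defines coordinate [e]. *)
Definition step_check (st : nat * bool * seq nat) : bool :=
  let: (e, _, q) := st in
  [&& distinct_terms q, is_basis_term (term1 q), is_basis_term (term2 q), e <= 20,
      ~~ is_basis_term (term3 q) || (e != 0) & (e == 0) || (step_of e == st)]%N.

Definition bits_list : seq (seq bool) :=
  iter 8 (fun l => [seq b :: s | b <- [:: true; false], s <- l]) [:: [::]].

Fixpoint build_check (tab : table) (sts : seq (nat * bool * seq nat)) : bool :=
  if sts is st :: sts' then
    let t1 := term1 st.2 in let t2 := term2 st.2 in
    all (fun s => lookup tab s != None) [:: t1.2; t2.1; t2.2] &&
    build_check (step_entry tab st :: tab) sts'
  else true.

Lemma build_checkP : build_check gauge_table steps.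
Proof. by vm_compute. Qed.

Lemma relation_checkP : all (relation_check vamos_table) relations.
Proof. by vm_compute. Qed.

(** This makes points of the Dressian valid, while [relation_checkP] serves the converse. Applying
    an abstraction lets the list be computed once for all triples. *)
Lemma triple_ofP : (fun l => all (fun t => has (fun t' => permuted t' t) l) triples)
  (pmap (triple_of vamos_table) relations).
Proof. by vm_compute. Qed.

Lemma step_checkP : all step_check steps.
Proof. by vm_compute. Qed.

Lemma step_ofP : all (fun e => (step_of e).1.1 == e) (iota 1 20).
Proof. by vm_compute. Qed.

(** The 8 gauge bases and the 57 steps account for all 65 bases. *)
Lemma lookup_basis : all (fun s => is_basis_bits s ==> (lookup vamos_table s != None)) bits_list.
Proof. by vm_compute. Qed.

Lemma step_vecP : all (fun e => let: (_, b, q) := step_of e in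
    veq (vadd (term_vec vamos_table (term1 q)) (vopp (term_vec vamos_table (term2 q))))
        (sign_vec b (unit_vec e))) (iota 1 20).
Proof. by vm_compute. Qed.

(** * Bases as bit vectors and terms as monomials *)

Definition set_of_bits (s : seq bool) : {set 'I_8} := [set x : 'I_8 | nth false s x]%SET.

Lemma size_bits_of l : size (bits_of l) = 8%N. Proof. by rewrite size_map size_iota. Qed.

Lemma in_set_of_bits_of (x : 'I_8) l : (x \in set_of_bits (bits_of l)) = (nat_of_ord x \in l).
Proof. by rewrite inE (nth_map 0%N) ?size_iota // nth_iota. Qed.

Lemma set_of_bits_inj s s' : size s = 8%N -> size s' = 8%N ->
  set_of_bits s = set_of_bits s' -> s = s'.
Proof.
move=> sz sz' /setP e; apply: (eq_from_nth (x0 := false)); rewrite ?sz // => i i8.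
by have := e (Ordinal i8); rewrite !inE.
Qed.

Lemma set4E (a b c d : 'I_8) :
  a |: (b |: [set c; d]) = set_of_bits (bits_of [:: a : nat; b : nat; c : nat; d : nat]).
Proof. by apply/setP => x; rewrite in_set_of_bits_of !inE !orbA. Qed.

Lemma card_set_of_bits s : size s = 8%N -> #|set_of_bits s| = count id s.
Proof.
move=> sz; rewrite -sum1_card.
rewrite (eq_bigl (fun i : 'I_8 => nth false s i)) => [|i]; last by rewrite inE.
rewrite -sum1_count (big_nth false) sz big_mkord.
by apply: eq_bigl.
Qed.

Lemma basis_bitsP s : size s = 8%N -> (set_of_bits s \in bases vamos) = is_basis_bits s.
Proof.
move=> sz; rewrite /= inE card_set_of_bits // /is_basis_bits sz eqxx /=; congr (_ && ~~ _).
rewrite inE -[[seq _ | s <- _]]/(map (fun l => [set x : 'I_8 | (x : nat) \in l]%SET) _).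
rewrite /vamos_nonbasis_bits; set ls := (X in map _ X); rewrite -/ls.
apply/mapP/mapP => -[l ll e]; exists l => //.
  apply: set_of_bits_inj; rewrite ?size_bits_of // e.
  by apply/setP => x; rewrite in_set_of_bits_of inE.
by rewrite e; apply/setP => x; rewrite in_set_of_bits_of inE.
Qed.

Definition basis_index (s : seq bool) : option 'I_#|bases vamos| :=
  [pick i | enum_val i == set_of_bits s].

Lemma basis_indexP s : size s = 8%N ->
  if is_basis_bits s then exists2 i, basis_index s = Some i & enum_val i = set_of_bits s
  else basis_index s = None.
Proof.
move=> sz; rewrite -basis_bitsP // /basis_index; case: pickP => [i /eqP e|no].
  by rewrite -e enum_valP; exists i.
case: ifP => // sb; have := no (enum_rank_in sb (set_of_bits s)).
by rewrite enum_rankK_in // eqxx.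
Qed.

Lemma plucker_varE s : plucker_var vamos (set_of_bits s) =
  if basis_index s is Some i then 'X_i else 0.
Proof. by []. Qed.

(** [None] stands for a term killed by a nonbasis. *)
Definition term_mnm (t : seq bool * seq bool) : option 'X_{1..#|bases vamos|} :=
  match basis_index t.1, basis_index t.2 with
  | Some i, Some j => Some (U_(i) + U_(j))%MM
  | _, _ => None
  end.

Definition mnm_poly (n : nat) (o : option 'X_{1..n}) : {mpoly int[n]} :=
  if o is Some u then 'X_[u] else 0.

Lemma plucker_termE t : plucker_var vamos (set_of_bits t.1) * plucker_var vamos (set_of_bits t.2) =
  mnm_poly (term_mnm t).
Proof.
rewrite !plucker_varE /term_mnm; case: basis_index => [i|]; last by rewrite mul0r.
by case: basis_index => [j|]; rewrite ?mulr0 //= mpolyXD.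
Qed.

(** Distinct monomials cannot cancel: each receives a single contribution, 1 or -1. *)
Lemma msupp_three (n : nat) (x y z : option 'X_{1..n}) :
  uniq (pmap id [:: x; y; z]) ->
  perm_eq (msupp (mnm_poly x - mnm_poly y + mnm_poly z)) (pmap id [:: x; y; z]).
Proof.
move=> u; apply: (uniq_perm (msupp_uniq _) u) => m.
pose ind (o : option 'X_{1..n}) := if o is Some v then v == m else false.
have cE o : (mnm_poly o)@_m = (ind o)%:R.
  by case: o => [v|]; rewrite /= ?mcoeffX ?mcoeff0.
have -> : (m \in pmap id [:: x; y; z]) = [|| ind x, ind y | ind z].
  by case: x y z {u} => [x|] [y|] [z|]; rewrite /= ?inE ?orbF ?(eq_sym m).
have two : [&& ~~ (ind x && ind y), ~~ (ind x && ind z) & ~~ (ind y && ind z)].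
  have ne (v v' : 'X_{1..n}) : v != v' -> ~~ ((v == m) && (v' == m)).
    by apply: contraNN => /andP[/eqP-> /eqP->].
  by case: x y z u => [x|] [y|] [z|]; rewrite /= ?inE ?negb_or ?andbT ?andbF //=;
    do ?[case/andP]; intros; rewrite ?ne.
rewrite mcoeff_msupp mcoeffD mcoeffB !cE.
by case: (ind x) (ind y) (ind z) two => [] [] [].
Qed.

Lemma three_term_pluckerE (c d i j k l : 'I_8) :
  three_term_plucker vamos [set c; d] i j k l =
  let q := [:: c : nat; d : nat; i : nat; j : nat; k : nat; l : nat] in
  mnm_poly (term_mnm (term1 q)) - mnm_poly (term_mnm (term2 q)) +
  mnm_poly (term_mnm (term3 q)).
Proof. by rewrite /three_term_plucker !set4E -!plucker_termE. Qed.

Lemma term_mnm_basis t : size t.1 = 8%N -> size t.2 = 8%N ->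
  isSome (term_mnm t) = is_basis_term t.
Proof.
move=> s1 s2; rewrite /term_mnm /is_basis_term.
have := basis_indexP s1; have := basis_indexP s2.
by case: ifP => _ => [[j -> _]|->]; case: ifP => _ => [[i -> _]|->].
Qed.

(** * Parametrization by the cube and gauge coordinates *)

Section Weights.
Variable R : realType.
Local Notation V := 'rV[R]_#|bases vamos|.
Implicit Types (w : V) (z : nat -> R).

Definition basis_coord w (s : seq bool) : R := if basis_index s is Some i then w 0 i else 0.

Definition term_weight w (t : seq bool * seq bool) : R :=
  basis_coord w t.1 + basis_coord w t.2.

Lemma weightU (n : nat) (w : 'rV[R]_n) (i j : 'I_n) :
  weight w (U_(i) + U_(j))%MM = w 0 i + w 0 j.
Proof.
have one (k : 'I_n) : \sum_l w 0 l *+ (U_(k)%MM : 'X_{1..n}) l = w 0 k.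
  rewrite (bigD1 k) //= mnm1E eqxx big1 ?addr0 // => l lk.
  by rewrite mnm1E eq_sym (negPf lk).
rewrite -(one i) -(one j) -big_split; apply: eq_bigr => l _.
by rewrite mnmDE mulrnDr.
Qed.

Lemma weight_term w t u : term_mnm t = Some u -> weight w u = term_weight w t.
Proof.
rewrite /term_mnm /term_weight /basis_coord.
by case: basis_index => // i; case: basis_index => // j [<-]; rewrite weightU.
Qed.

Fixpoint ev z (v : seq int) : R :=
  if v is c :: v' then c%:~R * z 0%N + ev (fun i => z i.+1) v' else 0.

Lemma ev_vadd z a b : ev z (vadd a b) = ev z a + ev z b.
Proof.
elim: a b z => [|x a IH] [|y b] z /=; rewrite ?add0r ?addr0 //.
by rewrite IH rmorphD /= mulrDl addrACA.
Qed.

Lemma ev_vopp z a : ev z (vopp a) = - ev z a.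
Proof.
elim: a z => [|x a IH] z /=; first by rewrite oppr0.
by rewrite IH rmorphN /= mulNr opprD.
Qed.

Lemma ev_eq z a b : veq a b -> ev z a = ev z b.
Proof.
move=> h; apply/eqP; rewrite -subr_eq0 -ev_vopp -ev_vadd; move: h; rewrite /veq.
elim: (vadd _ _) z => //= x s IH z /andP[/eqP-> h].
by rewrite mul0r add0r IH.
Qed.

Lemma ev_unit z e : ev z (unit_vec e) = if e is j.+1 then z j else 0.
Proof.
case: e => //= e; elim: e z => [|e IH] z /=; first by rewrite mul1r addr0.
by rewrite mul0r add0r IH.
Qed.

Lemma ev_sign z b v : ev z (sign_vec b v) = (if b then -1 else 1) * ev z v.
Proof. by case: b; rewrite /= ?ev_vopp ?mulN1r ?mul1r. Qed.

Lemma evD z z' v : ev (fun i => z i + z' i) v = ev z v + ev z' v.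
Proof.
elim: v z z' => [|c v IH] z z' /=; first by rewrite addr0.
by rewrite IH mulrDr addrACA.
Qed.

Lemma evZ (a : R) z v : ev (fun i => a * z i) v = a * ev z v.
Proof.
elim: v z => [|c v IH] z /=; first by rewrite mulr0.
by rewrite IH mulrDr mulrCA.
Qed.

Lemma eq_ev z z' v : (forall i, z i = z' i) -> ev z v = ev z' v.
Proof. by elim: v z z' => //= c v IH z z' e; rewrite e (IH _ (fun i => z' i.+1)). Qed.

Definition bits_of_set (A : {set 'I_8}) : seq bool := [seq inord x \in A | x <- iota 0 8].

Lemma set_of_bitsK s : size s = 8%N -> bits_of_set (set_of_bits s) = s.
Proof.
move=> sz; apply: (eq_from_nth (x0 := false)); rewrite size_map size_iota // => i i8.
by rewrite (nth_map 0%N) ?size_iota // nth_iota // inE inordK.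
Qed.

Lemma bits_of_setK A : set_of_bits (bits_of_set A) = A.
Proof.
by apply/setP => x; rewrite inE (nth_map 0%N) ?size_iota // nth_iota // add0n inord_val.
Qed.

Lemma size_bits_of_set A : size (bits_of_set A) = 8%N.
Proof. by rewrite size_map size_iota. Qed.

Definition emb z : V := \row_i ev z (entry vamos_table (bits_of_set (enum_val i))).

Lemma embD z z' : emb (fun i => z i + z' i) = emb z + emb z'.
Proof. by apply/rowP => i; rewrite !mxE evD. Qed.

Lemma embZ (a : R) z : emb (fun i => a * z i) = a *: emb z.
Proof. by apply/rowP => i; rewrite !mxE evZ. Qed.

Lemma eq_emb z z' : (forall i, z i = z' i) -> emb z = emb z'.
Proof. by move=> e; apply/rowP => i; rewrite !mxE (eq_ev _ e). Qed.

Lemma basis_coord_emb z s : is_basis_bits s -> basis_coord (emb z) s = ev z (entry vamos_table s).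
Proof.
move=> sb; have sz : size s = 8%N by case/and3P: sb => /eqP.
have := basis_indexP sz; rewrite sb /basis_coord => -[i -> e].
by rewrite mxE e set_of_bitsK.
Qed.

Lemma term_weight_emb z t : is_basis_term t ->
  term_weight (emb z) t = ev z (term_vec vamos_table t).
Proof. by case/andP => h1 h2; rewrite /term_weight !basis_coord_emb // ev_vadd. Qed.

Definition step_diff w (q : seq nat) : R :=
  term_weight w (term1 q) - term_weight w (term2 q).

Definition y_coord w (e : nat) : R :=
  let: (_, b, q) := step_of e in (if b then -1 else 1) * step_diff w q.

Definition z_coord w (i : nat) : R :=
  if (i < 20)%N then y_coord w i.+1 else basis_coord w (bits_of (nth [::] gauge (i - 20))).

(** The two-term equations used to fill the table; by [emb_z_coord] they suffice to recover [w] from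
    its coordinates. *)
Definition flat w : Prop :=
  forall st, st \in steps -> st.1.1 = 0%N -> step_diff w st.2 = 0.

Lemma lookup_mem (tab : table) s : lookup tab s != None -> (s, entry tab s) \in tab.
Proof.
rewrite /entry; elim: tab => //= -[s' v] tab IH; case: (eqVneq s s') => [<- _|_ /IH h].
  by rewrite mem_head.
by rewrite in_cons h orbT.
Qed.

Definition consistent w (tab : table) : Prop :=
  forall s v, (s, v) \in tab -> basis_coord w s = ev (z_coord w) v.

(** The symbolic table repeats the solution of the equations at [w]: each step expresses one basis
    through three that are already known. *)
Lemma consistent_build w tab sts : {subset sts <= steps} -> flat w ->
  build_check tab sts -> consistent w tab ->
  consistent w (foldl (fun tab st => step_entry tab st :: tab) tab sts).
Proof.
move=> + fw; elim: sts tab => //= -[[e b] q] sts IH tab /subset_behead[st sub].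
move=> /andP[/and4P[k1 k2 k3 _] ok] con; apply: IH => // s v.
rewrite in_cons => /orP[/eqP[-> ->]|]; last exact: con.
have val s' : lookup tab s' != None -> ev (z_coord w) (entry tab s') = basis_coord w s'.
  by move=> /lookup_mem/con.
rewrite !ev_vadd ev_vopp ev_sign ev_unit !val //.
suff -> : (if b then -1 else 1) * (if e is j.+1 then z_coord w j else 0) = step_diff w q.
  by rewrite /step_diff /term_weight /=; lra.
have /and5P[_ _ _ e20 /andP[_ /orP[/eqP e0|/eqP eb]]] := allP step_checkP _ st.
  by rewrite e0 mulr0 (fw _ st).
case: e e20 st eb {k1 k2 k3 ok val} => [|e] e20 st eb; first by rewrite mulr0 (fw _ st).
rewrite /z_coord e20 /y_coord eb mulrA.
by case: b {st eb}; rewrite ?mulrNN !mul1r.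
Qed.

Lemma bits_list_complete s : size s = 8%N -> s \in bits_list.
Proof.
rewrite /bits_list; elim: {1 2}8%N s => [|n IH] s; first by move/size0nil->.
case: s => // b s [sz]; apply/allpairsP; exists (b, s); split; rewrite ?IH //.
by case: b.
Qed.

Lemma emb_z_coord w : flat w -> emb (z_coord w) = w.
Proof.
move=> fw; have con : consistent w vamos_table.
  apply: (consistent_build (fun _ => id) fw build_checkP) => s v /mapP[i].
  rewrite mem_iota => i8 [-> ->]; have /= -> := ev_unit (z_coord w) (20 + i).+1.
  by rewrite /z_coord ltnNge leq_addr /= addKn.
apply/rowP => i; rewrite mxE; set s := bits_of_set (enum_val i).
have sz : size s = 8%N by apply: size_bits_of_set.
have sb : is_basis_bits s by rewrite -basis_bitsP // bits_of_setK enum_valP.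
have := implyP (allP lookup_basis _ (bits_list_complete sz)) sb.
move=> /lookup_mem/con <-; have := basis_indexP sz; rewrite sb /basis_coord => -[j -> e].
by congr (w 0 _); apply: enum_val_inj; rewrite e bits_of_setK.
Qed.

End Weights.

Lemma basis_index_val s i : basis_index s = Some i -> enum_val i = set_of_bits s.
Proof. by rewrite /basis_index; case: pickP => // j /eqP e [<-]. Qed.

(** The variable of [t.1] occurs in [u] but not in [u']. *)
Lemma term_mnm_neq t t' u u' : size t.1 = 8%N -> size t'.1 = 8%N -> size t'.2 = 8%N ->
  t.1 \notin [:: t'.1; t'.2] -> term_mnm t = Some u -> term_mnm t' = Some u' -> u != u'.
Proof.
move=> sz sz1 sz2 nt; rewrite /term_mnm.
case E1 : basis_index => [i|] //; case: basis_index => [j|] // [<-].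
case E2 : (basis_index t'.1) => [k|] //; case E3 : (basis_index t'.2) => [l|] // [<-].
have ne s m : basis_index s = Some m -> size s = 8%N -> t.1 != s -> m != i.
  move=> Em ss; apply: contraNneq => mi; apply/eqP/set_of_bits_inj => //.
  by rewrite -(basis_index_val E1) -(basis_index_val Em) mi.
move: nt; rewrite !inE negb_or => /andP[n1 n2].
apply/eqP => /(congr1 (fun v : 'X_{1..#|bases vamos|} => v i)) /eqP.
rewrite !mnmDE !mnm1E eqxx (negPf (ne _ _ E2 sz1 n1)) (negPf (ne _ _ E3 sz2 n2)).
by rewrite add1n.
Qed.

Definition relation_poly (q : seq nat) : {mpoly int[#|bases vamos|]} :=
  mnm_poly (term_mnm (term1 q)) - mnm_poly (term_mnm (term2 q)) +
  mnm_poly (term_mnm (term3 q)).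

Definition relation_mnms (q : seq nat) : seq 'X_{1..#|bases vamos|} :=
  pmap id [:: term_mnm (term1 q); term_mnm (term2 q); term_mnm (term3 q)].

Lemma relation_mnms_uniq q : distinct_terms q -> uniq (relation_mnms q).
Proof.
case/and5P=> _ _ _; rewrite !inE !negb_or => /and4P[n1 n2 n3 n4] /andP[n5 n6].
rewrite /relation_mnms.
have ne12 := @term_mnm_neq (term1 q) (term2 q) _ _ (size_bits_of _)
  (size_bits_of _) (size_bits_of _).
have ne13 := @term_mnm_neq (term1 q) (term3 q) _ _ (size_bits_of _)
  (size_bits_of _) (size_bits_of _).
have ne23 := @term_mnm_neq (term2 q) (term3 q) _ _ (size_bits_of _)
  (size_bits_of _) (size_bits_of _).
rewrite !inE !negb_or in ne12 ne13 ne23.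
rewrite n1 n2 in ne12; rewrite n3 n4 in ne13; rewrite n5 n6 in ne23.
case: (term_mnm (term1 q)) ne12 ne13 => [u1|] ne12 ne13;
  case: (term_mnm (term2 q)) ne12 ne23 => [u2|] ne12 ne23;
  case: (term_mnm (term3 q)) ne13 ne23 => [u3|] ne13 ne23 //=;
  by rewrite ?inE ?negb_or ?(ne12 _ _ isT erefl erefl) ?(ne13 _ _ isT erefl erefl)
             ?(ne23 _ _ isT erefl erefl).
Qed.

Lemma msupp_relation q : distinct_terms q ->
  perm_eq (msupp (relation_poly q)) (relation_mnms q).
Proof. by move=> dq; apply: msupp_three; apply: relation_mnms_uniq. Qed.

Lemma relation_poly_plucker q : distinct_terms q ->
  plucker_relations vamos (relation_poly q).
Proof.
case/and5P; case: q => [|c [|d [|i [|j [|k [|l [|? ?]]]]]]] // uq _.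
move=> /and5P[c8 d8 i8 j8 /and3P[k8 l8 _]] _ _.
have uo : uniq [:: Ordinal c8; Ordinal d8; Ordinal i8; Ordinal j8; Ordinal k8; Ordinal l8].
  by rewrite -(map_inj_uniq val_inj).
exists [set Ordinal c8; Ordinal d8]%SET, (Ordinal i8), (Ordinal j8), (Ordinal k8), (Ordinal l8).
move: uo; rewrite /= !inE !negb_or.
move=> /and5P[/and5P[cd ci cj ck cl] /and4P[di dj dk dl] ij jk rest].
split; last by rewrite three_term_pluckerE.
- by rewrite cards2 cd.
- by rewrite /= ij jk rest.
- by rewrite /= !(eq_sym _ (Ordinal c8)) !(eq_sym _ (Ordinal d8)) ci cj ck cl di dj dk dl.
Qed.

(** * Shapes of the relations on the parametrized space *)

Section Shapes.
Variable R : realType.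
Local Notation V := 'rV[R]_#|bases vamos|.
Implicit Types (w : V) (z : nat -> R).

Definition tcoord z (e : nat) : R := if e is j.+1 then z j else 0.

(** The common summand [b] does not affect ties, so only the remaining cube coordinates matter. *)
Inductive rel_shape (f : {mpoly int[#|bases vamos|]}) : Prop :=
  | Shape0 of msupp f = [::]
  | Shape2 u1 u2 of perm_eq (msupp f) [:: u1; u2] &
      (forall z, weight (emb z) u1 = weight (emb z) u2)
  | Shape3 u1 u2 u3 t of perm_eq (msupp f) [:: u1; u2; u3] & t \in triples &
      (forall z, exists b, [/\ weight (emb z) u1 = b + tcoord z t.1.1,
        weight (emb z) u2 = b + tcoord z t.1.2 & weight (emb z) u3 = b + tcoord z t.2])
  | Shape4 u1 u2 u3 a1 a2 b1 b2 c1 c2 of perm_eq (msupp f) [:: u1; u2; u3] &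
      is_square a1 a2 b1 b2 c1 c2 &
      (forall z, exists b, [/\ weight (emb z) u1 = b + (tcoord z a1 + tcoord z a2),
        weight (emb z) u2 = b + (tcoord z b1 + tcoord z b2) &
        weight (emb z) u3 = b + (tcoord z c1 + tcoord z c2)]).

Lemma rel_shape_perm f g : perm_eq (msupp f) (msupp g) -> rel_shape g -> rel_shape f.
Proof.
move=> fg; case.
- by move=> e; apply: Shape0; apply/perm_nilP; rewrite -e.
- by move=> u1 u2 p; apply: Shape2; apply: perm_trans fg p.
- by move=> u1 u2 u3 t p; apply: Shape3; apply: perm_trans fg p.
- by move=> u1 u2 u3 a1 a2 b1 b2 c1 c2 p; apply: Shape4; apply: perm_trans fg p.
Qed.

Lemma ev_residue z s : ev z (residue_vec s) = tcoord z (nth 0%N s 0) + tcoord z (nth 0%N s 1).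
Proof. by rewrite ev_vadd !ev_unit. Qed.

Lemma same_base_weight z a b ra rb : same_base a b ra rb ->
  ev z b = (ev z a - ev z (residue_vec ra)) + ev z (residue_vec rb).
Proof. by move=> /(ev_eq z); rewrite !ev_vadd => h; lra. Qed.

Lemma is_tripleP (i j k : nat) : is_triple i j k ->
  exists2 t, t \in triples & permuted (i, j, k) t.
Proof. by move=> /hasP[t tp tt]; exists t. Qed.

(* Reordering the three monomials realizes any permutation of the entries. *)
Lemma shape3_permuted (f : {mpoly int[#|bases vamos|]}) u1 u2 u3 t t' :
  perm_eq (msupp f) [:: u1; u2; u3] -> permuted t t' ->
  (forall z, exists b, [/\ weight (emb z) u1 = b + tcoord z t.1.1,
      weight (emb z) u2 = b + tcoord z t.1.2 & weight (emb z) u3 = b + tcoord z t.2]) ->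
  exists v1 v2 v3, perm_eq (msupp f) [:: v1; v2; v3] /\
  (forall z, exists b, [/\ weight (emb z) v1 = b + tcoord z t'.1.1,
      weight (emb z) v2 = b + tcoord z t'.1.2 & weight (emb z) v3 = b + tcoord z t'.2]).
Proof.
case: t => -[x y] s pf; rewrite /permuted !inE => h hw.
have ex v1 v2 v3 : perm_eq [:: u1; u2; u3] [:: v1; v2; v3] ->
    perm_eq (msupp f) [:: v1; v2; v3] by apply: perm_trans.
have sw (a b c : 'X_{1..#|bases vamos|}) : perm_eq [:: a; b; c] [:: b; a; c].
  by apply/permP => p /=; rewrite addnCA.
have sw' (a b c : 'X_{1..#|bases vamos|}) : perm_eq [:: a; b; c] [:: a; c; b].
  by apply/permP => p /=; congr (_ + _)%N; rewrite addnCA.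
move: h; do 5?[case/orP]; move=> /eqP->.
- by exists u1, u2, u3.
- exists u1, u3, u2; split; first exact: ex.
  by move=> z; have [b [h1 h2 h3]] := hw z; exists b.
- exists u2, u1, u3; split; first exact: ex.
  by move=> z; have [b [h1 h2 h3]] := hw z; exists b.
- exists u2, u3, u1; split; first by apply: ex; apply: perm_trans (sw _ _ _) (sw' _ _ _).
  by move=> z; have [b [h1 h2 h3]] := hw z; exists b.
- exists u3, u1, u2; split; first by apply: ex; apply: perm_trans (sw' _ _ _) (sw _ _ _).
  by move=> z; have [b [h1 h2 h3]] := hw z; exists b.
- exists u3, u2, u1; split.
    by apply: ex; apply: perm_trans (sw _ _ _) (perm_trans (sw' _ _ _) (sw _ _ _)).
  by move=> z; have [b [h1 h2 h3]] := hw z; exists b.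
Qed.

Lemma triple_weights (rs : seq (seq nat)) z a b c :
  same_base a b (nth [::] rs 0) (nth [::] rs 1) ->
  same_base a c (nth [::] rs 0) (nth [::] rs 2) ->
  let r i k := tcoord z (nth 0%N (nth [::] rs i) k) in
  exists d, [/\ ev z a = d + (r 0%N 0%N + r 0%N 1%N), ev z b = d + (r 1%N 0%N + r 1%N 1%N) &
    ev z c = d + (r 2%N 0%N + r 2%N 1%N)].
Proof.
move=> h1 h2; exists (ev z a - ev z (residue_vec (nth [::] rs 0))).
by rewrite (same_base_weight z h1) (same_base_weight z h2) !ev_residue subrK.
Qed.

Arguments three_check : simpl never.
Arguments veq : simpl never.

Lemma relation_shape q : relation_check vamos_table q -> rel_shape (relation_poly q).
Proof.
rewrite /relation_check; case/andP => dq.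
have p := msupp_relation dq; rewrite /relation_mnms in p.
have val t u z : size t.1 = 8%N -> size t.2 = 8%N -> term_mnm t = Some u ->
    weight (emb z) u = ev z (term_vec vamos_table t).
  move=> s1 s2 tu; rewrite (weight_term _ tu) term_weight_emb //.
  by rewrite -term_mnm_basis // tu.
have v1 u z := val (term1 q) u z (size_bits_of _) (size_bits_of _).
have v2 u z := val (term2 q) u z (size_bits_of _) (size_bits_of _).
have v3 u z := val (term3 q) u z (size_bits_of _) (size_bits_of _).
have b1 := @term_mnm_basis (term1 q) (size_bits_of _) (size_bits_of _).
have b2 := @term_mnm_basis (term2 q) (size_bits_of _) (size_bits_of _).
have b3 := @term_mnm_basis (term3 q) (size_bits_of _) (size_bits_of _).
rewrite [map _ _]/= -b1 -b2 -b3 {b1 b2 b3 val}.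
move: (term_vec vamos_table (term1 q)) (term_vec vamos_table (term2 q))
  (term_vec vamos_table (term3 q)) v1 v2 v3 p => a b c.
case: (term_mnm (term1 q)) => [u1|] v1; case: (term_mnm (term2 q)) => [u2|] v2;
  case: (term_mnm (term3 q)) => [u3|] v3 p; rewrite /= //;
  last by move=> _; apply: Shape0; apply/perm_nilP.
- rewrite /three_check; move: (residues a b c) => rs; case/and3P => h1 h2 /orP[|].
    case/and4P => /eqP e1 /eqP e2 /eqP e3 /is_tripleP[t tt pt].
    have [|w1 [w2 [w3 [pw hw]]]] := shape3_permuted p pt.
      move=> z; have [d [k1 k2 k3]] := triple_weights z h1 h2.
      by exists d; rewrite /= (v1 _ z erefl) (v2 _ z erefl) (v3 _ z erefl) k1 k2 k3
        e1 e2 e3 /= !addr0.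
    exact: Shape3 pw tt hw.
  by case/orP => sq; apply: (Shape4 p sq) => z; have [d [k1 k2 k3]] := triple_weights z h1 h2;
    exists d; rewrite (v1 _ z erefl) (v2 _ z erefl) (v3 _ z erefl) k1 k2 k3 //;
    rewrite (addrC (tcoord _ _)).
- by move=> h; apply: (Shape2 p) => z; rewrite (v1 _ z erefl) (v2 _ z erefl) (ev_eq z h).
- by move=> h; apply: (Shape2 p) => z; rewrite (v1 _ z erefl) (v3 _ z erefl) (ev_eq z h).
- by move=> h; apply: (Shape2 p) => z; rewrite (v2 _ z erefl) (v3 _ z erefl) (ev_eq z h).
Qed.

Definition plucker_prod (S : {set 'I_8}) (i j k l : 'I_8) : {mpoly int[#|bases vamos|]} :=
  plucker_var vamos (i |: (j |: S)) * plucker_var vamos (k |: (l |: S)).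

Lemma plucker_prodl S i j k l : plucker_prod S i j k l = plucker_prod S j i k l.
Proof. by rewrite /plucker_prod finset.setUCA. Qed.

Lemma plucker_prodr S i j k l : plucker_prod S i j k l = plucker_prod S i j l k.
Proof. by congr (_ * plucker_var _ _); apply: finset.setUCA. Qed.

Lemma plucker_prodC S i j k l : plucker_prod S i j k l = plucker_prod S k l i j.
Proof. exact: mulrC. Qed.

(** Distinctness of the monomials travels with the shape: it makes the support depend on the terms
    only up to order, so the sign changes caused by the swaps below are harmless. *)
Definition good_quad (S : {set 'I_8}) (i j k l : 'I_8) : Prop :=
  exists x1 x2 x3 : option 'X_{1..#|bases vamos|},
  [/\ plucker_prod S i j k l = mnm_poly x1, plucker_prod S i k j l = mnm_poly x2,
      plucker_prod S i l j k = mnm_poly x3, uniq (pmap id [:: x1; x2; x3]) &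
      rel_shape (mnm_poly x1 - mnm_poly x2 + mnm_poly x3)].

Lemma good_quad_shape S i j k l : good_quad S i j k l ->
  rel_shape (three_term_plucker vamos S i j k l).
Proof. by case=> [x1 [x2 [x3 [e1 e2 e3 _]]]]; rewrite -e1 -e2 -e3. Qed.

Lemma good_swap (n : nat) (x1 x2 x3 y1 y2 y3 : option 'X_{1..n}) :
  perm_eq [:: x1; x2; x3] [:: y1; y2; y3] -> uniq (pmap id [:: x1; x2; x3]) ->
  uniq (pmap id [:: y1; y2; y3]) /\
  perm_eq (msupp (mnm_poly y1 - mnm_poly y2 + mnm_poly y3))
          (msupp (mnm_poly x1 - mnm_poly x2 + mnm_poly x3)).
Proof.
move=> p u; have p' := perm_pmap id p.
have u' : uniq (pmap id [:: y1; y2; y3]) by rewrite -(perm_uniq p').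
split=> //; apply: perm_trans (msupp_three u') _.
by rewrite perm_sym; apply: perm_trans (msupp_three u) p'.
Qed.

Lemma perm3_swap12 (T : eqType) (a b c : T) : perm_eq [:: a; b; c] [:: b; a; c].
Proof. by apply/permP => p /=; rewrite addnCA. Qed.

Lemma perm3_swap23 (T : eqType) (a b c : T) : perm_eq [:: a; b; c] [:: a; c; b].
Proof. by apply/permP => p /=; congr (_ + _)%N; rewrite addnCA. Qed.

Lemma good_quad_swap12 S i j k l : good_quad S i j k l -> good_quad S j i k l.
Proof.
move=> [x1 [x2 [x3 [e1 e2 e3 u sh]]]]; exists x1, x3, x2.
have [u' p] := good_swap (perm3_swap23 x1 x2 x3) u; split=> //.
- by rewrite plucker_prodl.
- by rewrite plucker_prodC.
- by rewrite plucker_prodC.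
- exact: rel_shape_perm p sh.
Qed.

Lemma good_quad_swap23 S i j k l : good_quad S i j k l -> good_quad S i k j l.
Proof.
move=> [x1 [x2 [x3 [e1 e2 e3 u sh]]]]; exists x2, x1, x3.
have [u' p] := good_swap (perm3_swap12 x1 x2 x3) u; split=> //.
- by rewrite plucker_prodr.
- exact: rel_shape_perm p sh.
Qed.

Lemma good_quad_swap34 S i j k l : good_quad S i j k l -> good_quad S i j l k.
Proof.
move=> [x1 [x2 [x3 [e1 e2 e3 u sh]]]]; exists x1, x3, x2.
have [u' p] := good_swap (perm3_swap23 x1 x2 x3) u; split=> //.
- by rewrite plucker_prodr.
- exact: rel_shape_perm p sh.
Qed.

(** Insertion by adjacent transpositions: [H1] places the last index among three sorted ones, [H2]
    the third among two. *)
Lemma good_quad_sort S : let P i j k l := good_quad S i j k l in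
  (forall i j k l : 'I_8, (i < j)%N -> (j < k)%N -> (k < l)%N ->
    all (fun x => x \notin S) [:: i; j; k; l] -> P i j k l) ->
  forall i j k l : 'I_8, uniq [:: i; j; k; l] ->
    all (fun x => x \notin S) [:: i; j; k; l] -> P i j k l.
Proof.
move=> P H.
have H1 (i j k l : 'I_8) : (i < j)%N -> (j < k)%N -> l != i -> l != j -> l != k ->
    all (fun x => x \notin S) [:: i; j; k; l] -> P i j k l.
  move=> ij jk li lj lk /= /and5P[Si Sj Sk Sl _].
  have [kl|lk'] := ltnP k l; first by apply: H => //=; rewrite Si Sj Sk Sl.
  have {}lk : (l < k)%N by rewrite ltn_neqAle lk lk'.
  apply: good_quad_swap34; have [jl|lj'] := ltnP j l.
    by apply: H => //=; rewrite Si Sj Sk Sl.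
  have {}lj : (l < j)%N by rewrite ltn_neqAle lj lj'.
  apply: good_quad_swap23; have [il|li'] := ltnP i l.
    by apply: H => //=; rewrite Si Sj Sk Sl.
  have {}li : (l < i)%N by rewrite ltn_neqAle li li'.
  by apply: good_quad_swap12; apply: H => //=; rewrite Si Sj Sk Sl.
have H2 (i j k l : 'I_8) : (i < j)%N -> k != i -> k != j -> l != i -> l != j -> l != k ->
    all (fun x => x \notin S) [:: i; j; k; l] -> P i j k l.
  move=> ij ki kj li lj lk /= /and5P[Si Sj Sk Sl _].
  have [jk|kj'] := ltnP j k; first by apply: H1 => //=; rewrite Si Sj Sk Sl.
  have {}kj : (k < j)%N by rewrite ltn_neqAle kj kj'.
  apply: good_quad_swap23; have [ik|ki'] := ltnP i k.
    by apply: H1 => //=; rewrite Si Sj Sk Sl.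
  have {}ki : (k < i)%N by rewrite ltn_neqAle ki ki'.
  by apply: good_quad_swap12; apply: H1 => //=; rewrite Si Sj Sk Sl.
move=> i j k l; rewrite /= !inE !negb_or => /and4P[/and3P[ij ik il] /andP[jk jl] kl _].
move=> /and5P[Si Sj Sk Sl _].
have [lt|le] := ltnP i j; first by apply: H2; rewrite 1?eq_sym //= Si Sj Sk Sl.
apply: good_quad_swap12; apply: H2; rewrite 1?eq_sym //= ?Si ?Sj ?Sk ?Sl //.
by rewrite ltn_neqAle le andbT eq_sym.
Qed.

Lemma mem_increasing_pairs (i j : 'I_8) : (i < j)%N -> (i : nat, j : nat) \in increasing_pairs.
Proof.
move=> ij; rewrite mem_filter ij; apply/allpairsP; exists (i : nat, j : nat).
by rewrite !mem_iota /= !ltn_ord.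
Qed.

Lemma plucker_shape f : plucker_relations vamos f -> rel_shape f.
Proof.
move=> [S [i [j [k [l [[cS] u nS ->]]]]]]; apply: good_quad_shape.
apply: good_quad_sort u nS => {}i {}j {}k {}l ij jk kl nS.
have [c [d [cd eS]]] : exists c d : 'I_8, (c < d)%N /\ S = [set c; d]%SET.
  have /eqP/cards2P[c [d [cd eS]]] := cS.
  have [lt|le] := ltnP c d; first by exists c, d.
  exists d, c; split; last by rewrite finset.setUC.
  by rewrite ltn_neqAle le andbT eq_sym.
set q := [:: c : nat; d : nat; i : nat; j : nat; k : nat; l : nat].
have qr : q \in relations.
  rewrite mem_filter; apply/andP; split; first (apply/andP; split; last exact: jk).
    have : uniq (map val [:: c; d; i; j; k; l]); last by [].
    rewrite map_inj_uniq; last exact: val_inj.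
    have ne (x : 'I_8) : x \notin S -> (c != x) && (d != x).
      by rewrite eS !inE negb_or !(eq_sym _ x).
    move: nS => /and5P[/ne/andP[? ?] /ne/andP[? ?] /ne/andP[? ?] /ne/andP[? ?] _].
    have lt (x y : 'I_8) : (x < y)%N -> x != y.
      by move=> xy; apply: contraTneq xy => ->; rewrite ltnn.
    rewrite /= !inE !negb_or; do ?[apply/andP; split] => //; apply: lt => //.
    - exact: ltn_trans jk.
    - exact: ltn_trans (ltn_trans ij jk) kl.
    - exact: ltn_trans kl.
  apply/allpairsP; exists ((c : nat, d : nat), [:: i : nat; j : nat; k : nat; l : nat]).
  split; rewrite ?mem_increasing_pairs //.
  apply/allpairsP; exists ((i : nat, j : nat), (k : nat, l : nat)).
  by rewrite !mem_increasing_pairs.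
have chk := allP relation_checkP _ qr.
have dq : distinct_terms q by case/andP: chk.
exists (term_mnm (term1 q)), (term_mnm (term2 q)), (term_mnm (term3 q)).
split; rewrite ?eS.
- by rewrite -plucker_termE /plucker_prod !set4E.
- by rewrite -plucker_termE /plucker_prod !set4E.
- by rewrite -plucker_termE /plucker_prod !set4E.
- exact: relation_mnms_uniq.
- exact: relation_shape.
Qed.

Lemma triple_relation t : t \in triples -> exists f u1 u2 u3,
  [/\ plucker_relations vamos f, perm_eq (msupp f) [:: u1; u2; u3] &
  forall z, exists b, [/\ weight (emb z) u1 = b + tcoord z t.1.1,
      weight (emb z) u2 = b + tcoord z t.1.2 & weight (emb z) u3 = b + tcoord z t.2]].
Proof.
move=> tt; have /hasP[t' + pt] := allP triple_ofP _ tt.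
rewrite mem_pmap => /mapP[q qr]; rewrite /triple_of.
case: ifP; last by [].
move=> /andP[/and4P[b1 b2 b3 _] tr] /Some_inj et'.
have chk := allP relation_checkP _ qr.
have dq : distinct_terms q by case/andP: chk.
have := msupp_relation dq; rewrite /relation_mnms.
have := @term_mnm_basis (term1 q) (size_bits_of _) (size_bits_of _).
rewrite b1; case E1 : (term_mnm (term1 q)) => [u1|] // _.
have := @term_mnm_basis (term2 q) (size_bits_of _) (size_bits_of _).
rewrite b2; case E2 : (term_mnm (term2 q)) => [u2|] // _.
have := @term_mnm_basis (term3 q) (size_bits_of _) (size_bits_of _).
rewrite b3; case E3 : (term_mnm (term3 q)) => [u3|] // _ p.
move: chk => /andP[_]; rewrite [map _ _]/= b1 b2 b3 /= /three_check.
have T1 z := term_weight_emb z b1; have T2 z := term_weight_emb z b2.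
have T3 z := term_weight_emb z b3.
move: tr et' T1 T2 T3; move: (term_vec vamos_table (term1 q))
  (term_vec vamos_table (term2 q)) (term_vec vamos_table (term3 q)) => a b c.
move: (residues a b c) => rs /and4P[/eqP r1 /eqP r2 /eqP r3 _] et' T1 T2 T3 /and3P[h1 h2 _].
have [|w1 [w2 [w3 [pw hw]]]] := shape3_permuted p pt.
  move=> z; have [d [k1 k2 k3]] := triple_weights z h1 h2.
  exists d; rewrite et' /= (weight_term _ E1) (weight_term _ E2) (weight_term _ E3).
  by rewrite T1 T2 T3 k1 k2 k3 r1 r2 r3 /= !addr0.
by exists (relation_poly q), w1, w2, w3; split=> //; apply: relation_poly_plucker.
Qed.

Lemma step_relation st : st \in steps -> exists f u1 u2,
  [/\ plucker_relations vamos f, u1 \in msupp f, u2 \in msupp f,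
      (forall w, step_diff w st.2 = weight w u1 - weight w u2) &
      st.1.1 = 0%N -> perm_eq (msupp f) [:: u1; u2]].
Proof.
move=> ss; have := allP step_checkP _ ss; case: st {ss} => -[e b] q.
move=> /and5P[dq b1 b2 _ /andP[b3 _]].
have := msupp_relation dq; rewrite /relation_mnms.
have := @term_mnm_basis (term1 q) (size_bits_of _) (size_bits_of _).
rewrite b1; case E1 : (term_mnm (term1 q)) => [u1|] // _.
have := @term_mnm_basis (term2 q) (size_bits_of _) (size_bits_of _).
rewrite b2; case E2 : (term_mnm (term2 q)) => [u2|] // _ p.
exists (relation_poly q), u1, u2; split.
- exact: relation_poly_plucker.
- by rewrite (perm_mem p) mem_head.
- by rewrite (perm_mem p) in_cons mem_head orbT.
- by move=> w; rewrite (weight_term _ E1) (weight_term _ E2).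
move=> /= e0; move: b3 p; rewrite e0 orbF -(@term_mnm_basis (term3 q)) ?size_bits_of //.
by case: (term_mnm (term3 q)).
Qed.

End Shapes.

(** * Triangles and the four-point condition *)

Section Squares.
Variable R : realFieldType.
Implicit Types a b c x y z : R.

Definition is_min a b c : bool := (a <= b) && (a <= c).

Lemma is_minC a b c : is_min a b c = is_min a c b. Proof. exact: andbC. Qed.

Lemma holds_is_min d a b c : holds d a b c ->
  [/\ is_min a b c = (d != C1), is_min b a c = (d != C2) & is_min c a b = (d != C3)].
Proof.
rewrite /is_min; case: d => /= -[e l].
- by rewrite e l lexx.
- by rewrite -e lexx (ltW l) leNgt l.
- by rewrite -e lexx (ltW l) leNgt l.
- by rewrite -e lexx (ltW l) !leNgt l.
Qed.

Lemma min_twiceP a b c :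
  reflect (min_twice a b c) (2 <= is_min a b c + is_min b a c + is_min c a b)%N.
Proof.
apply: (iffP idP) => [|/min_twice_holds/holds_is_min[-> -> ->]]; last by case: code_of.
rewrite /is_min; case: (ltrgtP a b) => ab; case: (ltrgtP a c) => ac; case: (ltrgtP b c) => bc //= _;
  first [by constructor 1; split; lra | by constructor 2; split; lra
       | by constructor 3; split; lra].
Qed.

Definition ties_kept a b c a' b' c' : bool :=
  [&& is_min a b c ==> is_min a' b' c', is_min b a c ==> is_min b' a' c' &
      is_min c a b ==> is_min c' a' b'].

Lemma codele_ties a b c a' b' c' : min_twice a b c -> min_twice a' b' c' ->
  codele (code_of a b c) (code_of a' b' c') = ties_kept a b c a' b' c'.
Proof.
move=> /min_twice_holds/holds_is_min[h1 h2 h3] /min_twice_holds/holds_is_min[k1 k2 k3].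
rewrite /ties_kept h1 h2 h3 k1 k2 k3.
by case: code_of; case: code_of.
Qed.

Lemma min_twice_sym12 a b c : min_twice a b c -> min_twice b a c.
Proof.
move=> /min_twiceP h; apply/min_twiceP.
by rewrite [(is_min b a c + _)%N]addnC (is_minC c).
Qed.

Lemma min_twice_sym23 a b c : min_twice a b c -> min_twice a c b.
Proof.
move=> /min_twiceP h; apply/min_twiceP.
by rewrite -addnA [(is_min c a b + _)%N]addnC addnA (is_minC a).
Qed.

Lemma min_twice_or a b c : min_twice a b c -> a <= b \/ c <= b.
Proof. by case=> -[e l]; [left; rewrite e|left|right; rewrite e]. Qed.

(* The four-point condition: the three sums of opposite entries of an
   ultrametric on four points again attain their minimum twice, and where the
   minimum is attained is determined by the four triangles. *)
Lemma is_min_sum a1 a2 b1 b2 c1 c2 :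
  min_twice a1 b1 c1 -> min_twice a1 b2 c2 -> min_twice a2 b1 c2 -> min_twice a2 b2 c1 ->
  is_min (a1 + a2) (b1 + b2) (c1 + c2) =
  (is_min a1 b1 c1 || is_min a1 b2 c2) && (is_min a2 b1 c2 || is_min a2 b2 c1).
Proof.
move=> t1 t2 t3 t4; apply/idP/idP.
  move=> /andP[hB hC].
  have strict a b c : min_twice a b c -> ~~ is_min a b c -> b = c /\ b < a.
    move=> /min_twice_holds h; have [-> _ _] := holds_is_min h; move: h.
    by case: code_of.
  apply/andP; split; rewrite -[_ || _]negbK negb_or; apply/negP.
    move=> /andP[/(strict _ _ _ t1)[e1 l1] /(strict _ _ _ t2)[e2 l2]].
    by case: t3 => -[]; lra.
  move=> /andP[/(strict _ _ _ t3)[e1 l1] /(strict _ _ _ t4)[e2 l2]].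
  by case: t1 => -[]; lra.
move=> /andP[/orP[/andP[h1 h2]|/andP[h1 h2]] /orP[/andP[h3 h4]|/andP[h3 h4]]]; apply/andP.
- by split; [have [] := min_twice_or t2|]; lra.
- by split; [|have [] := min_twice_or (min_twice_sym23 t2)]; lra.
- by split; [|have [] := min_twice_or (min_twice_sym23 t1)]; lra.
- by split; [have [] := min_twice_or t1|]; lra.
Qed.

Definition square_at (a1 a2 b1 b2 c1 c2 : R) : Prop :=
  [/\ min_twice a1 b1 c1, min_twice a1 b2 c2, min_twice a2 b1 c2 & min_twice a2 b2 c1].

Lemma square_is_min a1 a2 b1 b2 c1 c2 : square_at a1 a2 b1 b2 c1 c2 ->
  [/\ is_min (a1 + a2) (b1 + b2) (c1 + c2) =
        (is_min a1 b1 c1 || is_min a1 b2 c2) && (is_min a2 b1 c2 || is_min a2 b2 c1),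
      is_min (b1 + b2) (a1 + a2) (c1 + c2) =
        (is_min b1 a1 c1 || is_min b1 a2 c2) && (is_min b2 a1 c2 || is_min b2 a2 c1) &
      is_min (c1 + c2) (a1 + a2) (b1 + b2) =
        (is_min c1 a1 b1 || is_min c1 a2 b2) && (is_min c2 a2 b1 || is_min c2 a1 b2)].
Proof.
move=> [t1 t2 t3 t4].
have s1 := min_twice_sym12 t1; have s2 := min_twice_sym12 t2.
have s3 := min_twice_sym12 t3; have s4 := min_twice_sym12 t4.
split; [exact: is_min_sum|exact: is_min_sum|].
rewrite is_minC (is_min_sum (b1 := b1) (b2 := b2) (c1 := a1) (c2 := a2)).
- by rewrite (is_minC c1) (is_minC c1 b2) (is_minC c2 b1) (is_minC c2 b2).
- exact: min_twice_sym12 (min_twice_sym23 s1).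
- exact: min_twice_sym12 (min_twice_sym23 s4).
- exact: min_twice_sym12 (min_twice_sym23 s3).
- exact: min_twice_sym12 (min_twice_sym23 s2).
Qed.

(** The formulas of [square_is_min] reduce this to the 256 combinations of codes of the four
    triangles. *)
Lemma square_min_twice a1 a2 b1 b2 c1 c2 : square_at a1 a2 b1 b2 c1 c2 ->
  min_twice (a1 + a2) (b1 + b2) (c1 + c2).
Proof.
move=> sq; have [e1 e2 e3] := square_is_min sq; apply/min_twiceP; rewrite e1 e2 e3.
case: sq => /min_twice_holds/holds_is_min[-> -> ->] /min_twice_holds/holds_is_min[-> -> ->].
move=> /min_twice_holds/holds_is_min[-> -> ->] /min_twice_holds/holds_is_min[-> -> ->].
by do 4!case: code_of.
Qed.

(** By [square_is_min], minimality among the sums is a monotone Boolean function of minimality in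
    the triangles. *)
Lemma square_ties a1 a2 b1 b2 c1 c2 a1' a2' b1' b2' c1' c2' :
  square_at a1 a2 b1 b2 c1 c2 -> square_at a1' a2' b1' b2' c1' c2' ->
  ties_kept a1 b1 c1 a1' b1' c1' -> ties_kept a1 b2 c2 a1' b2' c2' ->
  ties_kept a2 b1 c2 a2' b1' c2' -> ties_kept a2 b2 c1 a2' b2' c1' ->
  ties_kept (a1 + a2) (b1 + b2) (c1 + c2) (a1' + a2') (b1' + b2') (c1' + c2').
Proof.
move=> /square_is_min[e1 e2 e3] /square_is_min[k1 k2 k3].
rewrite /ties_kept e1 e2 e3 k1 k2 k3.
move=> /and3P[/implyP i1 /implyP i2 /implyP i3] /and3P[/implyP i4 /implyP i5 /implyP i6].
move=> /and3P[/implyP i7 /implyP i8 /implyP i9] /and3P[/implyP i10 /implyP i11 /implyP i12].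
by apply/and3P; split; apply/implyP => /andP[/orP[] h /orP[] h']; apply/andP; split; apply/orP;
  first [by left; auto | by right; auto].
Qed.

End Squares.

(** * The Dressian in the coordinates of the 4-cube *)

Section MinSupp.
Variables (R : realType) (n : nat).
Implicit Types (f : {mpoly int[n]}) (w : 'rV[R]_n).

Lemma size_min_supp f w ms : perm_eq (msupp f) ms ->
  size (min_supp f w) = count (fun u => all (fun v => weight w u <= weight w v) ms) ms.
Proof.
move=> p; rewrite size_filter (permP p); apply: eq_count => u.
exact: perm_all.
Qed.

Lemma mem_min_supp_perm f w ms u : perm_eq (msupp f) ms ->
  (u \in min_supp f w) = (u \in ms) && all (fun v => weight w u <= weight w v) ms.
Proof. by move=> p; rewrite mem_filter (perm_mem p) (perm_all _ p) andbC. Qed.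

Lemma perm_msupp_neq0 f u s : perm_eq (msupp f) (u :: s) -> f <> 0.
Proof. by move=> /perm_size e f0; move: e; rewrite f0 msupp0. Qed.

Lemma trop2P f w u1 u2 : perm_eq (msupp f) [:: u1; u2] ->
  trop f w <-> weight w u1 = weight w u2.
Proof.
move=> p; rewrite /trop /= (size_min_supp _ p) /= !lexx /= !andbT !addn0.
split=> [[/(perm_msupp_neq0 p)//|]|->]; last by right; rewrite lexx.
by case: ltrgtP.
Qed.

Lemma trop3P f w u1 u2 u3 : perm_eq (msupp f) [:: u1; u2; u3] ->
  trop f w <-> min_twice (weight w u1) (weight w u2) (weight w u3).
Proof.
move=> p; rewrite /trop /= (size_min_supp _ p) /= !lexx /= !andbT addn0 addnA.
rewrite (rwP (min_twiceP _ _ _)) /is_min.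
by split=> [[/(perm_msupp_neq0 p)//|]|]; [|right].
Qed.

Lemma ties3P f v w u1 u2 u3 : perm_eq (msupp f) [:: u1; u2; u3] ->
  {subset min_supp f w <= min_supp f v} <->
  ties_kept (weight w u1) (weight w u2) (weight w u3)
            (weight v u1) (weight v u2) (weight v u3).
Proof.
move=> p; have memE (x : 'rV[R]_n) u := mem_min_supp_perm x u p.
have m1 (x : 'rV[R]_n) : (u1 \in min_supp f x) = is_min (weight x u1) (weight x u2) (weight x u3).
  by rewrite memE mem_head /= lexx andbT.
have m2 (x : 'rV[R]_n) : (u2 \in min_supp f x) = is_min (weight x u2) (weight x u1) (weight x u3).
  by rewrite memE !inE eqxx orbT /= lexx andbT.
have m3 (x : 'rV[R]_n) : (u3 \in min_supp f x) = is_min (weight x u3) (weight x u1) (weight x u2).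
  by rewrite memE !inE eqxx !orbT /= lexx !andbT.
split=> [h|/and3P[/implyP h1 /implyP h2 /implyP h3] u].
  by apply/and3P; split; apply/implyP; rewrite -?m1 -?m2 -?m3; apply: h.
move=> uw; have /min_supp_msupp := uw; rewrite (perm_mem p) !inE => /or3P[] /eqP e;
  move: uw; rewrite e ?m1 ?m2 ?m3; [exact: h1|exact: h2|exact: h3].
Qed.

End MinSupp.

Lemma min_twice_shift (R : realFieldType) (d a b c : R) :
  min_twice (d + a) (d + b) (d + c) <-> min_twice a b c.
Proof.
by split=> /min_twiceP h; apply/min_twiceP; move: h; rewrite /is_min !lerD2l.
Qed.

Lemma ties_kept_shift (R : realFieldType) (d a b c d' a' b' c' : R) :
  ties_kept (d + a) (d + b) (d + c) (d' + a') (d' + b') (d' + c') = ties_kept a b c a' b' c'.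
Proof. by rewrite /ties_kept /is_min !lerD2l. Qed.

Section Vamos.
Variable R : realType.
Local Notation V := 'rV[R]_#|bases vamos|.
Local Notation G := (plucker_relations vamos).
Local Notation D := (Dressian R vamos).
Implicit Types (w v l : V) (u : 'rV[R]_20) (x y : nat -> R).

Lemma vamos_relations_finite : finite_set G.
Proof.
pose F (t : {set 'I_8} * ('I_8 * 'I_8 * ('I_8 * 'I_8))) :=
  three_term_plucker vamos t.1 t.2.1.1 t.2.1.2 t.2.2.1 t.2.2.2.
apply: (@sub_finite_set _ _ (F @` setT)); last exact/finite_image/finite_finset.
by move=> _ [S [i [j [k [l [_ _ _ ->]]]]]]; exists (S, ((i, j), (k, l))).
Qed.

Lemma vamos_relations_size f : G f -> f = 0 \/ (2 <= size (msupp f) <= 3)%N.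
Proof.
move=> /(plucker_shape R); case.
- by move=> /eqP; rewrite msupp_eq0 => /eqP; left.
- by move=> u1 u2 /perm_size -> _; right.
- by move=> u1 u2 u3 t /perm_size -> _ _; right.
- by move=> u1 u2 u3 a1 a2 b1 b2 c1 c2 /perm_size -> _ _; right.
Qed.

Let finG := vamos_relations_finite.
Let L := lineality R finG.
Local Notation cone := (cone G).

Definition zext u (i : nat) : R := if (i < 20)%N then u 0 (inord i) else 0.

Lemma tcoord_zext u e : (e <= 20)%N -> tcoord (zext u) e = coord_ext u e.
Proof. by case: e => //= e e20; rewrite /zext e20. Qed.

(** The gauge coordinates are set to 0. By [sigmaK] and [lineality_ycoords] the image meets the
    lineality space only in 0, and by [flat_sigma] it represents every flat point modulo
    lineality. *)
Definition sigma u : V := emb (zext u).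

Lemma sigmaD u u' : sigma (u + u') = sigma u + sigma u'.
Proof.
by rewrite -embD; apply: eq_emb => i; rewrite /zext; case: ifP; rewrite ?addr0 // mxE.
Qed.

Lemma sigmaZ (a : R) u : sigma (a *: u) = a *: sigma u.
Proof.
by rewrite -embZ; apply: eq_emb => i; rewrite /zext; case: ifP; rewrite ?mulr0 // mxE.
Qed.

Definition ycoords w : 'rV[R]_20 := \row_j y_coord w j.+1.

Lemma step_of_mem e : (0 < e <= 20)%N -> step_of e \in steps /\ (step_of e).1.1 = e.
Proof.
move=> e20; have /eqP he := allP step_ofP e (etrans (mem_iota 1 20 e) e20).
split=> //; apply/mem_nth; rewrite ltnNge; apply/negP => le.
by move: he e20; rewrite /step_of nth_default // => <-.
Qed.

Lemma sigmaK u : ycoords (sigma u) = u.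
Proof.
apply/rowP => j; rewrite mxE /y_coord.
have j20 : (0 < j.+1 <= 20)%N by rewrite ltn_ord.
have [sm se] := step_of_mem j20.
have := allP step_vecP j.+1 (etrans (mem_iota 1 20 _) j20).
have := allP step_checkP _ sm; case: step_of {sm se} => -[e b] q.
move=> /and5P[_ b1 b2 _ _] /(ev_eq (zext u)).
rewrite ev_vadd ev_vopp ev_sign ev_unit /step_diff (term_weight_emb _ b1) (term_weight_emb _ b2).
by move=> ->; rewrite /zext ltn_ord inord_val mulrA; case: b; rewrite ?mulrNN !mul1r.
Qed.

Lemma D_flat w : D w -> flat w.
Proof.
move=> Dw st ss e0; have [f [u1 [u2 [Gf _ _ -> p]]]] := step_relation R ss.
by apply/eqP; rewrite subr_eq0; apply/eqP/(trop2P w (p e0)); apply: Dw.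
Qed.

(** Each cube coordinate is, up to sign, the difference of the weights of two monomials of one
    relation. *)
Lemma lineality_ycoords l : l \in L -> ycoords l = 0.
Proof.
move=> /linealityP h; apply/rowP => j; rewrite !mxE /y_coord.
have j20 : (0 < j.+1 <= 20)%N by rewrite ltn_ord.
have [sm _] := step_of_mem j20; case: step_of sm => -[e b] q sm.
have [f [u1 [u2 [Gf u1f u2f -> _]]]] := step_relation R sm.
by rewrite (h f Gf u1 u2) // subrr mulr0.
Qed.

Lemma is_triple_le (i j k : nat) : is_triple i j k -> [&& i <= 20, j <= 20 & k <= 20]%N.
Proof.
move=> /is_tripleP[t /triples_le h]; rewrite /permuted !inE.
by do 5?[case/orP]; move=> /eqP e; move: h; rewrite e /= => /and3P[-> -> ->].
Qed.

Lemma emb_lineality z : (forall e, (e <= 20)%N -> tcoord z e = 0) -> emb z \in L.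
Proof.
move=> z0; apply/linealityP => f Gf.
have same ms : perm_eq (msupp f) ms -> (exists b, all (fun m => weight (emb z) m == b) ms) ->
    forall m m', m \in msupp f -> m' \in msupp f -> weight (emb z) m = weight (emb z) m'.
  by move=> p [b /allP h] m m'; rewrite !(perm_mem p) => /h/eqP-> /h/eqP->.
case: (plucker_shape R Gf).
- by move=> -> u u'.
- by move=> u1 u2 p h; apply: same p _; exists (weight (emb z) u2); rewrite /= h !eqxx.
- move=> u1 u2 u3 t p /triples_le/and3P[h1 h2 h3] /(_ z)[b [k1 k2 k3]].
  by apply: same p _; exists b; rewrite /= k1 k2 k3 !z0 // !addr0 eqxx.
- move=> u1 u2 u3 a1 a2 b1 b2 c1 c2 p.
  move=> /and4P[/is_triple_le/and3P[? ? ?] _ /is_triple_le/and3P[? ? ?] /is_triple_le/and3P[? ? ?]].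
  by move=> /(_ z)[b [k1 k2 k3]]; apply: same p _; exists b; rewrite /= k1 k2 k3 !z0 // !addr0 eqxx.
Qed.

Lemma flat_sigma w : flat w -> w - sigma (ycoords w) \in L.
Proof.
move=> fw; rewrite -{1}(emb_z_coord fw) -scaleN1r -embZ -embD; apply: emb_lineality.
case=> //= e e20; rewrite /z_coord /zext e20 mxE inordK //.
by rewrite mulN1r subrr.
Qed.

Lemma is_triple_min_twice x i j k : valid x -> is_triple i j k -> min_twice (x i) (x j) (x k).
Proof.
move=> [_ vx] /is_tripleP[t /vx]; rewrite /permuted !inE.
move=> + h; do 5?[case/orP: h => h]; move: h => /eqP-> //= m.
- exact: min_twice_sym23.
- exact: min_twice_sym12.
- exact: min_twice_sym12 (min_twice_sym23 m).
- exact: min_twice_sym23 (min_twice_sym12 m).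
- exact: min_twice_sym12 (min_twice_sym23 (min_twice_sym12 m)).
Qed.

Lemma patle_patternP x y : patle (pattern x) (pattern y) <->
  forall t, t \in triples -> codele (code_of (x t.1.1) (x t.1.2) (x t.2))
                                    (code_of (y t.1.1) (y t.1.2) (y t.2)).
Proof.
rewrite /patle /pattern; elim: triples => //= t s IH; split=> [/andP[h /IH hs] t'|h].
  by rewrite in_cons => /orP[/eqP->|/hs].
apply/andP; split; first by apply: h; rewrite mem_head.
by apply/IH => t' ts; apply: h; rewrite in_cons ts orbT.
Qed.

(** Every triple occurs as a relation, which gives one direction. For the other, the square
    relations follow from their four triangles. *)
Lemma D_sigma u : D (sigma u) <-> valid (coord_ext u).
Proof.
split=> [Du|vu].
  split=> // t tt; have [f [u1 [u2 [u3 [Gf p hz]]]]] := triple_relation R tt.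
  have [b [k1 k2 k3]] := hz (zext u).
  have /and3P[h1 h2 h3] := triples_le tt.
  have /(trop3P _ p) := Du f Gf; rewrite k1 k2 k3 !tcoord_zext //.
  by move/min_twice_shift.
move=> f Gf; case: (plucker_shape R Gf).
- by move=> /eqP; rewrite msupp_eq0 => /eqP f0; left.
- by move=> u1 u2 p h; apply/(trop2P _ p)/h.
- move=> u1 u2 u3 t p tt /(_ (zext u))[b [k1 k2 k3]].
  have /and3P[h1 h2 h3] := triples_le tt.
  by apply/(trop3P _ p); rewrite k1 k2 k3 !tcoord_zext // min_twice_shift; apply: vu.2.
- move=> u1 u2 u3 a1 a2 b1 b2 c1 c2 p /and4P[q1 q2 q3 q4] /(_ (zext u))[b [k1 k2 k3]].
  have /and3P[? ? ?] := is_triple_le q1; have /and3P[? ? ?] := is_triple_le q2.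
  have /and3P[? ? ?] := is_triple_le q3.
  apply/(trop3P _ p); rewrite k1 k2 k3 !tcoord_zext // min_twice_shift.
  by apply: square_min_twice; split; apply: is_triple_min_twice.
Qed.

Lemma is_triple_ties x y i j k : valid x -> valid y -> patle (pattern x) (pattern y) ->
  is_triple i j k -> ties_kept (x i) (x j) (x k) (y i) (y j) (y k).
Proof.
move=> vx vy /patle_patternP le /is_tripleP[t tt].
have := le t tt; rewrite codele_ties; [|exact: vx.2|exact: vy.2].
rewrite /permuted !inE /ties_kept => + h.
by do 5?[case/orP: h => h]; move: h => /eqP-> /= /and3P[h1 h2 h3]; apply/and3P; split;
  rewrite ?(is_minC (x _) (x i)) ?(is_minC (y _) (y i));
  first [exact: h1|exact: h2|exact: h3|by rewrite is_minC [X in _ ==> X]is_minC;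
    first [exact: h1|exact: h2|exact: h3]].
Qed.

(** Square relations impose no further ties: [square_ties] derives theirs from the triangles, so the
    pattern over [triples] determines the cone. *)
Lemma cone_sigma u u' : valid (coord_ext u) -> cone (sigma u) (sigma u') <->
  valid (coord_ext u') /\ patle (pattern (coord_ext u)) (pattern (coord_ext u')).
Proof.
move=> vu; split=> [h|[vu' le]].
  have vu' : valid (coord_ext u').
    by apply/D_sigma; apply: cone_sub_D h; apply/D_sigma.
  split=> //; apply/patle_patternP => t tt.
  have [f [u1 [u2 [u3 [Gf p hz]]]]] := triple_relation R tt.
  have [b [k1 k2 k3]] := hz (zext u); have [b' [l1 l2 l3]] := hz (zext u').
  have /and3P[h1 h2 h3] := triples_le tt.
  have /(ties3P _ _ p) := h f Gf; rewrite k1 k2 k3 l1 l2 l3 !tcoord_zext // ties_kept_shift.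
  by rewrite codele_ties //; [apply: vu.2|apply: vu'.2].
move=> f Gf; case: (plucker_shape R Gf).
- by move=> e w0 /min_supp_msupp; rewrite e.
- move=> u1 u2 p hz w0; rewrite !(mem_min_supp_perm _ _ p) => /andP[m _]; rewrite m /=.
  by move: m; rewrite !inE => /orP[] /eqP->; rewrite -hz !lexx.
- move=> u1 u2 u3 t p tt hz; apply/(ties3P _ _ p).
  have [b [k1 k2 k3]] := hz (zext u); have [b' [l1 l2 l3]] := hz (zext u').
  have /and3P[h1 h2 h3] := triples_le tt.
  rewrite k1 k2 k3 l1 l2 l3 !tcoord_zext // ties_kept_shift -codele_ties.
  + by move/patle_patternP: le; apply.
  + exact: vu.2.
  + exact: vu'.2.
- move=> u1 u2 u3 a1 a2 b1 b2 c1 c2 p /and4P[q1 q2 q3 q4] hz; apply/(ties3P _ _ p).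
  have [b [k1 k2 k3]] := hz (zext u); have [b' [l1 l2 l3]] := hz (zext u').
  have /and3P[? ? ?] := is_triple_le q1; have /and3P[? ? ?] := is_triple_le q2.
  have /and3P[? ? ?] := is_triple_le q3.
  rewrite k1 k2 k3 l1 l2 l3 !tcoord_zext // ties_kept_shift.
  by apply: square_ties; first [split; exact: is_triple_min_twice|exact: is_triple_ties].
Qed.

Lemma D_sigma_ycoords w : D w -> w - sigma (ycoords w) \in L /\ valid (coord_ext (ycoords w)).
Proof.
move=> Dw; have lL := flat_sigma (D_flat Dw); split=> //; apply/D_sigma.
have := D_lineality (finG := finG) (sigma (ycoords w)) lL.
by rewrite addrC subrK => -[h _]; exact: h Dw.
Qed.

Lemma cone_ycoords w v : D w -> cone w v <->
  [/\ v - sigma (ycoords v) \in L, valid (coord_ext (ycoords v)) &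
      patle (pattern (coord_ext (ycoords w))) (pattern (coord_ext (ycoords v)))].
Proof.
move=> Dw; have [wL vw] := D_sigma_ycoords Dw.
have e : cone w v <-> cone (sigma (ycoords w)) v.
  rewrite -{1}(subrK (sigma (ycoords w)) w) addrC.
  by split=> h f Gf a; have := h f Gf a; rewrite (lineality_min_supp _ Gf wL).
have conv : v - sigma (ycoords v) \in L ->
    cone (sigma (ycoords w)) v <-> cone (sigma (ycoords w)) (sigma (ycoords v)).
  by move=> vL; rewrite -{1}(subrK (sigma (ycoords v)) v) addrC; apply: cone_lineality.
split=> [h|[vL vv le]].
  have [vL vv] := D_sigma_ycoords (cone_sub_D Dw h); split=> //.
  by move/e/(conv vL): h => /(cone_sigma _ vw)[].
by apply/e/(conv vL)/(cone_sigma _ vw).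
Qed.

End Vamos.

Lemma card_eq_image_seq (T : eqType) (U : Type) (s : seq T) (F : T -> U) : uniq s ->
  {in s &, injective F} -> ([set F p | p in [set` s]] #= `I_(size s))%card.
Proof.
case: s => [|x0 s'] us Finj.
  rewrite II0 card_eq0; apply/eqP/seteqP; split=> // y [p].
  by rewrite /= in_nil.
set s := x0 :: s' in us Finj *.
have -> : [set F p | p in [set` s]] = [set F (nth x0 s i) | i in `I_(size s)].
  apply/seteqP; split=> y [p ps <-]; last by exists (nth x0 s p) => //=; apply: mem_nth.
  by exists (index p s); [exact: etrans (index_mem p s) ps | rewrite nth_index].
apply: inj_card_eq => i j /set_mem i_s /set_mem js e; apply/eqP.
by rewrite -(nth_uniq x0 i_s js us); apply/eqP/Finj; rewrite ?mem_nth.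
Qed.

(** * The cells of the Dressian *)

Section Cells.
Variable R : realType.
Local Notation V := 'rV[R]_#|bases vamos|.
Local Notation G := (plucker_relations vamos).
Local Notation D := (Dressian R vamos).
Let finG := vamos_relations_finite.
Let L := lineality R finG.
Variables (m : nat) (q : 'Hom(V, 'rV[R]_m)) (r : R).
Hypotheses (qP : is_quotient_map L q) (r_gt0 : 0 < r).
Let K := spherical_cells q r (Dressian_fan R vamos).
Local Notation cell := (cell G q r).
Local Notation pat w := (pattern (coord_ext (ycoords w))).

Lemma cell_pattern w w' : D w -> D w' -> pat w = pat w' -> cell w = cell w'.
Proof.
move=> Dw Dw' e; rewrite /cell; congr ((q @` _) `&` _); apply/seteqP.
by split=> v; rewrite !(cone_ycoords _ Dw) !(cone_ycoords _ Dw') e.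
Qed.

Lemma cell_pattern_inj w w' : D w -> D w' -> cell w !=set0 -> cell w = cell w' ->
  pat w = pat w'.
Proof.
move=> Dw Dw' w0 e.
have cE := cell_inj qP r_gt0 Dw Dw' w0 e.
have h : cone G w w' by rewrite cE; apply: cone_refl.
have h' : cone G w' w by rewrite -cE; apply: cone_refl.
move: h h' => /(cone_ycoords _ Dw)[_ _ h] /(cone_ycoords _ Dw')[_ _ h'].
exact: patle_anti h h'.
Qed.

Lemma q_sigma0 u : q (sigma u) = 0 -> u = 0.
Proof.
move=> /eqP; rewrite -memv_ker qP.1 => h.
by rewrite -(sigmaK u) (lineality_ycoords h).
Qed.

(** Points of the cone satisfy the ties of [w], which bounds the span from above. The bound is
    reached because [w] can be moved a little along any solution of the ties, and the dimension is
    kept since [q] is injective on the image of [sigma]. *)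
Lemma cell_span w : D w ->
  exists2 U : {vspace 'rV[R]_m}, is_span (cell w) U & \dim U = pattern_dim (pat w).
Proof.
move=> Dw; have [wL vw] := D_sigma_ycoords Dw; set p := pat w.
have [B [Binj BP]] := class_basis R p.
pose phi (z : 'rV[R]_(pattern_dim p)) := q (sigma (z *m B)).
have phi_lin : linear phi.
  by move=> a z z'; rewrite /phi mulmxDl -scalemxAl sigmaD sigmaZ linearD linearZ.
pose Phi := GRing.isLinear.Build _ _ _ _ phi phi_lin.
pose phil : {linear 'rV[R]_(pattern_dim p) -> 'rV[R]_m} := HB.pack phi Phi.
have phiE z : linfun phil z = phi z by rewrite lfunE.
exists (limg (linfun phil)); last first.
  rewrite limg_dim_eq ?dimvf; first by rewrite /dim /= mul1n.
  apply/eqP; rewrite -subv0; apply/subvP => z; rewrite memv_cap => /andP[_].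
  by rewrite memv_ker phiE memv0 => /eqP/q_sigma0/Binj ->.
have tied u : (forall t c, (t, c) \in zip triples p -> code_tied (coord_ext u) t c) <->
    exists z, u = z *m B by rewrite classesP -BP.
split=> [x [[v wv <-] _]|U' sub].
  have [vL vv le] := (cone_ycoords v Dw).1 wv.
  have [z ez] : exists z, ycoords v = z *m B.
    by apply/tied => t c; apply: patle_tied le.
  apply/memv_imgP; exists z; rewrite ?memvf // phiE /phi -ez.
  exact/(quotient_eq qP).
have coneU v : cone G w v -> q v \in U'.
  move=> wv; have [->|q0] := eqVneq (q v) 0; first exact: mem0v.
  have [c c0 cr] := sphere_normalize r_gt0 q0.
  rewrite -[q v](scalerK (lt0r_neq0 c0)) memvZ //; apply: sub; split=> //.
  by exists (c *: v); rewrite ?linearZ //; apply: coneZ.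
apply/subvP => _ /memv_imgP[z _ ->]; rewrite phiE /phi; set u := z *m B.
have [|e e0 [ve pe]] := relint_perturb vw (erefl : coord_ext u 0 = 0).
  by apply/tied; exists z.
have extE i : (i <= 20)%N -> coord_ext (ycoords w) i + e * coord_ext u i =
    coord_ext (ycoords w + e *: u) i by rewrite coord_extD coord_extZ.
have [ve' pe'] := eq_valid extE ve.
have inU : q (sigma (ycoords w + e *: u)) \in U'.
  apply: coneU; apply/(cone_ycoords _ Dw); rewrite sigmaK subrr mem0v.
  by split=> //; rewrite pe' pe patle_refl.
have inU0 : q (sigma (ycoords w)) \in U'.
  apply: coneU; apply/(cone_ycoords _ Dw); rewrite sigmaK subrr mem0v.
  by split=> //; rewrite patle_refl.
(* Both ends of the perturbation lie in the cone, so their difference recovers the direction [u]. *)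
have := memvB inU inU0; rewrite sigmaD sigmaZ linearD linearZ addrAC subrr add0r.
by move=> /(memvZ e^-1); rewrite scalerK // gt_eqF.
Qed.

(** An empty cell has span 0, so a positive number of classes already makes the cell nonempty. *)
Lemma cell_dimP w i : D w ->
  (cell w !=set0 /\ has_cell_dim (cell w) i) <-> pattern_dim (pat w) = i.+1.
Proof.
move=> Dw; have [U [sU mU] dU] := cell_span Dw; split=> [[_ [U' [sU' mU'] dU']]|e].
  rewrite -dU -dU'; congr (\dim _); apply/eqP.
  by rewrite eqEsubv mU ?mU'.
split; last by exists U => //; rewrite dU.
apply/set0P/eqP => c0; move: dU; rewrite e.
have := mU 0%VS; rewrite c0 subv0 => /(_ _)/eqP -> //.
by rewrite dimv0.
Qed.

Lemma pattern_realized p (x : nat -> R) : valid x -> pattern x = p ->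
  exists2 w : V, D w & pat w = p.
Proof.
move=> vx <-; pose u : 'rV[R]_20 := \row_j x j.+1.
have e i : (i <= 20)%N -> x i = coord_ext u i by move=> i20; rewrite coord_ext_row ?vx.1.
have [vu pu] := eq_valid e vx.
by exists (sigma u); [apply/D_sigma|rewrite sigmaK].
Qed.

Lemma cellsE : K = [set X | X !=set0 /\ exists2 w, D w & X = cell w].
Proof. exact: (spherical_cellsE finG). Qed.

Lemma pattern_points : exists (s : seq (seq code)) (pt : seq code -> V),
  [/\ uniq s, forall w, D w -> pat w \in s,
      forall p, p \in s -> D (pt p) /\ pat (pt p) = p &
      forall i, count (fun p => pattern_dim p == i.+1) s =
        nth 0%N [:: 201; 2014; 6810; 9581; 5425; 896; 72; 18; 2]%N i].
Proof.
have [s [us sP sc]] := cell_patterns R.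
have /choice[pt hpt] : forall p, exists w : V, p \in s -> D w /\ pat w = p.
  move=> p; have [/sP[x vx px]|nps] := boolP (p \in s); last by exists 0.
  by have [w Dw pw] := pattern_realized vx px; exists w.
exists s, pt; split=> // w Dw.
by apply/sP; exists (coord_ext (ycoords w)) => //; have [] := D_sigma_ycoords Dw.
Qed.

Lemma vamos_f_vector i :
  ([set X | K X /\ has_cell_dim X i] #=
   `I_(nth 0%N [:: 201; 2014; 6810; 9581; 5425; 896; 72; 18; 2]%N i))%card.
Proof.
have [s [pt [us sP hpt sc]]] := pattern_points.
rewrite -sc -size_filter; set s' := [seq p <- s | _].
have s'P p : p \in s' -> [/\ D (pt p), pat (pt p) = p &
    cell (pt p) !=set0 /\ has_cell_dim (cell (pt p)) i].
  rewrite mem_filter => /andP[/eqP dp /hpt[Dp ep]]; split=> //.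
  by apply/(cell_dimP _ Dp); rewrite ep.
have -> : [set X | K X /\ has_cell_dim X i] = [set cell (pt p) | p in [set` s']].
  apply/seteqP; split=> X.
    rewrite cellsE => -[[X0 [w Dw eX]] dX].
    have dw : pattern_dim (pat w) = i.+1 by apply/(cell_dimP _ Dw); rewrite -eX.
    exists (pat w); first by rewrite /= mem_filter dw eqxx sP.
    by rewrite eX; have [Dp ep] := hpt _ (sP _ Dw); apply: cell_pattern.
  move=> [p /= ps <-]; have [Dp ep [c0 cd]] := s'P _ ps; split=> //.
  by rewrite cellsE; split=> //; exists (pt p).
apply: card_eq_image_seq; first exact: filter_uniq.
move=> p p' ps ps' e; have [Dp ep [c0 _]] := s'P _ ps; have [Dp' ep' _] := s'P _ ps'.
by rewrite -ep -ep'; apply: cell_pattern_inj.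
Qed.

Lemma cells_finite : finite_set K.
Proof.
have [s [pt [us sP hpt _]]] := pattern_points.
apply: (@sub_finite_set _ _ [set cell (pt p) | p in [set` s]]); last first.
  exact/finite_image/finite_seq.
move=> X; rewrite cellsE => -[_ [w Dw ->]].
by exists (pat w); [exact: sP | have [Dp ep] := hpt _ (sP _ Dw); apply: cell_pattern].
Qed.

Lemma cells_dim : has_complex_dim K 8.
Proof.
split=> [|X i KX dX].
  have := vamos_f_vector 8; case: (pselect (exists X, K X /\ has_cell_dim X 8)).
    by move=> [X [KX dX]] _; exists X.
  move=> no; rewrite (_ : [set X | _] = set0); last first.
    by apply/seteqP; split=> // X h; case: no; exists X.
  (* The last entry of the list is 2, so 0 is an element of a set that would have to be empty. *)
  by rewrite card_eq_sym card_eq0 => /eqP/seteqP[/(_ 0%N)] /(_ isT).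
(* Past the end of the list the entries default to 0, which rules out larger cells. *)
rewrite leqNgt; apply/negP => i8; have := vamos_f_vector i.
rewrite nth_default // II0 card_eq0 => /eqP/seteqP[/(_ X)] h _.
by apply: h.
Qed.

End Cells.

Theorem proposition4p3 (R : realType) :
  exists L : {vspace 'rV[R]_#|bases vamos|},
    is_lineality_space (Dressian R vamos) L /\
    forall (m : nat) (q : 'Hom('rV[R]_#|bases vamos|, 'rV[R]_m)) (r : R),
      is_quotient_map L q -> 0 < r ->
      let K := spherical_cells q r (Dressian_fan R vamos) in
      [/\ \bigcup_(X in K) X = (q @` Dressian R vamos) `&` sphere r,
          spherical_complex r K,
          has_complex_dim K 8
        & has_f_vector K
            [:: 201; 2014; 6810; 9581; 5425; 896; 72; 18; 2]%N].
Proof.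
exists (lineality R vamos_relations_finite).
split; first exact/lineality_spaceP/vamos_relations_size.
move=> m q r qP r0; split.
- exact: (spherical_cells_cover vamos_relations_finite).
- by apply: (spherical_complexP qP r0); apply: cells_finite.
- exact: (cells_dim qP r0).
- by move=> i; exact: (vamos_f_vector qP r0).
Qed.
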